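(* Let $\delta>0$ and let $W:\mathbb{Z}\to\mathbb{R}$ be symmetric ($W_{-\kappa}=W_\kappa$) with $\Delta^{\!\delta} W$ everywhere positive and bounded, and $$\Lambda:=2\sup_{\kappa}\big|(\Delta^{\!\delta}\Delta^{\!\delta} W)_\kappa\big|+\sup_{\kappa}\frac{\big(\Delta^{\!\delta}[(\Delta^{\!\delta} W)^2]\big)_\kappa}{(\Delta^{\!\delta} W)_\kappa}<\infty.$$ Then the semigroup $\mathfrak{S}$ on $\mathcal{P}^\delta_{2,c}$ generated by $\dot\rho_\kappa=\big(\Delta^{\!\delta}(\rho\,\Delta^{\!\delta}(W\ast_\delta\rho))\big)_\kappa$, $\kappa\in\mathbb{Z}$, is $(-\Lambda)$-contractive with respect to the energy $\mathcal{E}(\rho)=-\frac\delta2\sum_\kappa\rho_\kappa(W\ast_\delta\rho)_\kappa$.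
   Context: Fix $\delta>0$. For $f:\mathbb{Z}\to\mathbb{R}$, $(\Delta^{\!\delta} f)_\kappa=(f_{\kappa+1}+f_{\kappa-1}-2f_\kappa)/\delta^2$; the discrete convolution is $(f\ast_\delta g)_\kappa=\delta\sum_\lambda f_\lambda g_{\kappa-\lambda}$; products and squares are pointwise. $\mathcal{P}^\delta_{2,c}$ is the set of $\rho:\mathbb{Z}\to[0,\infty)$ with $\delta\sum_\kappa\rho_\kappa=1$, $\delta\sum_\kappa(\delta\kappa)^2\rho_\kappa<\infty$, $\delta\sum_\kappa(\delta\kappa)\rho_\kappa=0$. Define $Q(p,r)=p^2/r$ if $r>0$, $Q(0,0)=0$, $Q(p,0)=+\infty$ if $p\ne0$. $\mathcal{C}(\rho^0,\rho^1)$ is the set of pairs $(\rho,\mathfrak{w})$, $\rho:[0,1]\to\mathcal{P}^\delta_{2,c}$, $\mathfrak{w}:[0,1]\to\ell^2$, with $\rho(0)=\rho^0$, $\rho(1)=\rho^1$, $\rho_\kappa\in H^1(0,1)$, $\mathfrak{w}_\kappa\in L^2(0,1)$ and $\dot\rho_\kappa=(\Delta^{\!\delta}\mathfrak{w})_\kappa$ a.e., for each $\kappa$. ${\mathbb{D}}^\delta(\rho^0,\rho^1)^2=\inf_{\mathcal{C}(\rho^0,\rho^1)}\delta\sum_\kappa\int_0^1Q(\mathfrak{w}_\kappa(s),\rho_\kappa(s))\,ds$. A semigroup $\mathfrak{S}$ on $\mathcal{P}^\delta_{2,c}$ is $\lambda$-contractive with respect to $\mathcal{E}$ if for all $\bar\rho,\bar\eta\in\mathcal{P}^\delta_{2,c}$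 with ${\mathbb{D}}^\delta(\bar\rho,\bar\eta)<\infty$: $$\limsup_{t\downarrow0}\frac{{\mathbb{D}}^\delta(\mathfrak{S}^t\bar\rho,\bar\eta)^2-{\mathbb{D}}^\delta(\bar\rho,\bar\eta)^2}{2t}+\frac\lambda2{\mathbb{D}}^\delta(\bar\rho,\bar\eta)^2\le\mathcal{E}(\bar\eta)-\mathcal{E}(\bar\rho).$$ *)

(* Defs.v *)
From HB Require Import structures.
From mathcomp Require Import all_boot all_order all_algebra.
From mathcomp Require Import all_classical all_reals all_analysis.
Set Implicit Arguments. Unset Strict Implicit. Unset Printing Implicit Defensive.
Import Order.TTheory GRing.Theory Num.Theory.
Import numFieldNormedType.Exports.
Local Open Scope classical_set_scope.
Local Open Scope ring_scope.

Section Defs.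
Variable R : realType.
Implicit Types (d : R) (f g rho : int -> R).

(* sum over Z of an absolutely summable real family: positive part minus negative part *)
Definition zsum (f : int -> R) : R :=
  fine (\esum_(k in [set: int]) (Num.max (f k) 0)%:E)
  - fine (\esum_(k in [set: int]) (Num.max (- f k) 0)%:E).

Definition dlap d f : int -> R :=
  fun k => (f (k + 1) + f (k - 1) - 2 * f k) / d ^+ 2.

Definition dconv d f g : int -> R := fun k => d * zsum (fun l => f l * g (k - l)).

Definition Pdelta d rho : Prop :=
  [/\ (forall k, 0 <= rho k),
      (d%:E * (\esum_(k in [set: int]) (rho k)%:E) = 1)%E,
      ((\esum_(k in [set: int]) (((d * k%:~R) ^+ 2) * rho k)%:E) < +oo)%E &
      d * zsum (fun k => (d * k%:~R) * rho k) = 0].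

Definition Qf (p r : R) : \bar R :=
  if 0 < r then (p ^+ 2 / r)%:E else if p == 0 then 0%E else +oo%E.

Definition admissible d (rho0 rho1 : int -> R) (rho w : R -> int -> R) : Prop :=
  [/\ (forall s, s \in `[0%R, 1%R] -> Pdelta d (rho s)),
      rho 0 = rho0 /\ rho 1 = rho1,
      (forall s, s \in `[0%R, 1%R] -> ((\esum_(k in [set: int]) ((w s k) ^+ 2)%:E) < +oo)%E),
      (forall k, measurable_fun (`[0%R, 1%R] : set R) (fun s => w s k) /\
         ((\int[lebesgue_measure]_(s in (`[0%R, 1%R] : set R)) ((w s k) ^+ 2)%:E) < +oo)%E) &
      (* rho_k in H^1(0,1) (continuous representative) with weak derivative
         (Delta^delta w)_k : rho_k(t) = rho_k(0) + int_0^t (Delta w(s))_k ds *)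
      (forall k t, t \in `[0%R, 1%R] ->
         rho t k = rho 0 k
                   + Rintegral lebesgue_measure (`[0%R, t] : set R) (fun s => dlap d (w s) k))].

Definition action d (rho w : R -> int -> R) : \bar R :=
  (d%:E * \esum_(k in [set: int])
            \int[lebesgue_measure]_(s in (`[0%R, 1%R] : set R)) Qf (w s k) (rho s k))%E.

Definition D2 d (rho0 rho1 : int -> R) : \bar R :=
  ereal_inf [set c | exists (rho w : R -> int -> R), admissible d rho0 rho1 rho w /\ c = action d rho w].

Definition energy d (W : int -> R) rho : R :=
  - (d / 2) * zsum (fun k => rho k * dconv d W rho k).

Definition rhs d (W : int -> R) rho : int -> R :=
  dlap d (fun k => rho k * dlap d (dconv d W rho) k).

Definition Lambda d (W : int -> R) : R :=
  2 * sup (range (fun k => `| dlap d (dlap d W) k |))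
  + sup (range (fun k => dlap d (fun j => (dlap d W j) ^+ 2) k / dlap d W k)).

Definition generated_semigroup d (W : int -> R) (S : R -> (int -> R) -> (int -> R)) : Prop :=
  [/\ (forall rb, Pdelta d rb -> S 0 rb = rb),
      (forall rb t, Pdelta d rb -> 0 <= t -> Pdelta d (S t rb)),
      (forall rb t s, Pdelta d rb -> 0 <= t -> 0 <= s -> S (t + s) rb = S t (S s rb)),
      (forall rb k, Pdelta d rb ->
         (fun t => S t rb k) @ 0^'+ --> rb k) &
      (forall rb k t, Pdelta d rb -> 0 < t ->
         derivable (fun tau => S tau rb k) t 1 /\
         derive1 (fun tau => S tau rb k) t = rhs d W (S t rb) k)].

Definition lambda_contractive d (lam : R) (S : R -> (int -> R) -> (int -> R))
    (E : (int -> R) -> R) : Prop :=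
  forall rb eb, Pdelta d rb -> Pdelta d eb -> (D2 d rb eb < +oo)%E ->
    (limf_esup (fun t : R => ((D2 d (S t rb) eb - D2 d rb eb) * ((2 * t)^-1)%:E)%E) 0^'+
     + ((lam / 2) * fine (D2 d rb eb))%:E <= (E eb - E rb)%:E)%E.

End Defs.

(* Main.v *)
(** Write [V = dlap W], [K = dlap V], [v = V * rho] (convolution), so that the
flow is [rho' = dlap (rho v)]. Given a curve [(rho s, w s)] from [a] to [b] of
action [A], the explicit Euler step of variable length [(1 - s) t],
[rho s + (1 - s) t dlap (rho s v s)], is a curve from the Euler step of [a] to
[b]. The conditions on [W] bound its action by
[(1 + t Lambda) A + 2 t (E b - E a) + O(t^2)]: the term [dlap (V^2) / V]
controls the neighbours in the weighted flux (it passes from [V] to [v] by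
convexity of [(x^2 + y^2) / z]), the term [K] controls the variation of [v]
along the curve, and the energy difference appears because
[E b - E a = - d \int \sum_k w v]. The solution [S t a] and the Euler step of
[a] differ by [dlap q] with [|q| <= 2 M t S t a] and [|q|_1 = O(t^2)], hence
they are joined by a curve of action [O(t^3)]. Spending the time fraction
[z t] on this initial layer costs [O(t^2) / z + O(z t)]; dividing by [2 t],
letting [t] and then [z] tend to [0] gives the evolution variational
inequality. *)

Require Import Defs.
From HB Require Import structures.
From mathcomp Require Import all_boot all_order all_algebra.
From mathcomp Require Import all_classical all_reals all_analysis.
From mathcomp Require Import measurable_realfun ring lra.
Import Order.TTheory GRing.Theory Num.Theory.
Import numFieldNormedType.Exports.
Local Open Scope classical_set_scope.
Local Open Scope ring_scope.
Set Implicit Arguments.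
Unset Strict Implicit.
Unset Printing Implicit Defensive.

(** * Summation over the integers *)

(** The Euler step stands in for the flow because it is an explicit quadratic expression in the
    density: it can be applied to every point of a curve that is merely absolutely continuous, and
    the solution is never differentiated in its initial datum. The semigroup enters only through the
    one trajectory that starts at [a]. The length [(1 - s) t] vanishes at [s = 1], which keeps the
    endpoint [b]; its derivative adds [- t rho v] to the flux, and the cross term of this with [w]
    is the power that integrates to the energy difference. Minimising curves are not assumed to
    exist: the curve has action at most [D + t ^ 2] and changes with [t], so every error constant
    must depend on [d], [M], [L1], [L2] and the action alone. In [Lambda], the factor 2 of [L1]
    comes from a cross term as well, that of [w] with the change [u = K * w] of the velocity; [L2]
    comes from the mass received from the neighbours, whose velocities differ from that at the site.
    The restriction [4 t M <= d ^ 2] is the stability condition of the explicit scheme: at most half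
    of the mass at a site moves. *)

Definition int_of_enum (n : nat) : int :=
  if odd n then Negz n./2 else Posz n./2.

Definition enum_of_int (k : int) : nat :=
  match k with Posz n => n.*2 | Negz n => n.*2.+1 end.

Lemma int_of_enumK : cancel int_of_enum enum_of_int.
Proof.
move=> n; rewrite /int_of_enum; case: ifP => /= on.
  by rewrite -[RHS]odd_double_half on.
by rewrite -[RHS]odd_double_half on.
Qed.

Lemma enum_of_intK : cancel enum_of_int int_of_enum.
Proof.
by case=> n; rewrite /int_of_enum/= ?odd_double/= ?doubleK ?uphalf_double.
Qed.

Section zsum_theory.
Variable R : realType.
Implicit Types (f g : int -> R).
Local Notation cnt := (@counting nat R).
Local Notation iz := int_of_enum.

(** Through the enumeration of the integers, sums become integrals for the counting measure on
    [nat], so that linearity, dominated convergence and Tonelli are inherited from integration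
    theory. *)
Lemma esum_counting (a : int -> \bar R) : (forall k, (0 <= a k)%E) ->
  (\esum_(k in [set: int]) a k = \int[cnt]_n a (iz n))%E.
Proof.
move=> a0; rewrite ge0_integral_count// nneseries_esumT//.
apply: reindex_esum; split => //.
  by move=> x y _ _; exact: (can_inj int_of_enumK).
by move=> k _; exists (enum_of_int k) => //; rewrite enum_of_intK.
Qed.

(** Outside this class [zsum] may be a default value, since [fine] sends [+oo] to [0]; the algebraic
    rules below are therefore restricted to it. *)
Definition zsummable f : Prop :=
  (\esum_(k in [set: int]) `|f k|%:E < +oo)%E.

Lemma zsummableP f : zsummable f <-> cnt.-integrable setT (EFin \o (f \o iz)).
Proof.
rewrite /zsummable esum_counting; last by move=> k; rewrite lee_fin.
split=> [h|/integrableP[_ //]].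
by apply/integrableP; split.
Qed.

Lemma zsumE f : zsummable f -> zsum f = \int[cnt]_n f (iz n).
Proof.
move=> /zsummableP sf; rewrite /zsum /Rintegral integralE.
have h1 := integrable_pos_fin_num (@measurableT _ nat) sf.
have h2 := integrable_neg_fin_num (@measurableT _ nat) sf.
rewrite fineB//; congr (fine _ - fine _).
  rewrite esum_counting; last by move=> k; rewrite lee_fin le_max lexx orbT.
  by apply: eq_integral => n _; rewrite /= funeposE/= EFin_max.
rewrite esum_counting; last by move=> k; rewrite lee_fin le_max lexx orbT.
by apply: eq_integral => n _; rewrite /= funenegE/= EFin_max.
Qed.

Lemma eq_zsum f g : f =1 g -> zsum f = zsum g.
Proof. by move=> fg; congr zsum; apply/funext. Qed.

Lemma eq_zsummable f g : f =1 g -> zsummable f -> zsummable g.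
Proof. by move=> fg; have -> : f = g by apply/funext. Qed.

Lemma zsummable_le f g : (forall k, `|f k| <= g k) -> zsummable g -> zsummable f.
Proof.
move=> fg; apply: le_lt_trans; apply: le_esum => k _; rewrite lee_fin.
exact: le_trans (fg k) (ler_norm _).
Qed.

Lemma zsummable_norm f : zsummable f -> zsummable (fun k => `|f k|).
Proof.
by apply: le_lt_trans; apply: le_esum => k _; rewrite normr_id.
Qed.

Lemma zsummableD f g : zsummable f -> zsummable g ->
  zsummable (fun k => f k + g k).
Proof.
move=> /zsummableP sf /zsummableP sg; apply/zsummableP.
exact: (integrableD (@measurableT _ nat) sf sg).
Qed.

Lemma zsummableZ c f : zsummable f -> zsummable (fun k => c * f k).
Proof.
move=> /zsummableP sf; apply/zsummableP.
exact: (integrableZl (@measurableT _ nat) c sf).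
Qed.

Lemma zsummableN f : zsummable f -> zsummable (fun k => - f k).
Proof.
by move=> /(zsummableZ (-1)); apply: eq_zsummable => k; rewrite mulN1r.
Qed.

Lemma zsummableB f g : zsummable f -> zsummable g ->
  zsummable (fun k => f k - g k).
Proof. by move=> sf sg; apply: zsummableD => //; exact: zsummableN. Qed.

Lemma zsummableM C (b : int -> R) f : (forall k, `|b k| <= C) ->
  zsummable f -> zsummable (fun k => b k * f k).
Proof.
move=> bC /zsummable_norm/(zsummableZ C); apply: zsummable_le => k.
by rewrite normrM ler_wpM2r.
Qed.

Lemma zsumD f g : zsummable f -> zsummable g ->
  zsum (fun k => f k + g k) = zsum f + zsum g.
Proof.
move=> sf sg; rewrite !zsumE//; last exact: zsummableD.
by rewrite RintegralD//; exact/zsummableP.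
Qed.

Lemma zsumZ c f : zsummable f -> zsum (fun k => c * f k) = c * zsum f.
Proof.
move=> sf; rewrite !zsumE//; last exact: zsummableZ.
by rewrite RintegralZl//; exact/zsummableP.
Qed.

Lemma zsumN f : zsummable f -> zsum (fun k => - f k) = - zsum f.
Proof.
move=> sf; rewrite -[RHS]mulN1r -zsumZ//; apply: eq_zsum => k.
by rewrite mulN1r.
Qed.

Lemma zsumB f g : zsummable f -> zsummable g ->
  zsum (fun k => f k - g k) = zsum f - zsum g.
Proof. by move=> sf sg; rewrite zsumD ?zsumN//; exact: zsummableN. Qed.

Lemma ler_zsum f g : zsummable f -> zsummable g -> (forall k, f k <= g k) ->
  zsum f <= zsum g.
Proof.
by move=> sf sg fg; rewrite !zsumE//; apply: le_Rintegral => //; exact/zsummableP.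
Qed.

Lemma zsum_ge0 f : (forall k, 0 <= f k) -> 0 <= zsum f.
Proof.
move=> f0; rewrite /zsum subr_ge0.
rewrite [X in fine X <= _]esum1 ?fine_ge0//.
  by apply: esum_ge0 => k _; rewrite lee_fin le_max lexx orbT.
by move=> k _; congr EFin; apply/max_idPr; rewrite oppr_le0.
Qed.

Lemma ler_norm_zsum f : zsummable f -> `|zsum f| <= zsum (fun k => `|f k|).
Proof.
move=> sf; rewrite !zsumE//; last exact: zsummable_norm.
by apply: le_normr_Rintegral => //; exact/zsummableP.
Qed.

Lemma esum_zsum f : (forall k, 0 <= f k) -> zsummable f ->
  (\esum_(k in [set: int]) (f k)%:E)%E = (zsum f)%:E.
Proof.
move=> f0 sf; rewrite zsumE// /Rintegral fineK.
  by rewrite esum_counting.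
by apply: integrable_fin_num => //; apply/zsummableP.
Qed.

Lemma zsummable_esum f : (forall k, 0 <= f k) ->
  (\esum_(k in [set: int]) (f k)%:E < +oo)%E -> zsummable f.
Proof.
move=> f0; apply: le_lt_trans; apply: le_esum => k _.
by rewrite ger0_norm.
Qed.

Let set_bijT (h : int -> int) : bijective h -> set_bij [set: int] [set: int] h.
Proof.
move=> [h' hK h'K]; split => //; first by move=> x y _ _; exact: (can_inj hK).
by move=> k _; exists (h' k).
Qed.

Lemma reindex_zsum (h : int -> int) f : bijective h ->
  zsum (fun k => f (h k)) = zsum f.
Proof.
move=> bh; rewrite /zsum; congr (fine _ - fine _); apply/esym.
  by apply: (reindex_esum setT setT); exact: set_bijT.
by apply: (reindex_esum setT setT); exact: set_bijT.
Qed.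

Lemma reindex_zsummable (h : int -> int) f : bijective h ->
  zsummable f -> zsummable (fun k => f (h k)).
Proof.
move=> bh; rewrite /zsummable (reindex_esum setT setT h)//.
exact: set_bijT.
Qed.

Lemma bij_shift (l : int) : bijective (fun k => k + l).
Proof. by exists (fun k => k - l) => k; rewrite (addrK, subrK). Qed.

Lemma bij_reflect (l : int) : bijective (fun k => l - k).
Proof. by exists (fun k => l - k) => k; rewrite opprB addrC subrK. Qed.

Lemma ler_zsum_term f k : (forall l, 0 <= f l) -> zsummable f -> f k <= zsum f.
Proof.
move=> f0 sf; rewrite -lee_fin -esum_zsum//.
rewrite (esumID [set k])/=; last by move=> l _; rewrite lee_fin.
rewrite setTI esum_set1 ?lee_fin// leeDl// esum_ge0// => l _.
by rewrite lee_fin.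
Qed.

Lemma zsum_eq0 f k : (forall l, 0 <= f l) -> zsummable f -> zsum f = 0 -> f k = 0.
Proof.
by move=> f0 sf s0; apply/eqP; rewrite eq_le f0 andbT -s0 ler_zsum_term.
Qed.

Lemma zsum_dominated (F : nat -> int -> R) f g :
  (forall k, F ^~ k @ \oo --> f k) -> zsummable g ->
  (forall n k, `|F n k| <= g k) ->
  zsum (F n) @[n --> \oo] --> zsum f.
Proof.
move=> Ff sg Fg.
have sF n : zsummable (F n) by apply: zsummable_le sg; exact: Fg.
have sf : zsummable f.
  apply: zsummable_le sg => k.
  have /(_ _) h := @cvg_norm _ _ _ _ _ _ _ (Ff k).
  rewrite leNgt; apply/negP => gf.
  have /cvgr_gt/(_ _ gf)[n _ /(_ n (leqnn n))] := h.
  by rewrite ltNge Fg.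
have [] := @dominated_convergence _ nat R cnt setT measurableT
   (fun n m => (F n (iz m))%:E) (fun m => (f (iz m))%:E) (fun m => (g (iz m))%:E).
- by move=> n.
- by [].
- by apply: aeW => m _; apply/fine_cvgP; split; [exact: nearW|exact: Ff].
- exact/zsummableP.
- by apply: aeW => m n _; rewrite lee_fin Fg.
move=> _ _ h.
rewrite zsumE//; under eq_fun do rewrite zsumE//.
by apply: fine_cvg; rewrite fineK//; apply: integrable_fin_num => //; exact/zsummableP.
Unshelve. all: by end_near. Qed.

Lemma measurable_zsum d (T : measurableType d) (D : set T) (F : T -> int -> R) :
  (forall k, measurable_fun D (F ^~ k)) ->
  measurable_fun D (fun x => zsum (F x)).
Proof.
move=> mF.
have h (G : T -> int -> R) : (forall k, measurable_fun D (G ^~ k)) ->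
    (forall x k, 0 <= G x k) ->
    measurable_fun D ((fun x => \esum_(k in [set: int]) (G x k)%:E)%E : T -> \bar R).
  move=> mG G0.
  rewrite (_ : (fun x => _) = (fun x => \sum_(n <oo) (G x (iz n))%:E)%E).
    apply: ge0_emeasurable_sum => [n x Dx _|n _].
      by rewrite lee_fin.
    exact/measurable_EFinP.
  apply/funext => x.
  rewrite esum_counting ?ge0_integral_count// => k; rewrite lee_fin; exact: G0.
apply: measurable_funB.
  apply: measurableT_comp => //; apply: h => [k|x k].
    by apply: measurable_maxr => //; exact: measurable_cst.
  by rewrite le_max lexx orbT.
apply: measurableT_comp => //; apply: h => [k|x k].
  apply: measurable_maxr => //; exact: measurableT_comp.
by rewrite le_max lexx orbT.
Qed.

Lemma ge0_integral_esum d (T : measurableType d) (mu : {measure set T -> \bar R})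
    (D : set T) (F : T -> int -> \bar R) : measurable D ->
  (forall k, measurable_fun D (F ^~ k : T -> \bar R)) ->
  (forall x k, D x -> (0 <= F x k)%E) ->
  (\int[mu]_(x in D) (\esum_(k in [set: int]) F x k) =
   \esum_(k in [set: int]) \int[mu]_(x in D) F x k)%E.
Proof.
move=> mD mF F0.
rewrite esum_counting; last by move=> k; apply: integral_ge0 => x Dx; exact: F0.
rewrite ge0_integral_count; last by move=> k; apply: integral_ge0 => x Dx; exact: F0.
rewrite -integral_nneseries//; last by move=> n x Dx; exact: F0.
apply: eq_integral => x /set_mem Dx.
rewrite esum_counting; last by move=> k; exact: F0.
by rewrite ge0_integral_count// => n; exact: F0.
Qed.

Section zsum_integral.
Context d (T : measurableType d) (mu : {measure set T -> \bar R}).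
Variables (D : set T) (F : T -> int -> R) (g : T -> R).
Hypotheses (mD : measurable D) (mF : forall k, measurable_fun D (F ^~ k)).
Hypothesis sF : forall x, D x -> zsummable (F x).
Hypothesis ig : mu.-integrable D (EFin \o g).
Hypothesis Fg : forall x, D x -> zsum (fun k => `|F x k|) <= g x.

Lemma integrable_zsum : mu.-integrable D (EFin \o (fun x => zsum (F x))).
Proof.
apply: le_integrable ig => //.
  exact/measurable_EFinP/measurable_zsum.
move=> x Dx; rewrite /= lee_fin.
rewrite (le_trans (ler_norm_zsum (sF Dx)))// (le_trans (Fg Dx))//.
exact: ler_norm.
Qed.

Lemma integrable_zsum_term k : mu.-integrable D (EFin \o (F ^~ k)).
Proof.
apply: le_integrable ig => //; first exact/measurable_EFinP.
move=> x Dx; rewrite /= lee_fin.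
rewrite (le_trans (@ler_zsum_term (fun k => `|F x k|) k _ _))//.
  by apply: zsummable_norm; exact: sF.
by rewrite (le_trans (Fg Dx))// ler_norm.
Qed.

Let normF_lty :
  (\esum_(k in [set: int]) \int[mu]_(x in D) `|F x k|%:E < +oo)%E.
Proof.
rewrite -ge0_integral_esum//; last first.
  by move=> k; apply/measurable_EFinP; exact: measurableT_comp.
have /integrableP[_] := ig; apply: le_lt_trans.
apply: ge0_le_integral => //.
- by move=> x Dx; apply: esum_ge0.
- apply: (@eq_measurable_fun _ _ _ _ _ (fun x => (zsum (fun k => `|F x k|))%:E)).
    move=> x /set_mem Dx; rewrite esum_zsum//.
    by apply: zsummable_norm; exact: sF.
  apply/measurable_EFinP/measurable_zsum => k; exact: measurableT_comp.
- by apply: measurableT_comp => //; case/integrableP: ig.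
move=> x Dx; rewrite esum_zsum//; last by apply: zsummable_norm; exact: sF.
by rewrite lee_fin (le_trans (Fg Dx))// ler_norm.
Qed.

Lemma zsummable_integral : zsummable (fun k => \int[mu]_(x in D) F x k).
Proof.
apply: le_lt_trans normF_lty; apply: le_esum => k _.
have iF := integrable_zsum_term k.
rewrite EFin_normr_Rintegral//; apply: le_abse_integral => //.
exact/measurable_EFinP.
Qed.

(** Fubini for a sum and an integral. Since [zsum] is a difference of two nonnegative sums, Tonelli
    is applied to the positive and the negative part separately. *)
Lemma zsum_integral :
  \int[mu]_(x in D) zsum (F x) = zsum (fun k => \int[mu]_(x in D) F x k).
Proof.
have iF := integrable_zsum_term.
have pE x k : Num.max (F x k) 0 = (`|F x k| + F x k) / 2.
  by case: (ltP (F x k) 0) => h;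
     [rewrite ltr0_norm | rewrite ger0_norm]; lra.
have nE x k : Num.max (- F x k) 0 = (`|F x k| - F x k) / 2.
  by case: (ltP (- F x k) 0) => h;
     [rewrite ger0_norm | rewrite ler0_norm]; lra.
(* Tonelli for a family squeezed between [0] and [|F|], together with the integrability facts needed
   to subtract two such identities. *)
have ge0_swap (G : T -> int -> R) : (forall x k, 0 <= G x k <= `|F x k|) ->
    (forall k, measurable_fun D (G ^~ k)) ->
    \int[mu]_(x in D) zsum (G x) = zsum (fun k => \int[mu]_(x in D) G x k) /\
    mu.-integrable D (EFin \o (fun x => zsum (G x))) /\
    zsummable (fun k => \int[mu]_(x in D) G x k) /\
    (forall x, D x -> zsummable (G x)).
  move=> GF mG.
  have G0 x k : 0 <= G x k by case/andP: (GF x k).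
  have iG k : mu.-integrable D (EFin \o (G ^~ k)).
    apply: le_integrable (iF k) => //; first exact/measurable_EFinP.
    by move=> x Dx; rewrite /= lee_fin ger0_norm//; case/andP: (GF x k).
  have sG x : D x -> zsummable (G x).
    move=> Dx; apply: zsummable_le (zsummable_norm (sF Dx)) => k.
    by rewrite ger0_norm//; case/andP: (GF x k).
  have sIG : zsummable (fun k => \int[mu]_(x in D) G x k).
    apply: le_lt_trans normF_lty; apply: le_esum => k _.
    rewrite EFin_normr_Rintegral//.
    rewrite gee0_abs; last by apply: integral_ge0 => x Dx; rewrite lee_fin.
    apply: ge0_le_integral => //.
    + by move=> x Dx; rewrite lee_fin.
    + exact/measurable_EFinP.
    + by apply/measurable_EFinP; exact: measurableT_comp.
    + by move=> x Dx; rewrite lee_fin; case/andP: (GF x k).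
  split; last first.
    split => //; apply: le_integrable ig => //.
      exact/measurable_EFinP/measurable_zsum.
    move=> x Dx; rewrite /= lee_fin ger0_norm; last exact: zsum_ge0.
    rewrite (le_trans _ (ler_norm _))// (le_trans _ (Fg Dx))// ler_zsum//.
      exact: sG.
      by apply: zsummable_norm; exact: sF.
    by move=> k; case/andP: (GF x k).
  rewrite /Rintegral.
  transitivity (fine (\int[mu]_(x in D) (\esum_(k in [set: int]) (G x k)%:E))%E).
    congr fine; apply: eq_integral => x /set_mem Dx.
    by rewrite esum_zsum//; exact: sG.
  rewrite ge0_integral_esum//; last first.
    by move=> x k Dx; rewrite lee_fin.
    by move=> k; exact/measurable_EFinP.
  transitivity (fine (\esum_(k in [set: int]) (\int[mu]_(x in D) G x k)%:E)%E).
    congr fine; apply: eq_esum => k _.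
    by rewrite /Rintegral fineK//; exact: (integrable_fin_num mD (iG k)).
  by rewrite esum_zsum// => k; apply: Rintegral_ge0.
have [] := ge0_swap (fun x k => Num.max (F x k) 0).
- move=> x k; rewrite le_max lexx orbT/= ge_max normr_ge0 andbT.
  exact: ler_norm.
- by move=> k; apply: measurable_maxr => //; exact: measurable_cst.
move=> eqp [ip [sp spx]].
have [] := ge0_swap (fun x k => Num.max (- F x k) 0).
- move=> x k; rewrite le_max lexx orbT/= ge_max normr_ge0 andbT.
  by rewrite -normrN ler_norm.
- by move=> k; apply: measurable_maxr => //; exact: measurableT_comp.
move=> eqn [in_ [sn snx]].
transitivity (\int[mu]_(x in D) (zsum (fun k => Num.max (F x k) 0) -
                                 zsum (fun k => Num.max (- F x k) 0))).
  apply: eq_Rintegral => x /set_mem Dx; rewrite -zsumB//; last 2 first.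
  - exact: spx.
  - exact: snx.
  by apply: eq_zsum => k; rewrite pE nE; lra.
rewrite RintegralB// eqp eqn -zsumB//; apply: eq_zsum => k.
rewrite -RintegralB//; last 2 first.
- apply: le_integrable (iF k) => //.
    apply/measurable_EFinP; apply: measurable_maxr => //; exact: measurable_cst.
  move=> x Dx; rewrite /= lee_fin ger0_norm ?le_max ?lexx ?orbT//.
  by rewrite ge_max normr_ge0 andbT ler_norm.
- apply: le_integrable (iF k) => //.
    apply/measurable_EFinP; apply: measurable_maxr => //.
    by apply: measurableT_comp => //; exact: mF.
  move=> x Dx; rewrite /= lee_fin ger0_norm ?le_max ?lexx ?orbT//.
  by rewrite ge_max normr_ge0 andbT -normrN ler_norm.
by apply: eq_Rintegral => x _; rewrite pE nE; lra.
Qed.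

End zsum_integral.
End zsum_theory.

(** * Absolutely continuous functions *)

Section bounded_integrable.
Context d (T : measurableType d) (R : realType) (mu : {measure set T -> \bar R}).
Variables (D : set T).
Hypothesis mD : measurable D.

Lemma integrable_le (f g : T -> R) : measurable_fun D f ->
  (forall x, D x -> `|f x| <= g x) -> mu.-integrable D (EFin \o g) ->
  mu.-integrable D (EFin \o f).
Proof.
move=> mf fg; apply: le_integrable => //; first exact/measurable_EFinP.
by move=> x Dx; rewrite /= lee_fin (le_trans (fg x Dx))// ler_norm.
Qed.

Lemma integrable_measurable (f : T -> R) :
  mu.-integrable D (EFin \o f) -> measurable_fun D f.
Proof. by case/integrableP => /measurable_EFinP. Qed.

Lemma integrableR_D (f g : T -> R) : mu.-integrable D (EFin \o f) ->
  mu.-integrable D (EFin \o g) -> mu.-integrable D (EFin \o (fun x => f x + g x)).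
Proof. by move=> hf hg; exact: (integrableD mD hf hg). Qed.

Lemma integrableR_Z c (f : T -> R) : mu.-integrable D (EFin \o f) ->
  mu.-integrable D (EFin \o (fun x => c * f x)).
Proof. by move=> hf; exact: (integrableZl mD c hf). Qed.

Lemma integrableR_M C (h g : T -> R) : measurable_fun D h ->
  (forall x, D x -> `|h x| <= C) -> mu.-integrable D (EFin \o g) ->
  mu.-integrable D (EFin \o (fun x => h x * g x)).
Proof.
move=> mh hC ig; apply: (@integrable_le _ (fun x => C * `|g x|)).
- by apply: measurable_funM => //; exact: integrable_measurable.
- by move=> x Dx; rewrite normrM ler_wpM2r// hC.
- by apply: integrableR_Z; exact: integrable_norm.
Qed.

End bounded_integrable.
Arguments integrableR_M {d T R mu D} mD C {h g}.

Section absolutely_continuous.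
Variable R : realType.
Local Notation mu := (@lebesgue_measure R).
Local Notation I := (`[0%R, 1%R]%classic : set R).
Implicit Types (f g p q : R -> R) (t : R).

Let J p t := \int[mu]_(s in `[0%R, t]) p s.

Lemma integrable_cst_itv a b c : mu.-integrable `[a, b] (EFin \o (fun=> c : R)).
Proof.
apply: measurable_bounded_integrable => //.
  rewrite /= lebesgue_measure_itv/=; case: ifP => _; rewrite -?EFinB ltry//.
exists `|c|; split; [by rewrite num_real|by move=> x cx y _ /=; exact: ltW].
Qed.

Lemma Rintegral_cst_itv t c : 0 <= t -> \int[mu]_(s in `[0%R, t]) c = c * t.
Proof.
move=> t0; rewrite Rintegral_cst//= lebesgue_measure_itv/= lte_fin.
case: ifPn => [_|]; first by rewrite -EFinB/= subr0.
by rewrite -leNgt => tle0; have -> : t = 0 by apply/le_anti/andP.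
Qed.

Lemma integrable_sub01 p t : t \in `[0%R, 1%R] ->
  mu.-integrable I (EFin \o p) -> mu.-integrable `[0%R, t] (EFin \o p).
Proof.
rewrite in_itv/= => /andP[t0 t1]; apply: integrableS => //.
by apply: subset_itvl; rewrite bnd_simp.
Qed.

Lemma measurable_primitive p t : mu.-integrable `[0%R, t] (EFin \o p) ->
  measurable_fun `[0%R, t] (J p).
Proof.
move=> ip; have [t0|t0] := leP 0 t; last first.
  rewrite set_itv_ge//; last by rewrite bnd_simp -ltNge.
  exact: measurable_fun_set0.
apply: subspace_continuous_measurable_fun => //.
exact: parameterized_integral_continuous.
Qed.

Lemma primitive_bound p t x : mu.-integrable `[0%R, t] (EFin \o p) ->
  x \in `[0%R, t] -> `|J p x| <= \int[mu]_(s in `[0%R, t]) `|p s|.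
Proof.
move=> ip; rewrite in_itv/= => /andP[x0 xt].
have sub : `[0%R, x] `<=` `[0%R, t] by apply: subset_itvl; rewrite bnd_simp.
have ipx : mu.-integrable `[0%R, x] (EFin \o p) by apply: integrableS ip.
rewrite (le_trans (le_normr_Rintegral _ _))//.
rewrite /Rintegral fine_le//.
- by apply: integrable_fin_num => //; exact: integrable_norm.
- by apply: integrable_fin_num => //; exact: integrable_norm.
apply: ge0_subset_integral => //.
by apply/measurable_EFinP; apply: measurableT_comp => //;
  exact: integrable_measurable ip.
Qed.

Lemma primitive_tail p t x : mu.-integrable `[0%R, t] (EFin \o p) ->
  x \in `[0%R, t] -> \int[mu]_(s in `]x, t]) p s = J p t - J p x.
Proof.
move=> ip; rewrite in_itv/= => /andP[x0 xt].
by rewrite /J Rintegral_itvB// bnd_simp.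
Qed.

Lemma integrable_primitive_mul p q t : mu.-integrable `[0%R, t] (EFin \o p) ->
  mu.-integrable `[0%R, t] (EFin \o q) ->
  mu.-integrable `[0%R, t] (EFin \o (fun x => J p x * q x)).
Proof.
move=> ip iq.
apply: (integrableR_M _ (\int[mu]_(s in `[0%R, t]) `|p s|)) => //.
  exact: measurable_primitive.
by move=> x xt; apply: primitive_bound.
Qed.

(** The integral of [p x * q y] over the triangle [x < y], computed in both orders. This carries the
    integration by parts for primitives of integrable functions without any pointwise derivative. *)
Lemma Fubini_triangle p q t : mu.-integrable `[0%R, t] (EFin \o p) ->
  mu.-integrable `[0%R, t] (EFin \o q) ->
  \int[mu]_(x in `[0%R, t]) (p x * (J q t - J q x)) =
  \int[mu]_(y in `[0%R, t]) (q y * J p y).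
Proof.
move=> ip iq.
(* Extension by [0] to the whole line, so that Fubini is used on the full product space and the
   triangle is encoded in [f]. *)
pose P := p \_ `[0%R, t]; pose Q := q \_ `[0%R, t].
have iP : mu.-integrable setT (EFin \o P).
  have /integrable_mkcond := ip.
  by rewrite restrict_EFin; apply; exact: measurable_itv.
have iQ : mu.-integrable setT (EFin \o Q).
  have /integrable_mkcond := iq.
  by rewrite restrict_EFin; apply; exact: measurable_itv.
pose f (z : measurableTypeR R * measurableTypeR R) :=
  (if z.1 < z.2 then P z.1 * Q z.2 else 0)%:E.
have mP : measurable_fun setT (P : measurableTypeR R -> measurableTypeR R).
  exact: integrable_measurable iP.
have mQ : measurable_fun setT (Q : measurableTypeR R -> measurableTypeR R).
  exact: integrable_measurable iQ.
have mf : measurable_fun setT f.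
  apply/measurable_EFinP; apply: measurable_fun_ifT => //.
    by apply: measurable_fun_ltr; [exact: measurable_fst|exact: measurable_snd].
  apply: measurable_funM.
    exact: (measurableT_comp mP measurable_fst).
  exact: (measurableT_comp mQ measurable_snd).
have iF : (mu \x mu)%E.-integrable setT f.
  apply/integrable12ltyP => //.
  apply: (@le_lt_trans _ _ (\int[mu]_x (`|P x|%:E * \int[mu]_y `|Q y|%:E)%E)%E).
    apply: ge0_le_integral => //.
    - by move=> x _; exact: integral_ge0.
    - apply: (measurable_fun_fubini_tonelli_F (abse \o f)) => //=.
      exact: measurableT_comp.
    - apply: emeasurable_funM => //.
      by apply/measurable_EFinP; exact: measurableT_comp.
    move=> x _; rewrite -ge0_integralZl//; last first.
      by apply/measurable_EFinP; exact: measurableT_comp.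
    apply: ge0_le_integral => //.
    - apply: measurableT_comp => //.
      by apply: (measurableT_comp mf); exact: pair1_measurable.
    - apply: emeasurable_funM => //.
      by apply/measurable_EFinP; exact: measurableT_comp.
    move=> y _; rewrite /f/=; case: ifP => _; rewrite lee_fin ?normrM//.
    by rewrite normr0 mulr_ge0.
  have /integrableP[_ hP] := iP; have /integrableP[_ hQ] := iQ.
  under eq_integral do rewrite muleC.
  rewrite ge0_integralZl//; last first.
    exact: integral_ge0.
    by apply/measurable_EFinP; exact: measurableT_comp.
  apply: lte_mul_pinfty.
  - exact: integral_ge0.
  - by rewrite ge0_fin_numE//; exact: integral_ge0.
  - exact: hP.
have := Fubini iF.
have -> : (\int[mu]_x \int[mu]_y f (x, y) =
           \int[mu]_(x in `[0%R, t]) (p x * (J q t - J q x))%:E)%E.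
  rewrite [RHS]integral_mkcond; apply: eq_integral => x _; rewrite patchE.
  case: ifPn => [/set_mem/= xt|/negP xt]; last first.
    apply: integral0_eq => y _; rewrite /f/=; case: ifP => // _.
    by rewrite /P patchE memNset ?mul0r// => h; apply: xt; exact: mem_set.
  rewrite -(primitive_tail iq)//.
  have iqx : mu.-integrable `]x, t] (EFin \o q).
    apply: integrableS iq => //; apply: subset_itvr; rewrite bnd_simp.
    by move: xt; rewrite in_itv/= => /andP[].
  rewrite EFinM /Rintegral fineK; last exact: integrable_fin_num.
  rewrite -integralZl// [RHS]integral_mkcond; apply: eq_integral => y _.
  move: xt; rewrite in_itv/= => /andP[x0 xt].
  rewrite patchE /f/= /P patchE /Q patchE !mem_setE/= !in_itv/= x0 xt/=.
  case: (ltP x y) => xy //=; rewrite (le_trans x0 (ltW xy))/=.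
  by case: ifP => // _; exact: (congr1 EFin (mulr0 _)).
have -> : (\int[mu]_y \int[mu]_x f (x, y) =
           \int[mu]_(y in `[0%R, t]) (q y * J p y)%:E)%E.
  rewrite [RHS]integral_mkcond; apply: eq_integral => y _; rewrite patchE.
  case: ifPn => [/set_mem/= yt|/negP yt]; last first.
    apply: integral0_eq => x _; rewrite /f/=; case: ifP => // _.
    by rewrite /Q patchE memNset ?mulr0// => h; apply: yt; exact: mem_set.
  have ipy : mu.-integrable `[0%R, y[ (EFin \o p).
    apply: integrableS ip => //; apply: subset_itvl; rewrite bnd_simp.
    by move: yt; rewrite in_itv/= => /andP[].
  rewrite /J -Rintegral_itv_bndo_bndc//.
  rewrite EFinM /Rintegral fineK; last exact: integrable_fin_num.
  rewrite -integralZl// [RHS]integral_mkcond; apply: eq_integral => x _.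
  move: yt; rewrite in_itv/= => /andP[y0 yt].
  rewrite patchE /f/= /P patchE /Q patchE !mem_setE/= !in_itv/= y0 yt/=.
  case: (ltP x y) => xy; rewrite ?andbF// (le_trans (ltW xy) yt) !andbT.
  by case: ifP => _; [rewrite mulrC|exact: (congr1 EFin (mul0r _))].
by move=> h; rewrite /Rintegral h.
Qed.

(** Inside the integral of [p], the constant [J q t] splits as [(J q t - J q x) + J q x]; the
    triangle identity turns the first part into the integral of [J p * q]. *)
Lemma primitive_mul p q t : mu.-integrable `[0%R, t] (EFin \o p) ->
  mu.-integrable `[0%R, t] (EFin \o q) ->
  J p t * J q t = \int[mu]_(x in `[0%R, t]) (p x * J q x + J p x * q x).
Proof.
move=> ip iq.
have ipq : mu.-integrable `[0%R, t] (EFin \o (fun x => J p x * q x)).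
  exact: integrable_primitive_mul.
have iqp : mu.-integrable `[0%R, t] (EFin \o (fun x => p x * J q x)).
  apply: eq_integrable (integrable_primitive_mul iq ip) => // x _.
  by rewrite /= mulrC.
have ipt : mu.-integrable `[0%R, t] (EFin \o (fun x => J q t * p x)).
  exact: integrableR_Z.
rewrite RintegralD//.
have := Fubini_triangle ip iq.
under eq_Rintegral do rewrite mulrBr mulrC.
under [in X in _ = X -> _]eq_Rintegral do rewrite mulrC.
by rewrite RintegralB// RintegralZl// => <-; rewrite /J; ring.
Qed.

(** Absolute continuity through the integral formula, the form in which [admissible] states that a
    density is in [H^1]. The derivative [g] is fixed only up to null sets. *)
Definition ac f g : Prop := mu.-integrable I (EFin \o g) /\
  forall t, t \in `[0%R, 1%R] -> f t = f 0 + \int[mu]_(s in `[0%R, t]) g s.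

Lemma ac_integrable f g t : ac f g -> t \in `[0%R, 1%R] ->
  mu.-integrable `[0%R, t] (EFin \o g).
Proof. by case=> ig _ tI; exact: integrable_sub01. Qed.

Lemma ac_measurable f g : ac f g -> measurable_fun I f.
Proof.
case=> ig fE; apply: (@eq_measurable_fun _ _ _ _ _ (fun t => f 0 + J g t)).
  by move=> t /set_mem tI; rewrite -fE.
apply: measurable_funD => //; exact: measurable_primitive.
Qed.

Lemma ac_bounded f g : ac f g -> exists C : R, forall t, t \in `[0%R, 1%R] -> `|f t| <= C.
Proof.
case=> ig fE; exists (`|f 0| + \int[mu]_(s in I) `|g s|) => t tI.
rewrite fE// (le_trans (ler_normD _ _))// lerD2l; exact: primitive_bound.
Qed.

Lemma ac_cst c : ac (fun=> c) (fun=> 0).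
Proof.
split; first exact: integrable_cst_itv.
move=> t; rewrite in_itv/= => /andP[t0 _].
by rewrite Rintegral_cst_itv// mul0r addr0.
Qed.

Lemma ac_id : ac id (fun=> 1).
Proof.
split; first exact: integrable_cst_itv.
move=> t; rewrite in_itv/= => /andP[t0 _].
by rewrite Rintegral_cst_itv// mul1r add0r.
Qed.

Lemma acD f g f' g' : ac f f' -> ac g g' ->
  ac (fun t => f t + g t) (fun t => f' t + g' t).
Proof.
move=> hf hg; case: (hf) (hg) => if' fE [ig' gE]; split.
  exact: integrableR_D.
move=> t tI; rewrite RintegralD//; last 2 first.
- exact: ac_integrable hf tI.
- exact: ac_integrable hg tI.
by rewrite fE// gE//; ring.
Qed.

Lemma acZ c f f' : ac f f' -> ac (fun t => c * f t) (fun t => c * f' t).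
Proof.
move=> hf; case: (hf) => if' fE; split; first exact: integrableR_Z.
move=> t tI; rewrite RintegralZl//; last exact: ac_integrable hf tI.
by rewrite fE//; ring.
Qed.

Lemma eq_ac f g f' g' : (forall t, t \in `[0%R, 1%R] -> f t = g t) ->
  (forall t, t \in `[0%R, 1%R] -> f' t = g' t) -> ac f f' -> ac g g'.
Proof.
move=> fg fg' [if' fE]; split.
  by apply: eq_integrable if' => // t /set_mem tI; rewrite /= fg'.
move=> t tI; rewrite -fg// -fg ?in_itv/= ?lexx ?ler01// fE//; congr (_ + _).
apply: eq_Rintegral => s /set_mem/= sI; apply: fg'; move: sI tI.
by rewrite !in_itv/= => /andP[-> st] /andP[_]; exact: le_trans.
Qed.

Lemma acB f g f' g' : ac f f' -> ac g g' ->
  ac (fun t => f t - g t) (fun t => f' t - g' t).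
Proof.
move=> hf /(acZ (-1)) hg; apply: eq_ac (acD hf hg) => t _;
  by rewrite mulN1r.
Qed.

Lemma acM f g f' g' : ac f f' -> ac g g' ->
  ac (fun t => f t * g t) (fun t => f' t * g t + f t * g' t).
Proof.
move=> hf hg; case: (hf) (hg) => if' fE [ig' gE].
have [Cf fC] := ac_bounded hf; have [Cg gC] := ac_bounded hg.
have i1 : mu.-integrable I (EFin \o (fun t => g t * f' t)).
  by apply: (integrableR_M _ Cg) => //; exact: ac_measurable hg.
have i2 : mu.-integrable I (EFin \o (fun t => f t * g' t)).
  by apply: (integrableR_M _ Cf) => //; exact: ac_measurable hf.
split.
  apply: integrableR_D => //.
  by apply: eq_integrable i1 => // t _ /=; rewrite mulrC.
move=> t tI.
have if't := ac_integrable hf tI; have ig't := ac_integrable hg tI.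
(* Each factor is its initial value plus a primitive: the product of the two primitives is
   [primitive_mul], all other terms are linear. *)
transitivity (f 0 * g 0 + \int[mu]_(s in `[0%R, t])
   ((f' s * J g' s + J f' s * g' s) + (g 0 * f' s + f 0 * g' s))); last first.
  congr (_ + _); apply: eq_Rintegral => s /set_mem/= st.
  have sI : s \in `[0%R, 1%R].
    move: st tI; rewrite !in_itv/= => /andP[-> st] /andP[_].
    exact: le_trans.
  by rewrite (fE s)// (gE s)// /J; ring.
have ip1 := integrable_primitive_mul if't ig't.
have ip2 := integrable_primitive_mul ig't if't.
rewrite [in RHS]RintegralD//; last 2 first.
- apply: integrableR_D => //; apply: eq_integrable ip2 => // s _ /=.
  by rewrite mulrC.
- by apply: integrableR_D => //; exact: integrableR_Z.
rewrite -primitive_mul// RintegralD//; [|exact: integrableR_Z..].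
by rewrite !RintegralZl// (fE t)// (gE t)// /J; ring.
Qed.

Lemma ac_dlap d (f f' : R -> int -> R) k : (forall k, ac (f ^~ k) (f' ^~ k)) ->
  ac (fun t => dlap d (f t) k) (fun t => dlap d (f' t) k).
Proof.
move=> h; apply: (@eq_ac
  (fun t => (d ^+ 2)^-1 * (f t (k + 1) + f t (k - 1) - 2 * f t k)) _
  (fun t => (d ^+ 2)^-1 * (f' t (k + 1) + f' t (k - 1) - 2 * f' t k)));
  try by move=> t _; rewrite /dlap mulrC.
apply: acZ; apply: acB; last exact: (acZ 2 (h k)).
exact: (acD (h _) (h _)).
Qed.

End absolutely_continuous.

(** * Affine changes of variable and concatenation in time *)

Definition affine_map (R : realType) (a b : R) (x : measurableTypeR R) :
  measurableTypeR R := (x - b) / a.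

Lemma measurable_affine_map (R : realType) (a b : R) :
  measurable_fun setT (affine_map a b).
Proof. by apply: measurable_funM => //; apply: measurable_funB. Qed.

Section affine_change_of_variables.
Variable R : realType.
Local Notation mu := (@lebesgue_measure R).
Variables (a b : R).
Hypothesis a0 : 0 < a.
Local Notation phi := (affine_map a b).

Let nu := measure_function_pushforward__canonical__measure_function_Measure
  mu (@measurable_affine_map R a b).

Let ai : {nonneg R} := NngNum (ltW (eqbRL (invr_gt0 a) a0)).

Let lebesgue_affine A : measurable A ->
  mu A = mscale ai nu A.
Proof.
apply: lebesgue_measure_unique => _ [[x y]] _ <-.
change (mu `]x, y]%classic = (a^-1)%:E * mu (phi @^-1` `]x, y]))%E.
have -> : phi @^-1` `]x, y] = `](a * x + b), (a * y + b)]%classic.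
  apply/seteqP; split => z /=; rewrite !in_itv/= /affine_map => /andP[h1 h2];
  by apply/andP; split; move: h1 h2; rewrite ?ltr_pdivlMr// ?ler_pdivrMr//;
     nra.
rewrite !lebesgue_measure_itv/= !lte_fin ltrD2r ltr_pM2l//.
case: ifPn => _; last by rewrite mule0.
by rewrite -!EFinB -EFinM; congr EFin; field; rewrite gt_eqF.
Qed.

Lemma ge0_integral_affine D (f : R -> \bar R) : measurable D ->
  measurable_fun D f -> (forall x, D x -> (0 <= f x)%E) ->
  (\int[mu]_(x in [set x | D ((x - b) / a)%R]) f ((x - b) / a)%R =
   a%:E * \int[mu]_(x in D) f x)%E.
Proof.
move=> mD mf f0.
have -> : (\int[mu]_(x in D) f x =
    \int[mscale ai nu]_(x in D) f x)%E.
  by apply: eq_measure_integral => A mA _; exact: lebesgue_affine.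
rewrite ge0_integral_mscale// /nu/= ge0_integral_pushforward//; last 2 first.
- exact: measurable_affine_map.
- by move=> x /set_mem; exact: f0.
by rewrite muleA -EFinM/= divff ?gt_eqF// mul1e.
Qed.

Lemma integrable_affine D (f : R -> R) : measurable D ->
  mu.-integrable D (EFin \o f) ->
  mu.-integrable [set x | D ((x - b) / a)]
    (EFin \o (fun x => f ((x - b) / a))).
Proof.
move=> mD /integrableP[mf fi].
have mD' : measurable [set x | D ((x - b) / a)].
  by rewrite -[X in measurable X]setTI; exact: measurable_affine_map.
apply/integrableP; split.
  apply: (measurable_comp mD _ mf (measurable_funTS (@measurable_affine_map _ a b))).
  by move=> _ [x Dx <-].
have mfn : measurable_fun D (fun x => `|f x|%:E).
  by apply/measurable_EFinP; apply: measurableT_comp => //; exact/measurable_EFinP.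
have E := @ge0_integral_affine D _ mD mfn (fun x _ => normr_ge0 (f x)).
rewrite [X in (X < _)%E](_ : _ = (a%:E * \int[mu]_(x in D) `|f x|%:E)%E) ?E//.
by apply: lte_mul_pinfty => //; rewrite lee_fin ltW.
Qed.

Lemma Rintegral_affine D (f : R -> R) : measurable D ->
  mu.-integrable D (EFin \o f) ->
  \int[mu]_(x in [set x | D ((x - b) / a)]) f ((x - b) / a) =
  a * \int[mu]_(x in D) f x.
Proof.
move=> mD fi; have mf : measurable_fun D (EFin \o f) by case/integrableP: fi.
rewrite /Rintegral.
have -> : (\int[mu]_(x in [set x | D ((x - b) / a)%R]) (f ((x - b) / a))%:E =
   a%:E * \int[mu]_(x in D) (f x)%:E)%E.
  rewrite integralE [in RHS]integralE.
  have h1 := @ge0_integral_affine D ((EFin \o f)^\+)%E mD.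
  have h2 := @ge0_integral_affine D ((EFin \o f)^\-)%E mD.
  have e1 : (\int[mu]_(x in [set x | D ((x - b) / a)%R])
      (fun x => (f ((x - b) / a))%:E)^\+ x =
      a%:E * \int[mu]_(x in D) (EFin \o f)^\+ x)%E.
    rewrite -h1//; last exact: measurable_funepos.
    by apply: eq_integral => x _; rewrite !funeposE.
  have e2 : (\int[mu]_(x in [set x | D ((x - b) / a)%R])
      (fun x => (f ((x - b) / a))%:E)^\- x =
      a%:E * \int[mu]_(x in D) (EFin \o f)^\- x)%E.
    rewrite -h2//; last exact: measurable_funeneg.
    by apply: eq_integral => x _; rewrite !funenegE.
  rewrite e1 e2.
  apply/esym/muleBr => //.
  apply: fin_num_adde_defr; exact: (integrable_pos_fin_num mD fi).
rewrite fineM//; exact: integrable_fin_num.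
Qed.

End affine_change_of_variables.

Section concatenation.
Variable R : realType.
Local Notation mu := (@lebesgue_measure R).
Local Notation I := (`[0%R, 1%R]%classic : set R).
Variable e : R.
Hypotheses (e0 : 0 < e) (e1 : e < 1).

(** The junction [s = e] belongs to the first piece, which is why the integrals below are cut into
    [[0, e]] and []e, t]]. *)
Definition concat T (f g : R -> T) (s : R) : T :=
  if s <= e then f (s / e) else g ((s - e) / (1 - e)).

Let e1' : 0 < 1 - e. Proof. by rewrite subr_gt0. Qed.

Let cleft s : 0 <= s -> s <= e -> s / e \in `[0%R, 1%R].
Proof.
by move=> s0 se; rewrite in_itv/= divr_ge0 ?(ltW e0)//= ler_pdivrMr// mul1r.
Qed.

Let cright s : e <= s -> s <= 1 -> (s - e) / (1 - e) \in `[0%R, 1%R].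
Proof.
move=> es s1; rewrite in_itv/= divr_ge0 ?subr_ge0 ?(ltW e1)//=.
by rewrite ler_pdivrMr// mul1r lerB.
Qed.

(** Reduces a pointwise claim about a concatenation to one of its pieces. The quantification over
    [T], [f], [g] lets one case split serve density, flux and cost together. *)
Lemma concatP s : s \in `[0%R, 1%R] ->
  (exists2 s', s' \in `[0%R, 1%R] &
     forall T (f g : R -> T), concat f g s = f s') \/
  (exists2 s', s' \in `[0%R, 1%R] &
     forall T (f g : R -> T), concat f g s = g s').
Proof.
rewrite in_itv/= => /andP[s0 s1]; rewrite /concat.
case: leP => se; [left|right]; first by exists (s / e); [exact: cleft|].
by exists ((s - e) / (1 - e)) => //; apply: cright => //; exact: ltW.
Qed.

Lemma concat0 T (f g : R -> T) : concat f g 0 = f 0.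
Proof. by rewrite /concat (ltW e0) mul0r. Qed.

Lemma concat1 T (f g : R -> T) : concat f g 1 = g 1.
Proof. by rewrite /concat leNgt e1/= divff// gt_eqF. Qed.

Let setleft t : t <= e ->
  `[0%R, t]%classic = [set x | `[0%R, t / e]%classic ((x - 0) / e)].
Proof.
move=> te; apply/seteqP; split => x /=; rewrite !in_itv/= subr0.
  by move=> /andP[x0 xt]; rewrite divr_ge0 ?(ltW e0)// ler_pM2r ?invr_gt0.
by rewrite ler_pM2r ?invr_gt0// pmulr_lge0 ?invr_gt0.
Qed.

Let setright t : `]e, t]%classic =
  [set x | `]0%R, (t - e) / (1 - e)]%classic ((x - e) / (1 - e))].
Proof.
apply/seteqP; split => x /=; rewrite !in_itv/=;
  by rewrite ler_pM2r ?invr_gt0// lerD2r pmulr_lgt0 ?invr_gt0// subr_gt0.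
Qed.

Let sub_oc t : `]0%R, t]%classic `<=` (`[0%R, t]%classic : set R).
Proof. by apply: subset_itvr; rewrite bnd_simp. Qed.

Let integrable_concat_left p q t : t \in `[0%R, 1%R] -> t <= e ->
  mu.-integrable I (EFin \o p) ->
  mu.-integrable `[0%R, t] (EFin \o concat p q) /\
  \int[mu]_(s in `[0%R, t]) concat p q s =
    e * \int[mu]_(s in `[0%R, (t / e)]) p s.
Proof.
move=> tI te ip; have t0 : 0 <= t by move: tI; rewrite in_itv/= => /andP[].
have ip' : mu.-integrable `[0%R, (t / e)] (EFin \o p).
  by apply: integrable_sub01 ip; exact: cleft.
have E s : s \in `[0%R, t]%classic -> concat p q s = p ((s - 0) / e).
  rewrite inE/= in_itv/= => /andP[_ st].
  by rewrite /concat (le_trans st te) subr0.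
split.
  have := @integrable_affine _ e 0 e0 _ p (measurable_itv _) ip'.
  rewrite -setleft//; apply: eq_integrable => // s st.
  by rewrite /= E.
transitivity (\int[mu]_(s in `[0%R, t]) p ((s - 0) / e)).
  by apply: eq_Rintegral => s st; exact: E.
by rewrite setleft//; apply: Rintegral_affine.
Qed.

Let integrable_concat_right p q t : t \in `[0%R, 1%R] -> e <= t ->
  mu.-integrable I (EFin \o q) ->
  mu.-integrable `]e, t] (EFin \o concat p q) /\
  \int[mu]_(s in `]e, t]) concat p q s =
    (1 - e) * \int[mu]_(s in `[0%R, ((t - e) / (1 - e))]) q s.
Proof.
move=> tI et iq; have t1 : t <= 1 by move: tI; rewrite in_itv/= => /andP[].
have iq' : mu.-integrable `[0%R, ((t - e) / (1 - e))] (EFin \o q).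
  by apply: integrable_sub01 iq; exact: cright.
have iq'' : mu.-integrable `]0%R, ((t - e) / (1 - e))] (EFin \o q).
  by apply: integrableS iq'.
have E s : s \in `]e, t]%classic -> concat p q s = q ((s - e) / (1 - e)).
  rewrite inE/= in_itv/= => /andP[es _].
  by rewrite /concat leNgt es.
split.
  have := @integrable_affine _ (1 - e) e e1' _ q (measurable_itv _) iq''.
  rewrite -setright//; apply: eq_integrable => // s st.
  by rewrite /= E.
transitivity (\int[mu]_(s in `]e, t]) q ((s - e) / (1 - e))).
  by apply: eq_Rintegral => s st; exact: E.
rewrite -Rintegral_itv_obnd_cbnd//.
by rewrite setright//; apply: Rintegral_affine.
Qed.

Lemma integrable_concat p q : mu.-integrable I (EFin \o p) ->
  mu.-integrable I (EFin \o q) -> mu.-integrable I (EFin \o concat p q).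
Proof.
move=> ip iq.
have [|h1 _] := @integrable_concat_left p q e _ (lexx _) ip.
  by rewrite in_itv/= !ltW.
have [|h2 _] := @integrable_concat_right p q 1 _ (ltW e1) iq.
  by rewrite in_itv/= ler01 lexx.
rewrite (@itv_bndbnd_setU _ _ _ (BRight e)) ?bnd_simp ?ltW//.
apply/integrableP; split.
  apply/measurable_funU => //.
  by split; [exact: (measurable_int mu h1)|exact: (measurable_int mu h2)].
rewrite ge0_integral_setU//=; last 2 first.
- apply: measurableT_comp => //; apply/measurable_funU => //.
  split; apply: measurableT_comp => //; apply/measurable_EFinP.
    exact: (measurable_int mu h1).
  exact: (measurable_int mu h2).
- apply/disj_setPS => y [/=]; rewrite !in_itv/= => /andP[_ ye] /andP[].
  by rewrite ltNge ye.
by apply: lte_add_pinfty; [case/integrableP: h1|case/integrableP: h2].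
Qed.

Lemma Rintegral_concat p q t : t \in `[0%R, 1%R] ->
  mu.-integrable I (EFin \o p) -> mu.-integrable I (EFin \o q) ->
  \int[mu]_(s in `[0%R, t]) concat p q s =
  if t <= e then e * \int[mu]_(s in `[0%R, (t / e)]) p s
  else e * \int[mu]_(s in I) p s +
       (1 - e) * \int[mu]_(s in `[0%R, ((t - e) / (1 - e))]) q s.
Proof.
move=> tI ip iq; case: (leP t e) => te.
  by have [] := integrable_concat_left q tI te ip.
have eI : e \in `[0%R, 1%R] by rewrite in_itv/= !ltW.
have [h1 E1] := @integrable_concat_left p q e eI (lexx _) ip.
have [h2 E2] := integrable_concat_right p tI (ltW te) iq.
rewrite divff ?gt_eqF// in E1.
rewrite -E1 -E2.
have it := integrable_sub01 tI (integrable_concat ip iq).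
rewrite -(@Rintegral_itvB _ _ _ _ e it) ?bnd_simp ?ltW//.
by rewrite addrC subrK.
Qed.

(** The factors [e^-1] and [(1 - e)^-1] are the changes of speed; [f 1 = g 0] excludes a jump at the
    junction. *)
Lemma ac_concat (f g p q : R -> R) : ac f p -> ac g q -> f 1 = g 0 ->
  ac (concat f g) (concat (fun s => e^-1 * p s) (fun s => (1 - e)^-1 * q s)).
Proof.
move=> hf hg fg; case: (hf) (hg) => ip fE [iq gE].
have iep : mu.-integrable I (EFin \o (fun s => e^-1 * p s)).
  exact: integrableR_Z.
have ieq : mu.-integrable I (EFin \o (fun s => (1 - e)^-1 * q s)).
  exact: integrableR_Z.
split; first exact: integrable_concat.
move=> t tI; rewrite Rintegral_concat// concat0 /concat.
have en0 : e != 0 by rewrite gt_eqF.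
have e1n0 : 1 - e != 0 by rewrite gt_eqF.
move: (tI); rewrite in_itv/= => /andP[t0 t1].
case: leP => te.
  have teI := cleft t0 te.
  rewrite RintegralZl//; last exact: integrable_sub01 ip.
  by rewrite mulrA mulfV// mul1r -fE.
have teI := cright (ltW te) t1.
rewrite !RintegralZl//; last exact: integrable_sub01 iq.
have oneI : 1 \in `[0%R, 1%R :> R] by rewrite in_itv/= ler01 lexx.
have := fE 1 oneI.
by rewrite mulrA mulfV// mul1r mulrA mulfV// mul1r addrA => <-; rewrite fg -gE.
Qed.

Lemma measurable_concat (f g : R -> R) : measurable_fun I f -> measurable_fun I g ->
  measurable_fun I (concat f g).
Proof.
move=> mf mg; apply: measurable_fun_if => //.
- by apply: measurable_fun_ler => //; exact: measurable_cst.
- apply: (measurable_comp _ _ mf) => //; last first.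
    by apply: measurable_funM.
  move=> z [s [/= + se] <-]; rewrite in_itv/= => /andP[s0 s1]; exact: cleft.
- apply: (measurable_comp _ _ mg) => //; last first.
    by apply: measurable_funM => //; exact: measurable_funB.
  move=> z [s [sI se] <-]; move: sI se => /=; rewrite in_itv/= => /andP[s0 s1].
  by move=> /negbT; rewrite -ltNge => /ltW se; exact: cright.
Qed.

End concatenation.

(** * Curves of finite action *)

Section Pdelta_theory.
Variables (R : realType) (d : R).
Hypothesis d0 : 0 < d.
Implicit Types rho : int -> R.

Lemma Pdelta_summable rho : Pdelta d rho -> zsummable rho.
Proof.
case=> r0 m _ _; apply: zsummable_esum => //; rewrite ltNge leye_eq.
apply/negP => /eqP h; move: m; rewrite h gt0_muley ?lte_fin//.
Qed.

Lemma Pdelta_mass rho : Pdelta d rho -> d * zsum rho = 1.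
Proof.
move=> P; have sr := Pdelta_summable P; case: P => r0 m _ _.
by move: m; rewrite esum_zsum// -EFinM => -[].
Qed.

Lemma Pdelta_zsum rho : Pdelta d rho -> zsum rho = d^-1.
Proof.
by move=> /Pdelta_mass h; apply: (mulfI (lt0r_neq0 d0)); rewrite h divff ?gt_eqF.
Qed.

Lemma Pdelta_summable2 rho : Pdelta d rho ->
  zsummable (fun k => (k%:~R : R) ^+ 2 * rho k).
Proof.
case=> r0 _ m2 _.
have /(zsummableZ ((d ^+ 2)^-1)) := zsummable_esum (f := fun k =>
  ((d * k%:~R) ^+ 2) * rho k) (fun k => mulr_ge0 (sqr_ge0 _) (r0 k)) m2.
apply: eq_zsummable => k; rewrite exprMn; field.
by rewrite gt_eqF.
Qed.

Lemma Pdelta_le rho k : Pdelta d rho -> rho k <= d^-1.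
Proof.
move=> P; rewrite -(Pdelta_zsum P); apply: ler_zsum_term; first by case: P.
exact: Pdelta_summable.
Qed.

Lemma zsummable_moment1 (f : int -> R) : zsummable f ->
  zsummable (fun k => (k%:~R : R) ^+ 2 * f k) -> zsummable (fun k => k%:~R * f k).
Proof.
move=> /zsummable_norm sf /zsummable_norm sf2.
apply: zsummable_le (zsummableD sf sf2) => k.
have -> : `|(k%:~R : R) ^+ 2 * f k| = `|k%:~R : R| ^+ 2 * `|f k|.
  by rewrite normrM normrX.
rewrite normrM -[X in _ <= X + _]mul1r -mulrDl ler_wpM2r//.
have := normr_ge0 (k%:~R : R); set x := `|_|; nra.
Qed.

Lemma zsumE_Pdelta_mean rho : Pdelta d rho -> zsum (fun k => k%:~R * rho k) = 0.
Proof.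
move=> P; have s1 := zsummable_moment1 (Pdelta_summable P) (Pdelta_summable2 P).
case: P => _ _ _ /eqP; rewrite mulf_eq0 gt_eqF//= => /eqP.
rewrite -[in X in X -> _](@eq_zsum _ (fun k => d * (k%:~R * rho k))).
  rewrite zsumZ// => /eqP; rewrite mulf_eq0 gt_eqF//= => /eqP//.
by move=> k; rewrite mulrA.
Qed.

Lemma PdeltaI rho : (forall k, 0 <= rho k) -> zsummable rho ->
  d * zsum rho = 1 -> zsummable (fun k => (k%:~R : R) ^+ 2 * rho k) ->
  zsum (fun k => k%:~R * rho k) = 0 -> Pdelta d rho.
Proof.
move=> r0 sr m s2 m1; split => //.
- by rewrite esum_zsum// -EFinM m.
- rewrite (@eq_esum _ _ _ _ (fun k => (d ^+ 2 * ((k%:~R : R) ^+ 2 * rho k))%:E)).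
    have s2' := zsummableZ (d ^+ 2) s2.
    rewrite esum_zsum ?ltry// => k.
    by rewrite mulr_ge0 ?sqr_ge0// mulr_ge0 ?sqr_ge0.
  by move=> k _; rewrite exprMn mulrA.
- rewrite (@eq_zsum _ _ (fun k => d * (k%:~R * rho k))).
    by rewrite zsumZ ?m1 ?mulr0//; exact: zsummable_moment1.
  by move=> k; rewrite mulrA.
Qed.

Lemma Pdelta_convex rho eta (x : R) : 0 <= x <= 1 -> Pdelta d rho ->
  Pdelta d eta -> Pdelta d (fun k => x * rho k + (1 - x) * eta k).
Proof.
move=> /andP[x0 x1] Pr Pe.
have x1' : 0 <= 1 - x by rewrite subr_ge0.
have sr := Pdelta_summable Pr; have se := Pdelta_summable Pe.
have sr2 := Pdelta_summable2 Pr; have se2 := Pdelta_summable2 Pe.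
have sr1 := zsummable_moment1 sr sr2; have se1 := zsummable_moment1 se se2.
apply: PdeltaI.
- move=> k; case: Pr => r0 _ _ _; case: Pe => e0 _ _ _.
  by rewrite addr_ge0// mulr_ge0.
- by apply: zsummableD; exact: zsummableZ.
- rewrite zsumD; [|exact: zsummableZ..].
  by rewrite !zsumZ// (Pdelta_zsum Pr) (Pdelta_zsum Pe); field; rewrite gt_eqF.
- have := zsummableD (zsummableZ x sr2) (zsummableZ (1 - x) se2).
  by apply: eq_zsummable => k; ring.
- rewrite (@eq_zsum _ _ (fun k => x * (k%:~R * rho k) +
    (1 - x) * (k%:~R * eta k))); last by move=> k; ring.
  rewrite zsumD; [|exact: zsummableZ..].
  by rewrite !zsumZ// !zsumE_Pdelta_mean// !mulr0 addr0.
Qed.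

End Pdelta_theory.

(** * The integrand of the action *)

Section Qf_theory.
Variable R : realType.
Implicit Types p r c : R.

Lemma Qf_ge0 p r : (0 <= Qf p r)%E.
Proof.
rewrite /Qf; case: ifPn => r0; last by case: ifP => _; rewrite ?lexx ?leey.
by rewrite lee_fin divr_ge0 ?sqr_ge0// ltW.
Qed.

Lemma Qf_le p r c : 0 <= r -> 0 <= c -> p ^+ 2 <= c * r -> (Qf p r <= c%:E)%E.
Proof.
move=> r0 c0 h; rewrite /Qf; case: ifPn => [r1|].
  by rewrite lee_fin ler_pdivrMr.
rewrite -leNgt => r1; have re : r = 0 by apply/le_anti/andP.
move: h; rewrite re mulr0 => h.
by have /eqP -> : p == 0; [rewrite -sqrf_eq0 -[_ == 0]andbT eq_le h sqr_ge0|rewrite eqxx lee_fin].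
Qed.

Lemma fine_Qf p r : 0 <= r -> (Qf p r < +oo)%E ->
  0 <= fine (Qf p r) /\ p ^+ 2 <= fine (Qf p r) * r.
Proof.
move=> r0 h; split; first exact/fine_ge0/Qf_ge0.
move: h; rewrite /Qf; case: ifPn => [r1 _|_].
  by rewrite /= divfK// gt_eqF.
case: ifPn => [/eqP-> _|//]; by rewrite expr2 !mul0r.
Qed.

Lemma Qf0 r : Qf 0 r = 0%E.
Proof. by rewrite /Qf expr2 !mul0r eqxx; case: ifP. Qed.

Lemma measurable_fun_inv d (T : measurableType d) (D : set T) (f : T -> R) :
  (forall x, D x -> 0 <= f x) -> measurable_fun D f ->
  measurable_fun D (fun x => (f x)^-1).
Proof.
move=> f0 mf.
(* For nonnegative numbers the inverse is the power [-1], also at [0], where both conventions give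
   [0]; measurability of powers then applies. *)
apply: (@eq_measurable_fun _ _ _ _ _ (fun x => f x `^ (-1))).
  by move=> x /set_mem Dx; rewrite powR_inv1// f0.
exact: (measurableT_comp (@measurable_powR R (-1)) mf).
Qed.

Lemma measurable_Qf d (T : measurableType d) (D : set T) (f g : T -> R) :
  measurable D -> measurable_fun D f -> measurable_fun D g ->
  measurable_fun D (fun x => Qf (f x) (g x)).
Proof.
move=> mD mf mg; apply: measurable_fun_if => //.
- by apply: measurable_fun_ltr => //; exact: measurable_cst.
- apply/measurable_EFinP; apply: measurable_funM.
    by apply: measurable_funX; apply: measurable_funS mf => // x [].
  apply: measurable_fun_inv; first by move=> x [_ /= /ltW].
  by apply: measurable_funS mg => // x [].
- apply: measurable_fun_if => //.
  + rewrite -[X in measurable X]/(_ `&` _).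
    apply: (measurable_fun_ltr (measurable_cst _) mg) => //.
  + apply: measurable_fun_eqr => //.
    by apply: measurable_funS mf => // x [].
Qed.

End Qf_theory.

Section curves.
Variables (R : realType) (d : R).
Hypothesis d0 : 0 < d.
Local Notation mu := (@lebesgue_measure R).
Local Notation I := (`[0%R, 1%R]%classic : set R).
Implicit Types (a b : int -> R) (rho w c : R -> int -> R).

(* [curve_ge0] and [curve_bound] say [Qf (w s k) (rho s k) <= c s k] without
   extended reals or divisions. *)
Record curve a b rho w c (A : R) : Prop := Curve {
  curve_Pdelta : forall s, s \in `[0%R, 1%R] -> Pdelta d (rho s);
  curve_start : rho 0 = a;
  curve_end : rho 1 = b;
  curve_ge0 : forall s k, s \in `[0%R, 1%R] -> 0 <= c s k;
  curve_bound : forall s k, s \in `[0%R, 1%R] ->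
    (w s k) ^+ 2 <= c s k * rho s k;
  curve_measurable_w : forall k, measurable_fun I (w ^~ k);
  curve_measurable_c : forall k, measurable_fun I (c ^~ k);
  curve_ac : forall k, ac (rho ^~ k) (fun s => dlap d (w s) k);
  curve_summable : forall s, s \in `[0%R, 1%R] -> zsummable (c s);
  curve_integrable : mu.-integrable I (EFin \o (fun s => zsum (c s)));
  curve_action : d * \int[mu]_(s in I) zsum (c s) <= A }.

Lemma le_curve a b rho w c A B : A <= B -> curve a b rho w c A ->
  curve a b rho w c B.
Proof. by move=> AB [*]; split => //; exact: le_trans AB. Qed.

Lemma D2_ge0 a b : (0 <= D2 d a b)%E.
Proof.
apply: le_ereal_inf_tmp => _ [rho [w [_ ->]]].
rewrite /action mule_ge0 ?lee_fin ?(ltW d0)//; apply: esum_ge0 => k _.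
by apply: integral_ge0 => s _; exact: Qf_ge0.
Qed.

(** Densities are at most [d^-1], so [d^-1 * c] dominates [w ^ 2]; this supplies both the square
    summability and the square integrability that [admissible] asks for. *)
Lemma curve_D2 a b rho w c A : curve a b rho w c A -> (D2 d a b <= A%:E)%E.
Proof.
move=> h; have P := curve_Pdelta h.
have r0 s k : s \in `[0%R, 1%R] -> 0 <= rho s k by move=> /P[].
have w2 s k : s \in `[0%R, 1%R] -> (w s k) ^+ 2 <= d^-1 * c s k.
  move=> sI; rewrite (le_trans (curve_bound h k sI))// mulrC ler_wpM2r//.
    exact: curve_ge0 h _ _ sI.
  exact: Pdelta_le (P s sI).
have di0 : 0 <= d^-1 by rewrite invr_ge0 ltW.
have mr k := ac_measurable (curve_ac h k).
have ck s k : s \in `[0%R, 1%R] -> c s k <= zsum (c s).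
  move=> sI; apply: ler_zsum_term; last exact: curve_summable h _ sI.
  by move=> l; exact: curve_ge0 h _ _ sI.
apply: (@le_trans _ _ (action d rho w)).
  apply: ereal_inf_lbound; exists rho, w; split => //; split => //.
  - by split; [exact: curve_start h|exact: curve_end h].
  - move=> s sI; apply: (@le_lt_trans _ _ (\esum_(k in [set: int]) (d^-1 * c s k)%:E)%E).
      by apply: le_esum => k _; rewrite lee_fin w2.
    rewrite esum_zsum ?ltry//.
      by move=> k; rewrite mulr_ge0//; exact: curve_ge0 h _ _ sI.
    by apply: zsummableZ; exact: curve_summable h _ sI.
  - move=> k; split; first exact: curve_measurable_w h k.
    have : mu.-integrable I (EFin \o (fun s => d^-1 * zsum (c s))).
      by apply: integrableR_Z => //; exact: curve_integrable h.
    move=> /integrableP[_].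
    apply: le_lt_trans; apply: ge0_le_integral => //.
    + by move=> s _; rewrite lee_fin sqr_ge0.
    + by apply/measurable_EFinP; apply: measurable_funX; exact: curve_measurable_w h k.
    + apply: measurableT_comp => //; apply/measurable_EFinP.
      apply: measurable_funM => //.
      exact: (integrable_measurable (curve_integrable h)).
    + move=> s sI; rewrite /= lee_fin (le_trans (w2 s k sI))//.
      by rewrite (le_trans _ (ler_norm _))// ler_wpM2l// ck.
  - by move=> k t tI; have [_ /(_ t tI)] := curve_ac h k.
have sc := curve_summable h.
rewrite /action -lee_pdivlMl//.
apply: (@le_trans _ _ (\esum_(k in [set: int]) \int[mu]_(s in I) (c s k)%:E)%E).
  apply: le_esum => k _; apply: ge0_le_integral => //.
  - by move=> s _; exact: Qf_ge0.
  - by apply: measurable_Qf => //; [exact: curve_measurable_w h k|exact: mr].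
  - by apply/measurable_EFinP; exact: curve_measurable_c h k.
  - move=> s sI; apply: Qf_le; [exact: r0|exact: curve_ge0 h _ _ sI|].
    exact: curve_bound h _ _ sI.
rewrite -ge0_integral_esum//; last 2 first.
- by move=> k; apply/measurable_EFinP; exact: curve_measurable_c h k.
- by move=> s k sI; rewrite lee_fin; exact: curve_ge0 h _ _ sI.
have -> : (\int[mu]_(s in I) (\esum_(k in [set: int]) (c s k)%:E) =
           \int[mu]_(s in I) (zsum (c s))%:E)%E.
  apply: eq_integral => s /set_mem sI; rewrite esum_zsum//; last exact: sc.
  by move=> k; exact: curve_ge0 h _ _ sI.
rewrite -[X in (X <= _)%E]fineK; last first.
  by apply: integrable_fin_num => //; exact: curve_integrable h.
by rewrite lee_fin -ler_pdivrMl ?invr_gt0// invrK; exact: curve_action h.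
Qed.

Lemma measurable_esum_ge0 dT (T : measurableType dT) (D : set T)
    (F : T -> int -> \bar R) : measurable D -> (forall x k, (0 <= F x k)%E) ->
  (forall k, measurable_fun D (F ^~ k : T -> \bar R)) ->
  measurable_fun D (fun x => \esum_(k in [set: int]) F x k : \bar R)%E.
Proof.
move=> mD F0 mF.
rewrite (_ : (fun x => _) = (fun x => \sum_(n <oo) F x (int_of_enum n))%E).
  by apply: ge0_emeasurable_sum => // n x Dx _; exact: F0.
by apply/funext => x; rewrite esum_counting ?ge0_integral_count.
Qed.

(* On the null set of times where the action density is infinite, [w] is
   replaced by [0]. *)
Lemma D2_curve a b A : (D2 d a b < A%:E)%E ->
  exists rho w c, curve a b rho w c A.
Proof.
move=> /ereal_inf_lt[_ [rho [w [[P [r0E r1E] wl2 wm acE] ->]]] actA].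
pose q s k := Qf (w s k) (rho s k).
pose E s := (\esum_(k in [set: int]) q s k)%E.
pose w' s k := if (E s < +oo)%E then w s k else 0.
pose c s k := fine (Qf (w' s k) (rho s k)).
have oneI : 1 \in `[0%R, 1%R :> R] by rewrite in_itv/= ler01 lexx.
have mw k : measurable_fun I (w ^~ k) by case: (wm k).
have mw2 k : measurable_fun I (fun s => (w s k) ^+ 2).
  by apply: measurable_funX; exact: mw.
have iw k : mu.-integrable I (EFin \o (w ^~ k)).
  have iw2 : mu.-integrable I (EFin \o (fun s => (w s k) ^+ 2)).
    apply/integrableP; split.
      apply/measurable_EFinP; exact: mw2.
    case: (wm k) => _; apply: le_lt_trans; apply: ge0_le_integral => //.
    - by apply: measurableT_comp => //; apply/measurable_EFinP; exact: mw2.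
    - apply/measurable_EFinP; exact: mw2.
    - by move=> s _; rewrite lee_fin ger0_norm ?sqr_ge0.
  (* Square integrability implies integrability on the unit interval, by [|w| <= w ^ 2 + 1]. *)
  apply: (@integrable_le _ _ R mu I _ _ (fun s => (w s k) ^+ 2 + 1)) => //.
    exact: mw.
    move=> s _; have := normr_ge0 (w s k); rewrite -[(w s k) ^+ 2]real_normK ?num_real//.
    set x := `|_|; nra.
  by apply: integrableR_D => //; exact: integrable_cst_itv.
have idw k : mu.-integrable I (EFin \o (fun s => dlap d (w s) k)).
  apply: (@eq_integrable _ _ _ mu _ _ (EFin \o (fun s =>
     (d ^+ 2)^-1 * (w s (k + 1) + w s (k - 1) + (-2) * w s k)))) => //.
    by move=> s _; rewrite /= /dlap mulrC mulNr.
  by do 3 ?[apply: integrableR_Z => //|apply: integrableR_D => //].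
have acw k : ac (rho ^~ k) (fun s => dlap d (w s) k).
  by split=> // t tI; rewrite acE.
have mr k := ac_measurable (acw k).
have mq k : measurable_fun I (q ^~ k) by exact: measurable_Qf.
have mE : measurable_fun I E.
  by apply: measurable_esum_ge0 => // s k; exact: Qf_ge0.
have mEb : measurable_fun I (fun s => (E s < +oo)%E).
  by apply: measurable_fun_lte => //; exact: measurable_cst.
have mw' k : measurable_fun I (w' ^~ k).
  by apply: measurable_fun_if => //; apply: measurable_funS (mw k) => // x [].
have E0 s : (0 <= E s)%E by apply: esum_ge0 => k _; exact: Qf_ge0.
have intE : (d%:E * \int[mu]_(s in I) E s < A%:E)%E.
  by move: actA; rewrite /action -ge0_integral_esum// => s k _; exact: Qf_ge0.
have iE : mu.-integrable I E.
  apply/integrableP; split => //.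
  under eq_integral do rewrite gee0_abs//.
  rewrite ltNge leye_eq; apply/negP => /eqP h; move: intE.
  by rewrite h gt0_muley ?lte_fin.
have qfin s k : (E s < +oo)%E -> (q s k < +oo)%E.
  apply: le_lt_trans; rewrite /E (esumID [set k])/=; last by move=> *; exact: Qf_ge0.
  rewrite setTI esum_set1; last exact: Qf_ge0.
  by rewrite leeDl// esum_ge0// => l _; exact: Qf_ge0.
have cE s k : c s k = if (E s < +oo)%E then fine (q s k) else 0.
  by rewrite /c /w'; case: ifP => // _; rewrite Qf0.
have c0 s k : 0 <= c s k by apply/fine_ge0/Qf_ge0.
have sumc s : (\esum_(k in [set: int]) (c s k)%:E <= E s)%E.
  apply: le_esum => k _; rewrite cE; case: ifPn => h.
    by rewrite fineK// ge0_fin_numE ?qfin//; exact: Qf_ge0.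
  exact: Qf_ge0.
have sc s : zsummable (c s).
  apply: zsummable_esum => //.
  have [h|h] := boolP (E s < +oo)%E; first exact: le_lt_trans (sumc s) h.
  by rewrite esum1 ?ltry// => k _; rewrite cE (negbTE h).
have mc k : measurable_fun I (c ^~ k).
  by apply: (measurableT_comp _ (measurable_Qf _ (mw' k) (mr k))).
have mzc : measurable_fun I (fun s => zsum (c s)) by exact: measurable_zsum.
have zcE s : ((zsum (c s))%:E <= E s)%E by rewrite -esum_zsum.
have aeE : {ae mu, forall s, I s -> E s \is a fin_num}.
  exact: integrable_ae iE.
have w'E s : E s \is a fin_num -> w' s = w s.
  by move=> Efin; apply/funext => k; rewrite /w' -ge0_fin_numE// Efin.
have idw' k : mu.-integrable I (EFin \o (fun s => dlap d (w' s) k)).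
  apply: (@integrable_le _ _ R mu I _ _ (fun s => `|dlap d (w s) k|)) => //.
  - apply: measurable_funM => //; apply: measurable_funB.
      by apply: measurable_funD; exact: mw'.
    by apply: measurable_funM => //; exact: mw'.
  - move=> s _; rewrite /w' /dlap; case: ifP => // _.
    by rewrite !addr0 mulr0 subr0 mul0r normr0.
  - exact: integrable_norm.
exists rho, w', c; split => //.
- move=> s k sI; rewrite /c; have [h|h] := boolP (E s < +oo)%E.
    rewrite /w' h; apply: (fine_Qf _ (qfin s k h)).2.
    by have [] := P s sI.
  by rewrite /w' (negbTE h) Qf0 expr2 !mul0r.
- move=> k; split => // t tI; rewrite acE//; congr (_ + _).
  rewrite /Rintegral; congr fine.
  have sub : `[0%R, t] `<=` I.
    by apply: subset_itvl; rewrite bnd_simp; move: tI; rewrite in_itv/= => /andP[].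
  (* The modified flux differs from [w] only on a null set of times, so the integral formula for
     [rho] survives. *)
  apply: ae_eq_integral => //.
  + by apply: (measurable_int mu); apply: integrableS (idw k).
  + by apply: (measurable_int mu); apply: integrableS (idw' k).
  + apply: negligibleS aeE => s /=; apply: contra_not => h st.
    by rewrite w'E//; apply: h; exact: sub.
- apply: le_integrable iE => //; first exact/measurable_EFinP.
  move=> s sI; rewrite /= ger0_norm; last exact: zsum_ge0.
  by rewrite gee0_abs.
- rewrite -lee_fin EFinM /Rintegral fineK; last first.
    apply: integrable_fin_num => //.
    apply: le_integrable iE => //; first exact/measurable_EFinP.
    move=> s sI; rewrite /= ger0_norm; last exact: zsum_ge0.
    by rewrite gee0_abs.
  apply: le_trans (ltW intE); rewrite lee_pmul2l ?lte_fin//.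
  apply: ge0_le_integral => //; last exact/measurable_EFinP.
  by move=> s sI; rewrite lee_fin; exact: zsum_ge0.
Qed.

(** Running a curve in time [e] multiplies its flux by [e^-1] and its cost by [e^-2]; integrating
    over an interval of length [e] gives one factor back, whence [A / e]. *)
Lemma curve_concat a b b' rho1 w1 c1 A rho2 w2 c2 B e : 0 < e < 1 ->
  curve a b rho1 w1 c1 A -> curve b b' rho2 w2 c2 B ->
  exists rho w c, curve a b' rho w c (A / e + B / (1 - e)).
Proof.
move=> /andP[e0 e1] h1 h2.
have e1' : 0 < 1 - e by rewrite subr_gt0.
have en : e != 0 by rewrite gt_eqF.
have e1n : 1 - e != 0 by rewrite gt_eqF.
pose W1 s k := e^-1 * w1 s k; pose W2 s k := (1 - e)^-1 * w2 s k.
pose C1 s k := e^-1 ^+ 2 * c1 s k; pose C2 s k := (1 - e)^-1 ^+ 2 * c2 s k.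
exists (concat e rho1 rho2), (concat e W1 W2), (concat e C1 C2).
have sC1 s : s \in `[0%R, 1%R] -> zsummable (C1 s).
  by move=> sI; apply: zsummableZ; exact: curve_summable h1 _ sI.
have sC2 s : s \in `[0%R, 1%R] -> zsummable (C2 s).
  by move=> sI; apply: zsummableZ; exact: curve_summable h2 _ sI.
have zE s : s \in `[0%R, 1%R] -> zsum (concat e C1 C2 s) =
    concat e (fun s => e^-1 ^+ 2 * zsum (c1 s))
             (fun s => (1 - e)^-1 ^+ 2 * zsum (c2 s)) s.
  move=> /(concatP e0 e1)[] [s' s'I E]; rewrite !E zsumZ//.
    exact: curve_summable h1 _ s'I.
  exact: curve_summable h2 _ s'I.
have i1 : mu.-integrable I (EFin \o (fun s => e^-1 ^+ 2 * zsum (c1 s))).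
  by apply: integrableR_Z => //; exact: curve_integrable h1.
have i2 : mu.-integrable I (EFin \o (fun s => (1 - e)^-1 ^+ 2 * zsum (c2 s))).
  by apply: integrableR_Z => //; exact: curve_integrable h2.
have app (f g : R -> int -> R) k : (fun s => concat e f g s k) =
    concat e (f ^~ k) (g ^~ k).
  by apply/funext => s; rewrite /concat; case: ifP.
split.
- move=> s /(concatP e0 e1)[] [s' s'I ->].
    exact: curve_Pdelta h1 _ s'I.
  exact: curve_Pdelta h2 _ s'I.
- by rewrite concat0//; exact: curve_start h1.
- by rewrite concat1//; exact: curve_end h2.
- move=> s k /(concatP e0 e1)[] [s' s'I ->]; rewrite mulr_ge0 ?sqr_ge0//.
    exact: curve_ge0 h1 _ _ s'I.
  exact: curve_ge0 h2 _ _ s'I.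
- move=> s k /(concatP e0 e1)[] [s' s'I E]; rewrite !E exprMn -[X in _ <= X]mulrA.
    by rewrite ler_wpM2l ?sqr_ge0//; exact: curve_bound h1 _ _ s'I.
  by rewrite ler_wpM2l ?sqr_ge0//; exact: curve_bound h2 _ _ s'I.
- move=> k; rewrite app; apply: measurable_concat => //; apply: measurable_funM => //.
    exact: curve_measurable_w h1 k.
  exact: curve_measurable_w h2 k.
- move=> k; rewrite app; apply: measurable_concat => //; apply: measurable_funM => //.
    exact: curve_measurable_c h1 k.
  exact: curve_measurable_c h2 k.
- move=> k; rewrite app.
  have := ac_concat e0 e1 (curve_ac h1 k) (curve_ac h2 k).
  rewrite (curve_end h1) (curve_start h2) => /(_ erefl).
  apply: eq_ac => // s /(concatP e0 e1)[] [s' s'I E]; rewrite !E /dlap /W1 /W2.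
    by ring.
  by ring.
- move=> s /(concatP e0 e1)[] [s' s'I ->]; first exact: sC1.
  exact: sC2.
- apply: eq_integrable (integrable_concat e0 e1 i1 i2) => // s /set_mem sI.
  by rewrite /= zE.
- rewrite (@eq_Rintegral _ _ _ mu _ (concat e (fun s => e^-1 ^+ 2 * zsum (c1 s))
             (fun s => (1 - e)^-1 ^+ 2 * zsum (c2 s)))); last first.
    by move=> s /set_mem sI; rewrite zE.
  rewrite Rintegral_concat//; last by rewrite in_itv/= ler01 lexx.
  rewrite [1 <= e]leNgt e1/= divff// !RintegralZl//; last 2 first.
  - exact: curve_integrable h2.
  - exact: curve_integrable h1.
  have := curve_action h1; have := curve_action h2.
  set x := (X in d * X <= B); set y := (X in d * X <= A) => hx hy.
  have -> : d * (e * (e^-1 ^+ 2 * y) + (1 - e) * ((1 - e)^-1 ^+ 2 * x)) =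
    d * y / e + d * x / (1 - e) by field; rewrite e1n en.
  by apply: lerD; rewrite ler_wpM2r// invr_ge0 ltW.
Qed.

End curves.

(** * Discrete Laplacian and convolution *)

Section zsum_exchange.
Variables (R : realType) (F : int -> int -> R).
Hypothesis sF : forall k, zsummable (F k).
Hypothesis sFF : zsummable (fun k => zsum (fun l => `|F k l|)).
Local Notation cnt := (@counting nat R).

Let iF := (zsummableP (fun k => zsum (fun l => `|F k l|))).1 sFF.

Lemma zsummable_exchange_term l : zsummable (F ^~ l).
Proof.
apply: zsummable_le sFF => k.
apply: (@ler_zsum_term _ (fun l => `|F k l|)) => //.
by apply: zsummable_norm; exact: sF.
Qed.

(** The instance of [zsum_integral] in which the measure is itself the counting measure. *)
Lemma zsum_exchange : zsum (fun k => zsum (F k)) = zsum (fun l => zsum (F ^~ l)).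
Proof.
have h := @zsum_integral R _ nat cnt setT (fun n => F (int_of_enum n))
  (fun n => zsum (fun l => `|F (int_of_enum n) l|)) measurableT
  (fun _ => ltac:(by [])) (fun n _ => sF _) iF (fun _ _ => lexx _).
rewrite zsumE; last first.
  by apply: zsummable_le sFF => k; exact: ler_norm_zsum.
rewrite h; apply: eq_zsum => l; rewrite [RHS]zsumE//.
exact: zsummable_exchange_term.
Qed.

End zsum_exchange.

Section dlap_zsum.
Variables (R : realType) (d : R).
Implicit Types f g : int -> R.

Lemma zsummable_shift (l : int) f : zsummable f -> zsummable (fun k => f (k + l)).
Proof. exact: reindex_zsummable (bij_shift l). Qed.

Lemma zsum_shift (l : int) f : zsum (fun k => f (k + l)) = zsum f.
Proof. exact: reindex_zsum (bij_shift l). Qed.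

Lemma zsummable_dlap f : zsummable f -> zsummable (dlap d f).
Proof.
move=> sf; have sp := zsummable_shift 1 sf; have sm := zsummable_shift (-1) sf.
have := zsummableZ ((d ^+ 2)^-1) (zsummableB (zsummableD sp sm) (zsummableZ 2 sf)).
by apply: eq_zsummable => k; rewrite /dlap mulrC.
Qed.

(** Summation by parts is a shift of the index. The hypotheses bear on products only, because [f]
    will also be a polynomial weight, and [g] a kernel that is merely bounded. *)
Lemma zsum_dlap f g : zsummable (fun k => f k * g k) ->
  zsummable (fun k => f (k + 1) * g k) -> zsummable (fun k => f (k - 1) * g k) ->
  [/\ zsummable (fun k => dlap d f k * g k), zsummable (fun k => f k * dlap d g k) &
  zsum (fun k => dlap d f k * g k) = zsum (fun k => f k * dlap d g k)].
Proof.
move=> s0 sp sm.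
have sp' := zsummable_shift (-1) sp; have sm' := zsummable_shift 1 sm.
have e1 k : f (k + -1 + 1) = f k by rewrite subrK.
have e2 k : f (k + 1 - 1) = f k by rewrite addrK.
have E1 k : dlap d f k * g k = (d ^+ 2)^-1 *
    ((f (k + 1) * g k + f (k - 1) * g k) - 2 * (f k * g k)).
  by rewrite /dlap; ring.
have E2 k : f k * dlap d g k = (d ^+ 2)^-1 *
    ((f (k + -1 + 1) * g (k + -1) + f (k + 1 - 1) * g (k + 1)) - 2 * (f k * g k)).
  by rewrite /dlap e1 e2; ring.
have S1 := zsummableB (zsummableD sp sm) (zsummableZ 2 s0).
have S2 := zsummableB (zsummableD sp' sm') (zsummableZ 2 s0).
split.
- by apply: eq_zsummable (zsummableZ _ S1) => k; rewrite E1.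
- by apply: eq_zsummable (zsummableZ _ S2) => k; rewrite E2.
rewrite (eq_zsum E1) (eq_zsum E2) !zsumZ//; congr (_ * _).
rewrite !zsumB//; [|exact: zsummableD|exact: zsummableZ|exact: zsummableD|
  exact: zsummableZ]; congr (_ - _); rewrite !zsumD//.
by rewrite (zsum_shift (-1) (fun k => f (k + 1) * g k))
  (zsum_shift 1 (fun k => f (k - 1) * g k)).
Qed.

End dlap_zsum.

Section convolution.
Variables (R : realType) (d : R).
Hypothesis d0 : 0 < d.
Implicit Types f g : int -> R.

Lemma dconvE f g k : dconv d f g k = d * zsum (fun l => f (k - l) * g l).
Proof.
rewrite /dconv; congr (_ * _).
rewrite -(reindex_zsum (fun l => f l * g (k - l)) (bij_reflect k)).
by apply: eq_zsum => l; rewrite opprB addrCA subrr addr0.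
Qed.

Lemma dlap_dconv B f k :
  (forall k, zsummable (fun l => B (k - l) * f l)) ->
  dlap d (dconv d B f) k = dconv d (dlap d B) f k.
Proof.
move=> s; have s1 := s (k + 1); have s2 := s (k - 1); have s0 := s k.
have s12 := zsummableD s1 s2; have s0' := zsummableZ 2 s0.
rewrite {1}/dlap !dconvE -!mulrDr -[2 * _]mulrCA -mulrBr -mulrA; congr (_ * _).
rewrite -zsumZ// -zsumD// -zsumB// mulrC -zsumZ; last exact: zsummableB.
apply: eq_zsum => l; rewrite /dlap.
by rewrite (addrAC k 1) (addrAC k (-1)); ring.
Qed.

Section bounded_kernel.
Variables (B : int -> R) (C : R).
Hypothesis BC : forall k, `|B k| <= C.

Lemma zsummable_kernel f k : zsummable f -> zsummable (fun l => B (k - l) * f l).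
Proof. by apply: (zsummableM (C := C)) => l; exact: BC. Qed.

Lemma dconv_bound f k : zsummable f ->
  `|dconv d B f k| <= C * (d * zsum (fun l => `|f l|)).
Proof.
move=> sf; have sB := zsummable_kernel k sf.
rewrite dconvE normrM gtr0_norm// mulrCA ler_pM2l//.
apply: (le_trans (ler_norm_zsum sB)); rewrite -zsumZ; last exact: zsummable_norm.
apply: ler_zsum; [exact: zsummable_norm|by apply/zsummableZ/zsummable_norm|].
by move=> l; rewrite normrM ler_wpM2r.
Qed.

Lemma dconvDr f g k : zsummable f -> zsummable g ->
  dconv d B (fun l => f l + g l) k = dconv d B f k + dconv d B g k.
Proof.
move=> sf sg; rewrite !dconvE -mulrDr -zsumD; [|exact: zsummable_kernel..].
by congr (_ * _); apply: eq_zsum => l; rewrite mulrDr.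
Qed.

Lemma dconvBr f g k : zsummable f -> zsummable g ->
  dconv d B (fun l => f l - g l) k = dconv d B f k - dconv d B g k.
Proof.
move=> sf sg; rewrite !dconvE -mulrBr -zsumB; [|exact: zsummable_kernel..].
by congr (_ * _); apply: eq_zsum => l; rewrite mulrBr.
Qed.

Lemma dconv_dlap f k : zsummable f -> dconv d B (dlap d f) k = dconv d (dlap d B) f k.
Proof.
move=> sf; rewrite !dconvE; congr (_ * _).
have [] := @zsum_dlap R d f (fun l => B (k - l)).
- by apply: eq_zsummable (zsummable_kernel k sf) => l; rewrite mulrC.
- apply: eq_zsummable (zsummable_kernel k (zsummable_shift 1 sf)) => l.
  by rewrite mulrC.
- apply: eq_zsummable (zsummable_kernel k (zsummable_shift (-1) sf)) => l.
  by rewrite mulrC.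
move=> _ _ E; under eq_zsum do rewrite mulrC.
rewrite E; apply: eq_zsum => l; rewrite mulrC; congr (_ * _).
rewrite /dlap; congr (_ / _); congr (_ - _).
by rewrite [RHS]addrC; congr (B _ + B _); ring.
Qed.

Hypothesis Bsym : forall k, B (- k) = B k.

(** The double family is dominated by [d C |g k| |f l|], which allows the exchange of sums; evenness
    of [B] does the rest. *)
Lemma dconv_sym f g : zsummable f -> zsummable g ->
  zsum (fun k => g k * dconv d B f k) = zsum (fun k => f k * dconv d B g k).
Proof.
move=> sf sg; have nf := zsummable_norm sf; have ng := zsummable_norm sg.
pose F k l := d * (g k * (B (k - l) * f l)).
have sF k : zsummable (F k).
  exact/zsummableZ/zsummableZ/zsummable_kernel.
have -> : zsum (fun k => g k * dconv d B f k) = zsum (fun k => zsum (F k)).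
  apply: eq_zsum => k; rewrite dconvE /F zsumZ; last first.
    exact/zsummableZ/zsummable_kernel.
  by rewrite zsumZ; [ring|exact: zsummable_kernel].
rewrite zsum_exchange//.
  apply: eq_zsum => l; rewrite dconvE /F zsumZ; last first.
    rewrite /=; have := zsummableZ (f l) (zsummable_kernel l sg).
    by apply: eq_zsummable => k; rewrite -(Bsym (k - l)) opprB; ring.
  rewrite mulrCA; congr (_ * _); rewrite -zsumZ; last exact: zsummable_kernel.
  by apply: eq_zsum => k; rewrite -(Bsym (k - l)) opprB; ring.
have C0 : 0 <= C by exact: le_trans (normr_ge0 _) (BC 0).
apply: zsummable_le (zsummableZ (d * C * zsum (fun l => `|f l|)) ng) => k.
rewrite ger0_norm; last exact: zsum_ge0.
have -> : d * C * zsum (fun l => `|f l|) * `|g k| =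
   zsum (fun l => (d * C * `|g k|) * `|f l|) by rewrite zsumZ//; ring.
apply: ler_zsum; [exact: zsummable_norm|exact: zsummableZ|] => l.
rewrite /F !normrM gtr0_norm// -!mulrA ler_pM2l//.
by rewrite mulrCA ler_wpM2r// ?BC// mulr_ge0.
Qed.

End bounded_kernel.
End convolution.

(** * The Euler step *)

Section quadratic_over_linear.
Variable R : realFieldType.
Implicit Types a c r : R.

(* Joint subadditivity of [a^2 / r], free of divisions. *)
Lemma sqr_le_addM a1 a2 c1 c2 r1 r2 : 0 <= c1 -> 0 <= c2 -> 0 <= r1 -> 0 <= r2 ->
  a1 ^+ 2 <= c1 * r1 -> a2 ^+ 2 <= c2 * r2 ->
  (a1 + a2) ^+ 2 <= (c1 + c2) * (r1 + r2).
Proof.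
move=> c10 c20 r10 r20 h1 h2.
have x0 : 0 <= c1 * r2 + c2 * r1 by rewrite addr_ge0// mulr_ge0.
have h3 : (2 * (a1 * a2)) ^+ 2 <= (c1 * r2 + c2 * r1) ^+ 2.
  have e1 : (a1 * a2) ^+ 2 <= (c1 * r1) * (c2 * r2).
    by rewrite exprMn ler_pM ?sqr_ge0.
  have := sqr_ge0 (c1 * r2 - c2 * r1).
  set u := c1 * r2; set v := c2 * r1 => h.
  have -> : (2 * (a1 * a2)) ^+ 2 = 4 * (a1 * a2) ^+ 2 by ring.
  have e2 : (c1 * r1) * (c2 * r2) = u * v by rewrite /u /v; ring.
  by rewrite e2 in e1; lra.
have h4 : 2 * (a1 * a2) <= c1 * r2 + c2 * r1.
  apply: le_trans (ler_norm _) _.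
  by rewrite -(ger0_norm x0) -ler_sqr ?nnegrE// !real_normK ?num_real.
have -> : (a1 + a2) ^+ 2 = a1 ^+ 2 + a2 ^+ 2 + 2 * (a1 * a2) by ring.
have -> : (c1 + c2) * (r1 + r2) = c1 * r1 + c2 * r2 + (c1 * r2 + c2 * r1) by ring.
lra.
Qed.

End quadratic_over_linear.

(** * Bounds on the flux by its cost *)

Section flux_bounds.
Variables (R : realType) (d : R).
Hypothesis d0 : 0 < d.
Variables (rho w c : int -> R).
Hypothesis Prho : Pdelta d rho.
Hypothesis c0 : forall k, 0 <= c k.
Hypothesis sc : zsummable c.
Hypothesis wc : forall k, w k ^+ 2 <= c k * rho k.

Let r0 k : 0 <= rho k. Proof. by case: Prho. Qed.

(** Young's inequality with a free weight [m]: [m = 1] gives summability, an optimised [m] gives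
    [flux_norm1]. *)
Let w_young m k : 0 < m -> `|w k| <= (m * c k + m^-1 * rho k) / 2.
Proof.
move=> m0; have m0' : 0 <= m^-1 by rewrite invr_ge0 ltW.
have x0 : 0 <= (m * c k + m^-1 * rho k) / 2.
  by rewrite divr_ge0// addr_ge0// mulr_ge0// ltW.
rewrite -(ger0_norm x0) -ler_sqr ?nnegrE// !real_normK ?num_real//.
apply: le_trans (wc k) _.
have := sqr_ge0 (m * c k - m^-1 * rho k).
have : (m * c k) * (m^-1 * rho k) = c k * rho k by field; rewrite gt_eqF.
set x := m * c k; set y := m^-1 * rho k; set z := c k * rho k => <-; nra.
Qed.

Lemma flux_norm_le k : `|w k| <= (c k + rho k) / 2.
Proof. by have := w_young k ltr01; rewrite invr1 !mul1r. Qed.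

Lemma flux_summable : zsummable w.
Proof.
have := zsummableZ 2^-1 (zsummableD sc (Pdelta_summable d0 Prho)).
by apply: zsummable_le => k; rewrite mulrC; exact: flux_norm_le.
Qed.

(** Cauchy-Schwarz against a density of mass one. With the weight [m = X^-1], the summed Young
    inequality reads [X <= (X^-1 (d zsum c) + X) / 2], and multiplying by [X] gives the claim. *)
Lemma flux_norm1 : (d * zsum (fun k => `|w k|)) ^+ 2 <= d * zsum c.
Proof.
set X := d * zsum _; have X0 : 0 <= X by rewrite mulr_ge0 ?(ltW d0)// zsum_ge0.
have [Xp|] := ltP 0 X; last first.
  move=> Xn; have -> : X = 0 by apply/le_anti/andP.
  by rewrite expr2 mul0r mulr_ge0 ?(ltW d0)// zsum_ge0.
have sr := Pdelta_summable d0 Prho.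
have h : X <= (X^-1 * (d * zsum c) + X * (d * zsum rho)) / 2.
  have -> : (X^-1 * (d * zsum c) + X * (d * zsum rho)) / 2 =
      d * zsum (fun k => 2^-1 * (X^-1 * c k + X^-1^-1 * rho k)).
    rewrite zsumZ; last by apply: zsummableD; exact: zsummableZ.
    rewrite zsumD; [|exact: zsummableZ..].
    by rewrite !zsumZ// invrK; ring.
  rewrite ler_pM2l//; apply: ler_zsum.
  - exact/zsummable_norm/flux_summable.
  - by apply/zsummableZ/zsummableD; exact: zsummableZ.
  - by move=> k; rewrite mulrC; apply: w_young; rewrite invr_gt0.
move: h; rewrite (Pdelta_mass d0 Prho) mulr1 -(ler_pM2l Xp).
have -> : X * ((X^-1 * (d * zsum c) + X) / 2) = (d * zsum c + X ^+ 2) / 2.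
  by field; rewrite gt_eqF.
by rewrite -expr2; lra.
Qed.

End flux_bounds.

Section potential.
Variables (R : realType) (d : R).
Hypothesis d0 : 0 < d.
Variables (V : int -> R) (M L1 L2 : R).
Hypothesis V0 : forall k, 0 < V k.
Hypothesis VM : forall k, V k <= M.
Hypothesis KL1 : forall k, `|dlap d V k| <= L1.
Hypothesis VL2 : forall k, dlap d (fun j => V j ^+ 2) k <= L2 * V k.

Let VMn k : `|V k| <= M. Proof. by rewrite gtr0_norm. Qed.

Lemma kernel_bound_ge0 : 0 <= M. Proof. exact: le_trans (normr_ge0 _) (VMn 0). Qed.

(* [dlap (V^2) >= 2 V dlap V] by convexity of the square. *)
Lemma Lambda_ge0 : 0 <= 2 * L1 + L2.
Proof.
have h1 : 2 * V 0 * dlap d V 0 <= dlap d (fun j => V j ^+ 2) 0.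
  rewrite /dlap mulrA ler_pM2r ?invr_gt0 ?exprn_gt0//.
  have := sqr_ge0 (V (0 + 1) - V 0); have := sqr_ge0 (V (0 - 1) - V 0); nra.
have h2 := VL2 0; have h3 := KL1 0; have h4 := V0 0.
have h5 : - L1 <= dlap d V 0 by move: h3; rewrite ler_norml => /andP[].
have : 0 <= (2 * L1 + L2) * V 0 by nra.
by rewrite pmulr_lge0.
Qed.

Section velocity.
Variable rho : int -> R.
Hypothesis Prho : Pdelta d rho.
Let v := dconv d V rho.
Let r0 k : 0 <= rho k. Proof. by case: Prho. Qed.
Let sr := Pdelta_summable d0 Prho.
Let sV k : zsummable (fun l => V (k - l) * rho l).
Proof. exact: (zsummable_kernel (C := M)). Qed.

Lemma velocity_le k : v k <= M.
Proof.
rewrite (le_trans (ler_norm _))// (le_trans (dconv_bound d0 VMn k sr))//.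
by under eq_zsum do rewrite ger0_norm//; rewrite (Pdelta_mass d0 Prho) mulr1.
Qed.

(** A sum of nonnegative terms vanishes only if every term does, and [V > 0] would then force
    [rho = 0], against mass one. Strictness matters because [euler_cost] divides by [v]. *)
Lemma velocity_gt0 k : 0 < v k.
Proof.
have h l : 0 <= V (k - l) * rho l by rewrite mulr_ge0// ltW.
rewrite lt_neqAle [0 <= _]mulr_ge0 ?(ltW d0)//; last first.
  by rewrite -(reindex_zsum _ (bij_reflect k)) zsum_ge0// => l;
     rewrite opprB addrCA subrr addr0.
rewrite andbT eq_sym /v dconvE mulf_eq0 gt_eqF//=; apply/negP => /eqP s0.
have rz l : rho l = 0.
  have /eqP := zsum_eq0 l h (sV k) s0.
  by rewrite mulf_eq0 gt_eqF//= => /eqP.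
have := Pdelta_mass d0 Prho.
have -> : zsum rho = zsum (fun l => 0 * rho l).
  by apply: eq_zsum => l; rewrite mul0r.
by rewrite zsumZ// mul0r mulr0 => /esym/eqP; rewrite oner_eq0.
Qed.

Lemma velocity_norm k : `|v k| <= M.
Proof. by rewrite gtr0_norm ?velocity_le// velocity_gt0. Qed.

(* Tangent-line form of the joint convexity of [(x^2 + y^2) / z]: the affine
   inequality in [V] survives averaging against [rho]. *)
Lemma velocity_sqr_dlap k : dlap d (fun j => v j ^+ 2) k <= L2 * v k.
Proof.
have vk := velocity_gt0 k.
(* The slopes of the tangent: [2 p x - p ^ 2 z <= x ^ 2 / z], with equality at [p = x / z], so
   nothing is lost when the averaged inequality is evaluated at [v]. *)
pose p := v (k + 1) / v k; pose q := v (k - 1) / v k.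
have h j : 2 * p * V (j + 1) + 2 * q * V (j - 1) - (p ^+ 2 + q ^+ 2 + 2) * V j
    <= d ^+ 2 * L2.
  have Vj := V0 j; rewrite -(ler_pM2r Vj).
  have := VL2 j; rewrite /dlap ler_pdivrMr ?exprn_gt0// => hj.
  have := sqr_ge0 (V (j + 1) - p * V j); have := sqr_ge0 (V (j - 1) - q * V j).
  nra.
have sV1 := zsummable_shift 0 (sV (k + 1)).
have : 2 * p * v (k + 1) + 2 * q * v (k - 1) - (p ^+ 2 + q ^+ 2 + 2) * v k
   <= d ^+ 2 * L2 * (d * zsum rho).
  rewrite /v !dconvE.
  have -> : 2 * p * (d * zsum (fun l => V (k + 1 - l) * rho l)) +
      2 * q * (d * zsum (fun l => V (k - 1 - l) * rho l)) -
      (p ^+ 2 + q ^+ 2 + 2) * (d * zsum (fun l => V (k - l) * rho l)) =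
      d * zsum (fun l => 2 * p * (V (k + 1 - l) * rho l) +
      2 * q * (V (k - 1 - l) * rho l) - (p ^+ 2 + q ^+ 2 + 2) * (V (k - l) * rho l)).
    rewrite zsumB; [|by apply: zsummableD; exact: zsummableZ|exact: zsummableZ].
    rewrite zsumD; [|exact: zsummableZ..].
    by rewrite !zsumZ//; ring.
  rewrite [d ^+ 2 * L2 * _]mulrCA ler_pM2l// -zsumZ//; apply: ler_zsum.
  - by apply: zsummableB; [apply: zsummableD|]; exact: zsummableZ.
  - exact: zsummableZ.
  - move=> l; have := ler_wpM2r (r0 l) (h (k - l)).
    by rewrite (addrAC k 1) (addrAC k (-1)) => ?; lra.
rewrite (Pdelta_mass d0 Prho) mulr1 => hh.
rewrite {1}/dlap ler_pdivrMr ?exprn_gt0//.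
move: hh; rewrite /p /q -(ler_pM2r vk).
have vn : v k != 0 by rewrite gt_eqF.
set x := v (k + 1); set y := v (k - 1); set z := v k.
have -> : (2 * (x / z) * x + 2 * (y / z) * y - ((x / z) ^+ 2 + (y / z) ^+ 2 + 2) * z) * z
  = x ^+ 2 + y ^+ 2 - 2 * z ^+ 2 by field.
by move=> hh; apply: (le_trans hh); rewrite [leRHS]mulrC !mulrA.
Qed.

End velocity.

Section euler_step.
Variables (rho w c : int -> R) (t x : R).
Hypothesis Prho : Pdelta d rho.
Hypothesis c0 : forall k, 0 <= c k.
Hypothesis sc : zsummable c.
Hypothesis wc : forall k, w k ^+ 2 <= c k * rho k.
Hypotheses (t0 : 0 <= t) (tM : 4 * t * M <= d ^+ 2) (x01 : 0 <= x <= 1).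

Let v := dconv d V rho.
Let u := dconv d (dlap d V) w.
Let y k := x * u k - v k.
(** [b * v k] is the fraction of the mass at [k] that the step sends to each of the two
    neighbours. *)
Let b := x * t / d ^+ 2.

Definition euler_density k : R := rho k + x * t * dlap d (fun j => rho j * v j) k.

(** Its Laplacian is the time derivative of [euler_density] along a curve when [x = 1 - s]: the term
    [- t rho v] differentiates the step length, [dlap w] is the derivative of [rho], and [u] that of
    [v]. *)
Definition euler_flux k : R :=
  w k - t * (rho k * v k) + x * t * (dlap d w k * v k + rho k * u k).

(* Density and flux at [k] are sums of a part carried by [rho k], [w k] with
   weight [1 - 2 b v k] and parts carried by the neighbours with weight
   [b v]; [sqr_le_addM] adds the costs of the parts. *)
Definition euler_cost k : R :=
  (1 - 2 * b * v k) * c k + 2 * t * (w k * y k) + 2 * t ^+ 2 * (rho k * y k ^+ 2)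
  + b * v k ^+ 2 * (c (k + 1) / v (k + 1) + c (k - 1) / v (k - 1)).

Let r0 k : 0 <= rho k. Proof. by case: Prho. Qed.
Let v0 k : 0 < v k. Proof. exact: velocity_gt0. Qed.
Let vM k : v k <= M. Proof. exact: velocity_le. Qed.
Let sr := Pdelta_summable d0 Prho.
Let sw := flux_summable d0 Prho c0 sc wc.
Let d20 : 0 < d ^+ 2. Proof. exact: exprn_gt0. Qed.
Let x0 : 0 <= x. Proof. by case/andP: x01. Qed.
Let x1 : x <= 1. Proof. by case/andP: x01. Qed.
Let b0 : 0 <= b. Proof. by rewrite divr_ge0 ?(ltW d20)// mulr_ge0. Qed.

(** The margin one half, rather than mere positivity, is what lets the term [2 t ^ 2 rho y ^ 2] of
    the cost complete the square in [c1_ge0] and dominate [(t rho y) ^ 2] in [c1_bound]. *)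
Let alpha k : 1 / 2 <= 1 - 2 * b * v k.
Proof.
have h1 : 4 * (x * t * v k) <= d ^+ 2.
  apply: le_trans tM; rewrite -[leRHS]mulrA ler_pM2l//.
  by apply: ler_pM; [exact: mulr_ge0|exact: ltW|rewrite ler_piMl|].
suff : b * v k <= 1 / 4 by lra.
by rewrite /b mulrAC ler_pdivrMr//; lra.
Qed.

Let densityE k : euler_density k = (1 - 2 * b * v k) * rho k +
  b * (rho (k + 1) * v (k + 1)) + b * (rho (k - 1) * v (k - 1)).
Proof. by rewrite /euler_density /dlap /b; ring. Qed.

Let fluxE k : euler_flux k = ((1 - 2 * b * v k) * w k + t * (rho k * y k)) +
  b * (v k * w (k + 1)) + b * (v k * w (k - 1)).
Proof. by rewrite /euler_flux /dlap /b /y; ring. Qed.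

Let c1 k := (1 - 2 * b * v k) * c k + 2 * t * (w k * y k) +
  2 * t ^+ 2 * (rho k * y k ^+ 2).

Let costE k : euler_cost k = c1 k + b * v k ^+ 2 * (c (k + 1) / v (k + 1)) +
  b * v k ^+ 2 * (c (k - 1) / v (k - 1)).
Proof. by rewrite /euler_cost /c1; ring. Qed.

Let c1_ge0 k : 0 <= c1 k.
Proof.
have ca : 0 <= rho k * c1 k -> 0 < rho k -> 0 <= c1 k.
  by move=> h r; rewrite -(pmulr_rge0 _ r).
have a0 := alpha k; have := wc k; have := c0 k; have := r0 k.
rewrite le_eqVlt => /orP[/eqP rz c0k|rp c0k] wck.
  move: wck; rewrite -rz mulr0 => w2.
  have wz : w k = 0 by apply/eqP; rewrite -sqrf_eq0 -[_ == 0]andbT eq_le w2 sqr_ge0.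
  by rewrite /c1 wz -rz !mul0r !mulr0 !addr0 mulr_ge0//; lra.
apply: ca => //; rewrite /c1.
have e : rho k * ((1 - 2 * b * v k) * c k + 2 * t * (w k * y k) +
    2 * t ^+ 2 * (rho k * y k ^+ 2)) =
   (1 - 2 * b * v k) * (c k * rho k) + 2 * w k * (t * (rho k * y k)) +
   2 * (t * (rho k * y k)) ^+ 2 by ring.
rewrite e; set z := t * (rho k * y k); set A := 1 - 2 * b * v k in a0 *.
have : A * w k ^+ 2 <= A * (c k * rho k) by rewrite ler_wpM2l//; lra.
have := sqr_ge0 (w k + 2 * z); nra.
Qed.

Let c1_bound k : ((1 - 2 * b * v k) * w k + t * (rho k * y k)) ^+ 2 <=
  c1 k * ((1 - 2 * b * v k) * rho k).
Proof.
have a0 := alpha k; rewrite /c1.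
set A := 1 - 2 * b * v k in a0 *.
have -> : (A * c k + 2 * t * (w k * y k) + 2 * t ^+ 2 * (rho k * y k ^+ 2)) * (A * rho k) =
  A ^+ 2 * (c k * rho k) + 2 * A * w k * (t * (rho k * y k)) +
  2 * A * (t * (rho k * y k)) ^+ 2 by ring.
set z := t * (rho k * y k).
have : A ^+ 2 * w k ^+ 2 <= A ^+ 2 * (c k * rho k) by rewrite ler_wpM2l ?sqr_ge0.
have := sqr_ge0 z; nra.
Qed.

Lemma euler_density_ge0 k : 0 <= euler_density k.
Proof.
have a0 := alpha k; have h j : 0 <= b * (rho j * v j).
  by rewrite mulr_ge0 ?b0// mulr_ge0 ?r0// (ltW (v0 j)).
by rewrite densityE !addr_ge0// mulr_ge0//; lra.
Qed.

Let side_ge0 k j : 0 <= b * v k ^+ 2 * (c j / v j).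
Proof.
rewrite mulr_ge0 ?divr_ge0 ?c0 ?(ltW (v0 j))//.
by rewrite mulr_ge0 ?sqr_ge0 ?b0.
Qed.

(** The flux arriving from [j] carries the velocity of the receiving site [k], the mass that of the
    sending site [j]; the factor [v k ^ 2 / v j] is the price of this mismatch. *)
Let side_bound k j : (b * (v k * w j)) ^+ 2 <=
  b * v k ^+ 2 * (c j / v j) * (b * (rho j * v j)).
Proof.
have -> : b * v k ^+ 2 * (c j / v j) * (b * (rho j * v j)) =
  (b * v k) ^+ 2 * (c j * rho j) by field; rewrite gt_eqF.
have -> : (b * (v k * w j)) ^+ 2 = (b * v k) ^+ 2 * w j ^+ 2 by ring.
by rewrite ler_wpM2l ?sqr_ge0.
Qed.

Lemma euler_cost_ge0 k : 0 <= euler_cost k.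
Proof.
rewrite costE; apply: addr_ge0; last exact: side_ge0.
by apply: addr_ge0; [exact: c1_ge0|exact: side_ge0].
Qed.

Lemma euler_bound k : euler_flux k ^+ 2 <= euler_cost k * euler_density k.
Proof.
have a0 := alpha k.
have ar : 0 <= (1 - 2 * b * v k) * rho k by rewrite mulr_ge0//; lra.
have br j : 0 <= b * (rho j * v j).
  by rewrite mulr_ge0 ?b0// mulr_ge0 ?r0// (ltW (v0 j)).
rewrite fluxE costE densityE; apply: sqr_le_addM => //; try by rewrite addr_ge0 ?c1_ge0 ?side_ge0.
by apply: sqr_le_addM => //; exact: c1_ge0.
Qed.

Let uL k : `|u k| <= L1 * (d * zsum (fun l => `|w l|)).
Proof. exact: dconv_bound. Qed.

Let L10 : 0 <= L1. Proof. exact: le_trans (normr_ge0 _) (KL1 0). Qed.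

Let yM k : `|y k| <= L1 * (d * zsum (fun l => `|w l|)) + M.
Proof.
rewrite (le_trans (ler_normB _ _))// lerD//; last exact: velocity_norm.
rewrite normrM (ger0_norm x0) (le_trans _ (uL k))// ler_piMl//.
Qed.

Let yM2 k : y k ^+ 2 <= 2 * L1 ^+ 2 * (d * zsum c) + 2 * M ^+ 2.
Proof.
have := yM k; have := flux_norm1 d0 Prho c0 sc wc.
have X0 : 0 <= d * zsum (fun l => `|w l|) by rewrite mulr_ge0 ?(ltW d0)// zsum_ge0.
move: X0; set X := d * zsum _; set A := d * zsum c => X0 XA yX.
have M0 := kernel_bound_ge0.
have h : y k ^+ 2 <= (L1 * X + M) ^+ 2.
  rewrite -real_normK ?num_real// ler_sqr ?nnegrE//.
  by rewrite addr_ge0// mulr_ge0.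
apply: (le_trans h).
have h1 : L1 ^+ 2 * X ^+ 2 <= L1 ^+ 2 * A by rewrite ler_wpM2l ?sqr_ge0.
have := sqr_ge0 (L1 * X - M); nra.
Qed.

(** After a shift of the index, the two neighbours charge [c k] with the weight [b * gam k]. In
    [gam_le], the term [2 v] will cancel the loss [- 2 b v] of the central weight, leaving
    [b d ^ 2 L2 = x t L2]. *)
Let gam k := (v (k + 1) ^+ 2 + v (k - 1) ^+ 2) / v k.

Let gam_ge0 k : 0 <= gam k.
Proof. by rewrite divr_ge0 ?addr_ge0 ?sqr_ge0// ltW. Qed.

Let gam_le k : gam k <= d ^+ 2 * L2 + 2 * v k.
Proof.
rewrite ler_pdivrMr//.
have := velocity_sqr_dlap Prho k; rewrite /dlap ler_pdivrMr// -/v.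
nra.
Qed.

Let sgam : zsummable (fun k => gam k * c k).
Proof.
apply: (zsummableM (C := d ^+ 2 * L2 + 2 * M)) sc => k.
by rewrite ger0_norm// (le_trans (gam_le k))// lerD2l ler_pM2l.
Qed.

Let svw : zsummable (fun k => w k * v k).
Proof.
have h k : `|v k| <= M by exact: velocity_norm.
by apply: eq_zsummable (zsummableM h sw) => k; rewrite mulrC.
Qed.

Let suw : zsummable (fun k => w k * u k).
Proof.
by apply: eq_zsummable (zsummableM uL sw) => k; rewrite mulrC.
Qed.

Let svc : zsummable (fun k => v k * c k).
Proof. by apply: (zsummableM (C := M)) sc => k; exact: velocity_norm. Qed.

Let swy : zsummable (fun k => w k * y k).
Proof.
have := zsummableB (zsummableZ x suw) svw.
by apply: eq_zsummable => k; rewrite /y; ring.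
Qed.

Let sry : zsummable (fun k => rho k * y k ^+ 2).
Proof.
have := @zsummableM _ (2 * L1 ^+ 2 * (d * zsum c) + 2 * M ^+ 2) (fun k => y k ^+ 2) rho.
move=> h; apply: eq_zsummable (h _ sr) => k; first by rewrite mulrC.
by rewrite ger0_norm ?sqr_ge0 ?yM2.
Qed.

Let side j k := v (k - j) ^+ 2 * (c k / v k).

Let sside (j : int) : (forall k, v (k - j) ^+ 2 / v k <= gam k) -> zsummable (side j).
Proof.
move=> h; apply: zsummable_le sgam => k.
have -> : side j k = v (k - j) ^+ 2 / v k * c k by rewrite /side; ring.
rewrite ger0_norm; first by rewrite ler_wpM2r.
by rewrite mulr_ge0// divr_ge0 ?sqr_ge0// ltW.
Qed.

Let s1 : zsummable (side 1).
Proof.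
apply: sside => k; rewrite /gam ler_pM2r ?invr_gt0//.
by rewrite lerDr sqr_ge0.
Qed.

Let s2 : zsummable (side (-1)).
Proof.
apply: sside => k; rewrite /gam ler_pM2r ?invr_gt0// opprK.
by rewrite lerDl sqr_ge0.
Qed.

Let sideE k : euler_cost k = (c k - 2 * b * (v k * c k) + 2 * t * (w k * y k) +
  2 * t ^+ 2 * (rho k * y k ^+ 2)) + b * (side 1 (k + 1) + side (-1) (k + -1)).
Proof.
rewrite /euler_cost /side addrK opprK subrK; ring.
Qed.

Let p1 := zsummableB sc (zsummableZ (2 * b) svc).
Let p2 := zsummableD p1 (zsummableZ (2 * t) swy).
Let p3 := zsummableD p2 (zsummableZ (2 * t ^+ 2) sry).
Let p4 := zsummableD (zsummable_shift 1 s1) (zsummable_shift (-1) s2).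

Lemma euler_summable : zsummable euler_cost.
Proof.
apply: eq_zsummable (zsummableD p3 (zsummableZ b p4)) => k.
by rewrite sideE.
Qed.

(** The weights [gam - 2 v] contribute [t L2]. The part [x u] of [y], paired with [w], contributes
    [2 t L1], because [|u| <= L1 (d zsum |w|)] and [flux_norm1] bounds the square of the norm by the
    cost. The part [- v] is kept as the power term, and [y ^ 2] gives the errors of order
    [t ^ 2]. *)
Lemma euler_cost_sum : d * zsum euler_cost <=
  (1 + t * (2 * L1 + L2) + 4 * t ^+ 2 * L1 ^+ 2) * (d * zsum c) +
  4 * t ^+ 2 * M ^+ 2 - 2 * t * (d * zsum (fun k => w k * v k)).
Proof.
have E : zsum euler_cost = zsum c + b * (zsum (fun k => gam k * c k) -
    2 * zsum (fun k => v k * c k)) + 2 * t * (x * zsum (fun k => w k * u k)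
    - zsum (fun k => w k * v k)) + 2 * t ^+ 2 * zsum (fun k => rho k * y k ^+ 2).
  rewrite (eq_zsum sideE) zsumD; [|exact: p3|exact: (zsummableZ b p4)].
  rewrite zsumD; [|exact: p2|exact: (zsummableZ _ sry)].
  rewrite zsumD; [|exact: p1|exact: (zsummableZ _ swy)].
  rewrite zsumB; [|exact: sc|exact: (zsummableZ _ svc)].
  rewrite (zsumZ _ svc) (zsumZ _ swy) (zsumZ _ sry) (zsumZ _ p4) zsumD; [|exact: (zsummable_shift 1 s1)|exact: (zsummable_shift (-1) s2)].
  rewrite (zsum_shift 1 (side 1)) (zsum_shift (-1) (side (-1))).
  have -> : zsum (fun k => w k * y k) = x * zsum (fun k => w k * u k) -
      zsum (fun k => w k * v k).
    rewrite -zsumZ// -zsumB//; last exact: zsummableZ.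
    by apply: eq_zsum => k; rewrite /y; ring.
  have -> : zsum (fun k => gam k * c k) = zsum (side 1) + zsum (side (-1)).
    rewrite -zsumD//; apply: eq_zsum => k; rewrite /gam /side opprK; ring.
  ring.
have A0 : 0 <= d * zsum c by rewrite mulr_ge0 ?(ltW d0)// zsum_ge0.
have h1 : b * (zsum (fun k => gam k * c k) - 2 * zsum (fun k => v k * c k)) <=
    t * (x * L2 * zsum c).
  have -> : t * (x * L2 * zsum c) = b * (d ^+ 2 * L2 * zsum c).
    by rewrite /b; field; rewrite gt_eqF.
  rewrite ler_wpM2l// lerBlDr -!zsumZ// -zsumD; [|exact: zsummableZ..].
  apply: ler_zsum => //; first by apply: zsummableD; exact: zsummableZ.
  move=> k; rewrite mulrA -mulrDl ler_wpM2r//; exact: gam_le.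
have h2 : d * zsum (fun k => w k * u k) <= L1 * (d * zsum c).
  apply: (@le_trans _ _ (L1 * (d * zsum (fun k => `|w k|)) ^+ 2)); last first.
    by rewrite ler_wpM2l//; exact: (flux_norm1 d0 Prho c0 sc wc).
  have -> : L1 * (d * zsum (fun k => `|w k|)) ^+ 2 =
      d * zsum (fun k => (L1 * (d * zsum (fun k => `|w k|))) * `|w k|).
    by rewrite zsumZ ?expr2; [ring|exact: zsummable_norm].
  rewrite ler_pM2l//; apply: ler_zsum => //.
    exact/zsummableZ/zsummable_norm.
  move=> k; rewrite (le_trans (ler_norm _))// normrM mulrC ler_wpM2r//.
have h3 : d * zsum (fun k => rho k * y k ^+ 2) <= 2 * L1 ^+ 2 * (d * zsum c) + 2 * M ^+ 2.
  set Y := leRHS; have -> : Y = d * (Y * zsum rho).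
    by rewrite mulrCA (Pdelta_mass d0 Prho) mulr1.
  rewrite ler_pM2l//.
  rewrite -zsumZ//; apply: ler_zsum => //; first exact: zsummableZ.
  by move=> k; rewrite mulrC ler_wpM2r.
have h4 : x * (d * zsum (fun k => w k * u k)) <= x * (L1 * (d * zsum c)).
  by rewrite ler_wpM2l.
(* [L2] carries no sign hypothesis, so the factor [x <= 1] is dropped on the whole sum [2 L1 + L2],
   which [Lambda_ge0] shows to be nonnegative. *)
have h5 : t * (x * ((2 * L1 + L2) * (d * zsum c))) <= t * ((2 * L1 + L2) * (d * zsum c)).
  rewrite ler_wpM2l// ler_piMl// mulr_ge0//; exact: Lambda_ge0.
have h6 : d * (b * (zsum (fun k => gam k * c k) - 2 * zsum (fun k => v k * c k))) <=
    d * (t * (x * L2 * zsum c)) by rewrite ler_wpM2l// ltW.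
have h7 : t * (x * (d * zsum (fun k => w k * u k))) <= t * (x * (L1 * (d * zsum c))).
  by rewrite ler_wpM2l.
have h8 : t ^+ 2 * (d * zsum (fun k => rho k * y k ^+ 2)) <=
   t ^+ 2 * (2 * L1 ^+ 2 * (d * zsum c) + 2 * M ^+ 2) by rewrite ler_wpM2l ?sqr_ge0.
rewrite E.
move: h5 h6 h7 h8.
set A := zsum c; set G := _ - 2 * _; set U := zsum (fun k => w k * u k).
set P := zsum (fun k => w k * v k); set Y := zsum _ => h5 h6 h7 h8.
nra.
Qed.

(** Summation by parts against [1], [k] and [k ^ 2]: the Laplacians of the first two vanish, which
    preserves mass and mean, and the third keeps the second moment finite. *)
Lemma euler_Pdelta : Pdelta d euler_density.
Proof.
have g0 k : 0 <= rho k * v k by rewrite mulr_ge0// ltW.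
have gr k : rho k * v k <= M * rho k by rewrite mulrC ler_wpM2r.
have sg : zsummable (fun k => rho k * v k).
  by apply: zsummable_le (zsummableZ M sr) => k; rewrite ger0_norm.
have sg2 : zsummable (fun k => (k%:~R : R) ^+ 2 * (rho k * v k)).
  apply: zsummable_le (zsummableZ M (Pdelta_summable2 d0 Prho)) => k.
  rewrite ger0_norm; last by rewrite mulr_ge0 ?sqr_ge0.
  by rewrite [leRHS]mulrCA ler_wpM2l ?sqr_ge0.
have sg1 := zsummable_moment1 sg sg2.
have [_ sl1 E1] : [/\ zsummable (fun k : int => dlap d (fun k => (k%:~R : R)) k * (rho k * v k)),
  zsummable (fun k => (k%:~R : R) * dlap d (fun k => rho k * v k) k) &
  zsum (fun k : int => dlap d (fun k => (k%:~R : R)) k * (rho k * v k)) =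
  zsum (fun k => (k%:~R : R) * dlap d (fun k => rho k * v k) k)].
  apply: zsum_dlap => //.
    apply: eq_zsummable (zsummableD sg1 sg) => k.
    by rewrite rmorphD/=; ring.
  apply: eq_zsummable (zsummableB sg1 sg) => k.
  by rewrite rmorphB/=; ring.
have [_ sl2 _] : [/\ zsummable (fun k : int => dlap d (fun k => (k%:~R : R) ^+ 2) k * (rho k * v k)),
  zsummable (fun k => (k%:~R : R) ^+ 2 * dlap d (fun k => rho k * v k) k) &
  zsum (fun k : int => dlap d (fun k => (k%:~R : R) ^+ 2) k * (rho k * v k)) =
  zsum (fun k => (k%:~R : R) ^+ 2 * dlap d (fun k => rho k * v k) k)].
  apply: zsum_dlap => //.
    apply: eq_zsummable (zsummableD (zsummableD sg2 (zsummableZ 2 sg1)) sg) => k.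
    by rewrite rmorphD/=; ring.
  apply: eq_zsummable (zsummableD (zsummableB sg2 (zsummableZ 2 sg1)) sg) => k.
  by rewrite rmorphB/=; ring.
have [_ sl0 E0] : [/\ zsummable (fun k : int => dlap d (fun=> (1 : R)) k * (rho k * v k)),
  zsummable (fun k => (1 : R) * dlap d (fun k => rho k * v k) k) &
  zsum (fun k : int => dlap d (fun=> (1 : R)) k * (rho k * v k)) =
  zsum (fun k => (1 : R) * dlap d (fun k => rho k * v k) k)].
  by apply: zsum_dlap; apply: eq_zsummable sg => k; rewrite mul1r.
have sdl : zsummable (dlap d (fun k => rho k * v k)) by exact: zsummable_dlap.
have Z0 : zsum (dlap d (fun k => rho k * v k)) = 0.
  transitivity (zsum (fun k => (1 : R) * dlap d (fun k => rho k * v k) k)).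
    by apply: eq_zsum => k; rewrite mul1r.
  rewrite -E0 (@eq_zsum _ _ (fun k => 0 * (rho k * v k))) ?zsumZ ?mul0r// => k.
  by rewrite /dlap; ring.
have Z1 : zsum (fun k => (k%:~R : R) * dlap d (fun k => rho k * v k) k) = 0.
  rewrite -E1 (@eq_zsum _ _ (fun k => 0 * (rho k * v k))) ?zsumZ ?mul0r// => k.
  by rewrite /dlap rmorphD rmorphB/=; ring.
apply: PdeltaI => //.
- exact: euler_density_ge0.
- by apply: zsummableD => //; exact: zsummableZ.
- rewrite zsumD//; last exact: zsummableZ.
  by rewrite zsumZ// Z0 mulr0 addr0; exact: Pdelta_mass.
- have := zsummableD (Pdelta_summable2 d0 Prho) (zsummableZ (x * t) sl2).
  by apply: eq_zsummable => k; rewrite /euler_density; ring.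
- have sr1 := zsummable_moment1 sr (Pdelta_summable2 d0 Prho).
  rewrite (@eq_zsum _ _ (fun k => k%:~R * rho k + x * t * ((k%:~R : R) *
     dlap d (fun k => rho k * v k) k))); last by move=> k; rewrite /euler_density; ring.
  rewrite zsumD//; last exact: zsummableZ.
  by rewrite zsumZ// Z1 mulr0 addr0; exact: (zsumE_Pdelta_mean d0 Prho).
Qed.

End euler_step.
End potential.

(** * The energy along curves *)

Section cutoff.
Variable R : realFieldType.
Implicit Types e x : R.

(** A rational profile reduces all difference estimates to polynomial inequalities. It decays
    exactly as fast as [W] may grow, so its product with [W] is bounded for each [e]. *)
Definition cutoff e x : R := (1 + e * x ^+ 2)^-1.

Let den_ge1 e x : 0 < e -> 1 <= 1 + e * x ^+ 2.
Proof. by move=> e0; rewrite lerDl mulr_ge0 ?sqr_ge0// ltW. Qed.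

Let den_gt0 e x : 0 < e -> 0 < 1 + e * x ^+ 2.
Proof. by move=> /(den_ge1 x); exact: lt_le_trans. Qed.

Let den_ge e x : e <= 1 -> e * (1 + x ^+ 2) <= 1 + e * x ^+ 2.
Proof. by move=> e1; rewrite mulrDr mulr1 lerD2r. Qed.

Lemma cutoff_ge0 e x : 0 < e -> 0 <= cutoff e x.
Proof. by move=> e0; rewrite invr_ge0 ltW// den_gt0. Qed.

Lemma cutoff_le1 e x : 0 < e -> cutoff e x <= 1.
Proof. by move=> e0; rewrite invf_le1 ?den_gt0// den_ge1. Qed.

(** The bound is uniform in [e]; its decay in [x] offsets the linear growth of the increments of
    [W]. *)
Lemma cutoff_diff e x y : 0 < e -> e <= 1 -> y = 1 \/ y = -1 ->
  `|cutoff e (x + y) - cutoff e x| * (1 + `|x|) <= 4.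
Proof.
move=> e0 e1 hy.
have D0 := den_gt0 x e0; have Dp0 := den_gt0 (x + y) e0.
have Dp1 := den_ge1 (x + y) e0; have De := den_ge x e1.
have -> : cutoff e (x + y) - cutoff e x =
    - (e * (2 * x * y + y ^+ 2)) / ((1 + e * x ^+ 2) * (1 + e * (x + y) ^+ 2)).
  by rewrite /cutoff; field; rewrite !gt_eqF.
have y2 : y ^+ 2 = 1 by case: hy => ->; ring.
rewrite y2 normrM normrN normfV [X in _ / X]gtr0_norm ?mulr_gt0//.
rewrite mulrAC ler_pdivrMr ?mulr_gt0//.
rewrite normrM (gtr0_norm e0).
have h : `|2 * x * y + 1| <= 2 * `|x| + 1.
  rewrite (le_trans (ler_normD _ _))// normr1 lerD2r !normrM.
  have -> : `|y| = 1 by case: hy => ->; rewrite ?normrN normr1.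
  by rewrite mulr1 ger0_norm.
have n0 := normr_ge0 x; have x2 : x ^+ 2 = `|x| ^+ 2 by rewrite real_normK ?num_real.
have h2 : `|2 * x * y + 1| * (1 + `|x|) <= 4 * (1 + x ^+ 2).
  rewrite x2; have : `|2 * x * y + 1| * (1 + `|x|) <= (2 * `|x| + 1) * (1 + `|x|).
    by rewrite ler_wpM2r// addr_ge0.
  have := sqr_ge0 (`|x| - 1); nra.
have h3 : e * (`|2 * x * y + 1| * (1 + `|x|)) <= e * (4 * (1 + x ^+ 2)).
  by rewrite ler_wpM2l// ltW.
rewrite -[leLHS]mulrA (le_trans h3)//.
have h4 : 4 * (1 + e * x ^+ 2) <= 4 * ((1 + e * x ^+ 2) * (1 + e * (x + y) ^+ 2)).
  by rewrite ler_pM2l// ler_peMr// ltW.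
by apply: le_trans h4; lra.
Qed.

(** Second differences gain one more power of [x], uniformly in [e], and offset the quadratic growth
    of [W] itself. *)
Lemma cutoff_diff2 e x : 0 < e -> e <= 1 ->
  `|cutoff e (x + 1) + cutoff e (x - 1) - 2 * cutoff e x| * (1 + x ^+ 2) <= 10.
Proof.
move=> e0 e1.
have D0 := den_gt0 x e0; have De := den_ge x e1.
have p0 := den_gt0 (x + 1) e0; have p1 := den_ge1 (x + 1) e0.
have m0 := den_gt0 (x - 1) e0; have m1 := den_ge1 (x - 1) e0.
have -> : cutoff e (x + 1) + cutoff e (x - 1) - 2 * cutoff e x =
    - (2 * e * (1 + e * x ^+ 2) + 2 * e ^+ 2 - 8 * e ^+ 2 * x ^+ 2) /
    ((1 + e * x ^+ 2) * ((1 + e * (x + 1) ^+ 2) * (1 + e * (x - 1) ^+ 2))).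
  by rewrite /cutoff; field; rewrite !gt_eqF.
have den0 : 0 < (1 + e * x ^+ 2) * ((1 + e * (x + 1) ^+ 2) * (1 + e * (x - 1) ^+ 2)).
  by rewrite !mulr_gt0.
rewrite normrM normrN normfV [X in _ / X]gtr0_norm//.
rewrite mulrAC ler_pdivrMr//.
have hn : `|2 * e * (1 + e * x ^+ 2) + 2 * e ^+ 2 - 8 * e ^+ 2 * x ^+ 2| <=
    10 * e * (1 + e * x ^+ 2).
  have ex : 0 <= e ^+ 2 * x ^+ 2 by rewrite mulr_ge0 ?sqr_ge0.
  have ee : e ^+ 2 <= e by rewrite expr2 ler_piMr// ltW.
  have ee0 := sqr_ge0 e.
  by rewrite ler_norml; apply/andP; split; nra.
have ey y : 0 <= e * y ^+ 2 by rewrite mulr_ge0 ?sqr_ge0// ltW.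
have hp : 1 + e * x ^+ 2 <= (1 + e * (x + 1) ^+ 2) * (1 + e * (x - 1) ^+ 2).
  have := mulr_ge0 (ey (x + 1)) (ey (x - 1)); have := ey x; nra.
set D := 1 + e * x ^+ 2 in D0 De hn hp *; set P := (X in D <= X) in hp *.
have x20 : 0 <= 1 + x ^+ 2 by rewrite addr_ge0 ?sqr_ge0.
apply: (@le_trans _ _ (10 * e * D * (1 + x ^+ 2))); first by rewrite ler_wpM2r.
have -> : 10 * e * D * (1 + x ^+ 2) = 10 * D * (e * (1 + x ^+ 2)) by ring.
rewrite -mulrA ler_pM2l// ler_wpM2l ?(ltW D0)//.
exact: le_trans De hp.
Qed.

End cutoff.

Section confining_potential.
Variables (R : realType) (d : R).
Hypothesis d0 : 0 < d.
Variables (W : int -> R) (M : R).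
Hypothesis Wsym : forall k, W (- k) = W k.
Let V := dlap d W.
Hypothesis V0 : forall k, 0 < V k.
Hypothesis VM : forall k, V k <= M.

Let b := d ^+ 2 * M.
Let d20 : 0 < d ^+ 2. Proof. exact: exprn_gt0. Qed.
Let VMn k : `|V k| <= M. Proof. by rewrite gtr0_norm. Qed.
Let M0 : 0 <= M. Proof. exact: le_trans (normr_ge0 _) (VMn 0). Qed.
Let b0 : 0 <= b. Proof. by rewrite mulr_ge0// ltW. Qed.

Lemma dlap_sym k : V (- k) = V k.
Proof.
rewrite /V /dlap Wsym -(Wsym (- k + 1)) -(Wsym (- k - 1)) !opprD !opprK.
by rewrite [W (k + 1) + _]addrC.
Qed.

Let Vdiff k : W (k + 1) - W k = W k - W (k - 1) + d ^+ 2 * V k.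
Proof. by rewrite /V /dlap; field; rewrite gt_eqF. Qed.

Let Wdiff_nat (n : nat) : `|W (n%:Z + 1) - W n%:Z| <= b * (n%:R + 1).
Proof.
elim: n => [|n IH].
  (* Symmetry gives [W (-1) = W 1], so the first increment is half of [d ^ 2 * V 0]; each further
     one adds at most [b]. *)
  have := Vdiff 0; rewrite !add0r Wsym => h.
  have e : W 1 - W 0 = d ^+ 2 * V 0 / 2 by lra.
  rewrite e mulr1 normrM normrM (gtr0_norm d20) (gtr0_norm (V0 0)).
  rewrite ger0_norm ?invr_ge0//; have : d ^+ 2 * V 0 <= b by rewrite ler_pM2l.
  have : 0 <= d ^+ 2 * V 0 by rewrite mulr_ge0 ?ltW.
  lra.
have := Vdiff n.+1%:Z; rewrite -addn1 PoszD addrK => ->.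
rewrite (le_trans (ler_normD _ _))// natrD mulrDr mulr1 lerD//.
by rewrite normrM (gtr0_norm d20) ler_pM2l.
Qed.

Lemma potential_diff k (j : int) : j = 1 \/ j = -1 ->
  `|W (k + j) - W k| <= b * (`|k%:~R| + 1).
Proof.
have pos (l : int) : `|W (l + 1) - W l| <= b * (`|l%:~R| + 1).
  case: l => n; first by rewrite normr_nat; exact: Wdiff_nat.
  have -> : Negz n + 1 = - n%:Z by rewrite NegzE -addn1 PoszD opprD subrK.
  rewrite NegzE !Wsym distrC -addn1 PoszD (le_trans (Wdiff_nat n))//.
  rewrite ler_wpM2l// lerD2r rmorphN normrN rmorphD/=.
  by apply: le_trans (ler_norm _); rewrite lerDl.
case=> ->; first exact: pos.
by rewrite -Wsym -[X in _ - X]Wsym opprD opprK (le_trans (pos _))// rmorphN normrN.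
Qed.

Lemma potential_growth k : `|W k| <= `|W 0| + b * k%:~R ^+ 2.
Proof.
have pos (n : nat) : `|W n%:Z| <= `|W 0| + b * n%:R ^+ 2.
  elim: n => [|n IH]; first by rewrite lerDl mulr_ge0 ?sqr_ge0.
  have -> : W n.+1%:Z = W n%:Z + (W (n%:Z + 1) - W n%:Z).
    by rewrite -addn1 PoszD; ring.
  have h := Wdiff_nat n; rewrite (le_trans (ler_normD _ _))//.
  have -> : n.+1%:R = n%:R + 1 :> R by rewrite -addn1 natrD.
  have n0 : 0 <= n%:R :> R by [].
  have bn : 0 <= b * n%:R by rewrite mulr_ge0.
  nra.
case: k => n; first exact: pos.
by rewrite NegzE Wsym mulrNz sqrrN; exact: pos.
Qed.

(** The signed counterpart of [Pdelta], stable under differences, on which convolution with the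
    quadratically growing [W] converges. *)
Let mom2 (f : int -> R) := zsummable f /\ zsummable (fun k => (k%:~R : R) ^+ 2 * f k).

Let mom2_shift f (l : int) : mom2 f -> mom2 (fun k => f (k + l)).
Proof.
move=> [s0 s2]; split; first exact: zsummable_shift.
have s1 := zsummable_moment1 s0 s2.
have := zsummableD (zsummableB s2 (zsummableZ (2 * l%:~R) s1))
  (zsummableZ (l%:~R ^+ 2) s0).
move=> /(zsummable_shift l); apply: eq_zsummable => k.
by rewrite rmorphD/=; ring.
Qed.

Let quad_summable f (C1 C2 : R) : mom2 f ->
  zsummable (fun k => (C1 + C2 * k%:~R ^+ 2) * `|f k|).
Proof.
move=> [/zsummable_norm s0 /zsummable_norm s2].
have := zsummableD (zsummableZ C1 s0) (zsummableZ C2 s2).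
by apply: eq_zsummable => k; rewrite normrM (ger0_norm (sqr_ge0 _)); ring.
Qed.

(* [W] grows quadratically and [z] need not have a second moment, so the
   summation by parts goes through a cutoff. *)
Lemma zsum_dlap_potential z : zsummable z ->
  zsummable (fun k => (k%:~R : R) ^+ 2 * dlap d z k) ->
  zsum (fun k => dlap d z k * W k) = zsum (fun k => z k * V k).
Proof.
move=> sz s2; have sdz : zsummable (dlap d z) by exact: zsummable_dlap.
pose e (n : nat) : R := n.+1%:R^-1.
have e0 n : 0 < e n by rewrite invr_gt0.
have e1 n : e n <= 1 by rewrite invf_le1// ler1n.
pose phi n k := cutoff (e n) k%:~R * W k.
have chi n (k : int) : 0 <= cutoff (e n) k%:~R <= 1.
  by rewrite cutoff_ge0 ?cutoff_le1.
have phib n k : `|phi n k| <= `|W 0| + b * n.+1%:R.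
  rewrite /phi normrM (ger0_norm (cutoff_ge0 _ (e0 n))) mulrC.
  rewrite ler_pdivrMr; last by rewrite ltr_pwDl// mulr_ge0 ?sqr_ge0// ltW.
  apply: (le_trans (potential_growth k)).
  set x := (k%:~R : R) ^+ 2; have x0 : 0 <= x by exact: sqr_ge0.
  have en : n.+1%:R * e n = 1 by rewrite /e mulfV.
  have : 0 <= `|W 0| * (e n * x) by rewrite mulr_ge0// mulr_ge0// (ltW (e0 n)).
  have : 0 <= b * n.+1%:R by rewrite mulr_ge0.
  have : b * n.+1%:R * (e n * x) = b * x by rewrite -mulrA [n.+1%:R * _]mulrA en mul1r.
  set A := `|W 0|; set B := b * n.+1%:R; set X := e n * x; nra.
have IPP n : zsum (fun k => dlap d z k * phi n k) = zsum (fun k => z k * dlap d (phi n) k).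
  have h f : zsummable f -> zsummable (fun k => f k * phi n k).
    by move=> sf; apply: eq_zsummable (zsummableM (phib n) sf) => k; rewrite mulrC.
  by have [] := @zsum_dlap R d z (phi n) (h _ sz) (h _ (zsummable_shift 1 sz))
    (h _ (zsummable_shift (-1) sz)).
have ec k : cutoff (e n) k%:~R @[n --> \oo] --> (1 : R).
  rewrite -[X in _ --> X](invr1 R) /cutoff; apply: cvgV; first exact: oner_neq0.
  rewrite -[X in _ --> X]addr0 -(mul0r (k%:~R ^+ 2)); apply: cvgD; first exact: cvg_cst.
  by apply: cvgMl; exact: cvg_harmonic.
have phic k : phi n k @[n --> \oo] --> W k.
  by rewrite -[X in _ --> X]mul1r; apply: cvgMl; exact: ec.
have L : zsum (fun k => dlap d z k * phi n k) @[n --> \oo] -->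
    zsum (fun k => dlap d z k * W k).
  apply: (zsum_dominated (g := fun k => (`|W 0| + b * k%:~R ^+ 2) * `|dlap d z k|)).
  - by move=> k; apply: cvgMr; exact: phic.
  - exact: quad_summable.
  - move=> n k; rewrite normrM mulrC ler_wpM2r// (le_trans _ (potential_growth k))//.
    rewrite normrM; have /andP[c0 c1] := chi n k; rewrite (ger0_norm c0).
    by rewrite ler_piMl.
(* The discrete Leibniz rule splits the second difference of [cutoff * W] into four terms, bounded
   by [b], [10 (|W 0| + b)], [4 b] and [4 b]. *)
pose C := (19 * b + 10 * `|W 0|) / d ^+ 2.
have Rr : zsum (fun k => z k * dlap d (phi n) k) @[n --> \oo] -->
    zsum (fun k => z k * V k).
  apply: (zsum_dominated (g := fun k => C * `|z k|)).
  - move=> k; apply: cvgMr; rewrite /V /dlap; apply: cvgMl; apply: cvgB.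
      by apply: cvgD; exact: phic.
    by apply: cvgMr; exact: phic.
  - exact/zsummableZ/zsummable_norm.
  - move=> n k; rewrite normrM mulrC ler_wpM2r// /dlap normrM.
    rewrite [X in _ * X]gtr0_norm ?invr_gt0// ler_pM2r ?invr_gt0//.
    have hp := @potential_diff k 1 (or_introl erefl).
    have hm := @potential_diff k (-1) (or_intror erefl).
    have hw := potential_growth k.
    have h2 : `|W (k + 1) + W (k - 1) - 2 * W k| <= b.
      have -> : W (k + 1) + W (k - 1) - 2 * W k = d ^+ 2 * V k.
        by rewrite /V /dlap; field; rewrite gt_eqF.
      by rewrite normrM (gtr0_norm d20) ler_pM2l.
    pose x : R := k%:~R.
    have cp := cutoff_diff x (e0 n) (e1 n) (or_introl erefl).
    have cm := cutoff_diff x (e0 n) (e1 n) (or_intror erefl).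
    have c2 := cutoff_diff2 x (e0 n) (e1 n).
    have /andP[c0 c1] := chi n k.
    rewrite /phi !rmorphD rmorphN/= -/x -/x.
    rewrite -/x in c0 c1 hp hm hw.
    move: cp cm c2 c0 c1 hp hm hw h2.
    set X := cutoff _ (x + 1); set Y := cutoff _ (x - 1); set Z := cutoff _ x.
    set p := W (k + 1); set q := W (k - 1); set r := W k.
    move=> cp cm c2 c0 c1 hp hm hw h2.
    have -> : X * p + Y * q - 2 * (Z * r) = Z * (p + q - 2 * r) +
       (X + Y - 2 * Z) * r + (X - Z) * (p - r) + (Y - Z) * (q - r) by ring.
    have t1 : `|Z * (p + q - 2 * r)| <= b.
      rewrite normrM (ger0_norm c0) (le_trans _ h2)// ler_piMl//.
    have t2 : `|(X + Y - 2 * Z) * r| <= 10 * (`|W 0| + b).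
      rewrite normrM; have n1 := normr_ge0 (X + Y - 2 * Z).
      apply: (@le_trans _ _ (`|X + Y - 2 * Z| * ((`|W 0| + b) * (1 + x ^+ 2)))).
        rewrite ler_wpM2l// (le_trans hw)//.
        have := mulr_ge0 (normr_ge0 (W 0)) (sqr_ge0 x); have := b0; nra.
      by rewrite mulrCA mulrC ler_wpM2r// addr_ge0.
    have t3 (u y : R) : `|u| * (1 + `|x|) <= 4 -> `|y| <= b * (`|x| + 1) ->
        `|u * y| <= 4 * b.
      move=> hu hy; rewrite normrM.
      apply: (@le_trans _ _ (`|u| * (b * (`|x| + 1)))); first by rewrite ler_wpM2l.
      by rewrite mulrCA mulrC [`|x| + 1]addrC ler_wpM2r.
    have t4 := t3 _ _ cp hp; have t5 := t3 _ _ cm hm.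
    rewrite (le_trans (ler_normD _ _))// -[leRHS]/(19 * b + 10 * `|W 0|).
    have := ler_normD (Z * (p + q - 2 * r) + (X + Y - 2 * Z) * r) ((X - Z) * (p - r)).
    have := ler_normD (Z * (p + q - 2 * r)) ((X + Y - 2 * Z) * r).
    lra.
have EQ : (fun n => zsum (fun k => dlap d z k * phi n k)) =
   (fun n => zsum (fun k => z k * dlap d (phi n) k)) by apply/funext.
rewrite EQ in L.
by have := cvg_unique _ L Rr; apply.
Qed.

Let kernel_summable g k : mom2 g -> zsummable (fun l => W (k - l) * g l).
Proof.
move=> mg; apply: zsummable_le (quad_summable (`|W 0| + 2 * b * k%:~R ^+ 2) (2 * b) mg) => l.
rewrite normrM ler_wpM2r// (le_trans (potential_growth _))//.
rewrite rmorphB/=; set x : R := k%:~R; set y : R := l%:~R.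
have := sqr_ge0 (x + y); have := b0; have := normr_ge0 (W 0); nra.
Qed.

Let mom2_Pdelta rho : Pdelta d rho -> mom2 rho.
Proof. by move=> P; split; [exact: Pdelta_summable P|exact: Pdelta_summable2 P]. Qed.

Lemma dlap_dconv_potential rho k : Pdelta d rho ->
  dlap d (dconv d W rho) k = dconv d V rho k.
Proof.
by move=> P; apply: dlap_dconv => // l; apply: kernel_summable; exact: mom2_Pdelta.
Qed.

Let double_summable f g : mom2 f -> mom2 g ->
  zsummable (fun k => zsum (fun l => `|d * (f k * (W (k - l) * g l))|)).
Proof.
move=> mf mg.
pose G0 := zsum (fun l => `|g l|); pose G2 := zsum (fun l => l%:~R ^+ 2 * `|g l|).
have sg := zsummable_norm mg.1.
have sg2 : zsummable (fun l => (l%:~R : R) ^+ 2 * `|g l|).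
  have := zsummable_norm mg.2; apply: eq_zsummable => l.
  by rewrite normrM (ger0_norm (sqr_ge0 _)).
apply: zsummable_le (quad_summable (d * (`|W 0| * G0 + 2 * b * G2)) (d * (2 * b * G0)) mf) => k.
rewrite ger0_norm; last exact: zsum_ge0.
have -> : (d * (`|W 0| * G0 + 2 * b * G2) + d * (2 * b * G0) * k%:~R ^+ 2) * `|f k| =
   zsum (fun l => (d * `|f k| * (`|W 0| + 2 * b * k%:~R ^+ 2)) * `|g l| +
   (d * `|f k| * (2 * b)) * (l%:~R ^+ 2 * `|g l|)).
  rewrite zsumD; [|exact: zsummableZ..]; rewrite !zsumZ// -/G0 -/G2; ring.
apply: ler_zsum.
- by apply/zsummable_norm/zsummableZ/zsummableZ; exact: kernel_summable.
- by apply: zsummableD; exact: zsummableZ.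
move=> l; rewrite !normrM (gtr0_norm d0).
have h : `|W (k - l)| <= `|W 0| + 2 * b * k%:~R ^+ 2 + 2 * b * l%:~R ^+ 2.
  rewrite (le_trans (potential_growth _))// rmorphB/=.
  set x : R := k%:~R; set y : R := l%:~R.
  have := sqr_ge0 (x + y); have := b0; have := normr_ge0 (W 0); nra.
have := ler_wpM2l (mulr_ge0 (mulr_ge0 (ltW d0) (normr_ge0 (f k))) (normr_ge0 (g l))) h.
by move=> h'; apply: le_trans (le_trans _ h') _; rewrite le_eqVlt; apply/orP; left; apply/eqP; ring.
Qed.

Let pairingE f g : mom2 f -> mom2 g ->
  zsum (fun k => f k * dconv d W g k) =
    zsum (fun k => zsum (fun l => d * (f k * (W (k - l) * g l)))) /\
  zsummable (fun k => f k * dconv d W g k).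
Proof.
move=> mf mg.
have E k : f k * dconv d W g k = zsum (fun l => d * (f k * (W (k - l) * g l))).
  have s := kernel_summable k mg.
  by rewrite dconvE zsumZ ?zsumZ//; [ring|exact: zsummableZ].
split; first exact: eq_zsum.
apply: zsummable_le (double_summable mf mg) => k; rewrite E ler_norm_zsum//.
by apply/zsummableZ/zsummableZ; exact: kernel_summable.
Qed.

Let pairing_exchange f g : mom2 f -> mom2 g ->
  zsum (fun k => f k * dconv d W g k) =
  zsum (fun l => zsum (fun k => d * (f k * (W (k - l) * g l)))).
Proof.
move=> mf mg; rewrite (pairingE mf mg).1 zsum_exchange//.
  by move=> k; apply/zsummableZ/zsummableZ; exact: kernel_summable.
exact: double_summable.
Qed.

Let pairing_sym f g : mom2 f -> mom2 g ->
  zsum (fun k => f k * dconv d W g k) = zsum (fun k => g k * dconv d W f k).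
Proof.
move=> mf mg; rewrite pairing_exchange// (pairingE mg mf).1.
apply: eq_zsum => l; apply: eq_zsum => k.
by rewrite -(Wsym (k - l)) opprB; ring.
Qed.

(** For each source [l] the family [z] translated by [l] falls under [zsum_dlap_potential]. Second
    moments are available for [dlap z] but not for [z]. *)
Let pairing_dlap z g : zsummable z -> mom2 (dlap d z) -> mom2 g ->
  zsum (fun k => dlap d z k * dconv d W g k) = zsum (fun k => z k * dconv d V g k).
Proof.
move=> sz mz mg; rewrite pairing_exchange//.
rewrite (dconv_sym d0 VMn dlap_sym mg.1 sz).
apply: eq_zsum => l.
transitivity (d * (g l * zsum (fun k => dlap d z (k + l) * W k))).
  rewrite -(zsum_shift l (fun k => d * (dlap d z k * (W (k - l) * g l)))).
  have sW : zsummable (fun k => dlap d z (k + l) * W k).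
    apply: zsummable_le (quad_summable `|W 0| b (mom2_shift l mz)) => k.
    by rewrite normrM mulrC ler_wpM2r//; exact: potential_growth.
  rewrite -!zsumZ//; last exact: zsummableZ.
  by apply: eq_zsum => k; rewrite addrK; ring.
have E k : dlap d z (k + l) = dlap d (fun k => z (k + l)) k.
  by rewrite /dlap (addrAC k l) (addrAC k l).
have -> : zsum (fun k => dlap d z (k + l) * W k) = zsum (fun k => z (k + l) * V k).
  rewrite -zsum_dlap_potential.
  - by apply: eq_zsum => k; rewrite E.
  - exact: zsummable_shift.
  - by apply: eq_zsummable (mom2_shift l mz).2 => k; rewrite E.
rewrite dconvE mulrCA; congr (_ * (_ * _)).
rewrite -(zsum_shift (- l) (fun k => z (k + l) * V k)).
by apply: eq_zsum => k; rewrite subrK mulrC -(dlap_sym (l - k)) opprB.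
Qed.

(** Polarisation of a symmetric quadratic form: the difference of its values is the pairing of
    [rho1 - rho0 = dlap z] with the sum of the potentials. The identity is exact, so the energy is
    never differentiated along a curve. *)
Lemma energy_diff rho0 rho1 z : Pdelta d rho0 -> Pdelta d rho1 -> zsummable z ->
  (forall k, rho1 k = rho0 k + dlap d z k) ->
  2 * (energy d W rho0 - energy d W rho1) =
  d * zsum (fun k => z k * (dconv d V rho0 k + dconv d V rho1 k)).
Proof.
move=> P0 P1 sz E; have m0 := mom2_Pdelta P0; have m1 := mom2_Pdelta P1.
have mz : mom2 (dlap d z).
  split; first exact: zsummable_dlap.
  by apply: eq_zsummable (zsummableB m1.2 m0.2) => k; rewrite E; ring.
have sr0 := m0.1; have sr1 := m1.1.
have sv g : zsummable g -> zsummable (fun k => z k * dconv d V g k).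
  move=> sg; have h k := dconv_bound d0 VMn k sg.
  by apply: eq_zsummable (zsummableM h sz) => k; rewrite mulrC.
have -> : zsum (fun k => z k * (dconv d V rho0 k + dconv d V rho1 k)) =
    zsum (fun k => z k * dconv d V rho0 k) + zsum (fun k => z k * dconv d V rho1 k).
  rewrite -zsumD; [|exact: sv..].
  by apply: eq_zsum => k; rewrite mulrDr.
rewrite -(pairing_dlap sz mz m0) -(pairing_dlap sz mz m1).
have Ed g : mom2 g -> zsum (fun k => dlap d z k * dconv d W g k) =
    zsum (fun k => rho1 k * dconv d W g k) - zsum (fun k => rho0 k * dconv d W g k).
  move=> mg; rewrite -zsumB; [|exact: (pairingE m1 mg).2|exact: (pairingE m0 mg).2].
  by apply: eq_zsum => k; rewrite E; ring.
by rewrite !Ed// (pairing_sym m1 m0) /energy; field.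
Qed.

End confining_potential.

Lemma integrableR_B d (T : measurableType d) (R : realType)
    (mu : {measure set T -> \bar R}) (D : set T) (f g : T -> R) : measurable D ->
  mu.-integrable D (EFin \o f) -> mu.-integrable D (EFin \o g) ->
  mu.-integrable D (EFin \o (fun x => f x - g x)).
Proof. by move=> mD hf hg; exact: (integrableB mD hf hg). Qed.

Section zsum_lebesgue.
Variable R : realType.
Local Notation mu := (@lebesgue_measure R).
Variables (t : R) (F : R -> int -> R) (g : R -> R).
Local Notation D := (`[0%R, t]%classic : set R).
Hypothesis mF : forall k, measurable_fun D (F ^~ k).
Hypothesis sF : forall s, s \in `[0%R, t] -> zsummable (F s).
Hypothesis ig : mu.-integrable D (EFin \o g).
Hypothesis Fg : forall s, s \in `[0%R, t] -> zsum (fun k => `|F s k|) <= g s.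

Lemma integrable_zsum_itv : mu.-integrable D (EFin \o (fun s => zsum (F s))).
Proof. exact: (@integrable_zsum R _ _ mu D F g). Qed.

Lemma integrable_zsum_term_itv k : mu.-integrable D (EFin \o (F ^~ k)).
Proof. exact: (@integrable_zsum_term R _ _ mu D F g). Qed.

Lemma zsummable_integral_itv : zsummable (fun k => \int[mu]_(s in D) F s k).
Proof. exact: (@zsummable_integral R _ _ mu D F g). Qed.

Lemma zsum_integral_itv :
  \int[mu]_(s in D) zsum (F s) = zsum (fun k => \int[mu]_(s in D) F s k).
Proof. exact: (@zsum_integral R _ _ mu D F g). Qed.

End zsum_lebesgue.

(** * Integrated flux, power and Euler shift along a curve *)

Section curve_calculus.
Variables (R : realType) (d : R).
Hypothesis d0 : 0 < d.
Local Notation mu := (@lebesgue_measure R).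
Local Notation I := (`[0%R, 1%R]%classic : set R).
Variables (W : int -> R) (M L1 L2 : R).
Hypothesis Wsym : forall k, W (- k) = W k.
Local Notation V := (dlap d W).
Local Notation K := (dlap d (dlap d W)).
Hypothesis V0 : forall k, 0 < V k.
Hypothesis VM : forall k, V k <= M.
Hypothesis KL1 : forall k, `|K k| <= L1.
Hypothesis VL2 : forall k, dlap d (fun j => V j ^+ 2) k <= L2 * V k.

Variables (a b : int -> R) (rho w c : R -> int -> R) (A : R).
Hypothesis hc : curve d a b rho w c A.

Let VMn k : `|V k| <= M. Proof. by rewrite gtr0_norm. Qed.
Let P s (sI : s \in `[0%R, 1%R]) : Pdelta d (rho s) := curve_Pdelta hc sI.
Let zeroI : 0 \in `[0%R, 1%R :> R]. Proof. by rewrite in_itv/= ler01 lexx. Qed.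
Let oneI : 1 \in `[0%R, 1%R :> R]. Proof. by rewrite in_itv/= ler01 lexx. Qed.

Let subI s : s \in `[0%R, 1%R] -> `[0%R, s] `<=` I.
Proof.
by rewrite in_itv/= => /andP[_ s1]; apply: subset_itvl; rewrite bnd_simp.
Qed.

Let sw s : s \in `[0%R, 1%R] -> zsummable (w s).
Proof.
move=> sI; apply: (flux_summable d0 (P sI)) (curve_summable hc sI) _ => k.
  exact: curve_ge0 hc _ _ sI.
exact: curve_bound hc _ _ sI.
Qed.

(** An integrable majorant of [zsum |w s|], from Young's inequality and [zsum rho = d^-1]; multiples
    of it dominate the exchanges of sum and integral below. *)
Let g s := (zsum (c s) + d^-1) / 2.

Let ig : mu.-integrable I (EFin \o g).
Proof.
have h : mu.-integrable I (EFin \o (fun s => 2^-1 * (zsum (c s) + d^-1))).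
  apply: integrableR_Z => //; apply: integrableR_D => //.
    exact: curve_integrable hc.
  exact: integrable_cst_itv.
by apply: eq_integrable h => // s _; rewrite /= mulrC.
Qed.

Let wg s : s \in `[0%R, 1%R] -> zsum (fun k => `|w s k|) <= g s.
Proof.
move=> sI; have sc := curve_summable hc sI; have sr := Pdelta_summable d0 (P sI).
rewrite /g -(Pdelta_zsum d0 (P sI)) mulrC -zsumD// -zsumZ; last exact: zsummableD.
apply: ler_zsum; [exact/zsummable_norm/sw|exact/zsummableZ/zsummableD|] => k.
rewrite mulrC; apply: (flux_norm_le (P sI)) => l.
  exact: curve_ge0 hc _ _ sI.
exact: curve_bound hc _ _ sI.
Qed.

Let mw := curve_measurable_w hc.

Let iw k : mu.-integrable I (EFin \o (w ^~ k)).
Proof. exact: (integrable_zsum_term_itv mw sw ig wg). Qed.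

Let g0 s : s \in `[0%R, 1%R] -> 0 <= g s.
Proof. by move=> sI; apply: le_trans (wg sI); exact: zsum_ge0. Qed.

(** The increment [rho s - rho 0] is the Laplacian of this summable family, which is the shape that
    [energy_diff] takes as input. *)
Definition flux_primitive s k : R := \int[mu]_(r in `[0%R, s]) w r k.
Local Notation z := flux_primitive.
Let Z k := \int[mu]_(r in I) `|w r k|.

Let sZ : zsummable Z.
Proof.
apply: (@zsummable_integral_itv R 1 (fun r k => `|w r k|) g) => //.
- by move=> k; apply: measurableT_comp => //; exact: mw.
- by move=> s sI; apply: zsummable_norm; exact: sw.
- move=> s sI; apply: le_trans (wg sI).
  by under eq_zsum do rewrite normr_id.
Qed.

Let zZ s k : s \in `[0%R, 1%R] -> `|z s k| <= Z k.
Proof. by move=> sI; exact: (primitive_bound (iw k)). Qed.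

Let sz s : s \in `[0%R, 1%R] -> zsummable (z s).
Proof. by move=> sI; apply: zsummable_le sZ => k; exact: zZ. Qed.

Let z_ac k : ac (z ^~ k) (w ^~ k).
Proof.
split; [exact: iw|move=> s sI].
by rewrite /z set_itv1 Rintegral_set1 add0r.
Qed.

Let rhoE s k : s \in `[0%R, 1%R] -> rho s k = rho 0 k + dlap d (z s) k.
Proof.
move=> sI; have [_ /(_ s sI) ->] := curve_ac hc k; congr (_ + _).
have iws l : mu.-integrable `[0%R, s] (EFin \o (w ^~ l)).
  by apply: integrableS (iw l) => //; exact: subI.
transitivity (\int[mu]_(r in `[0%R, s])
  ((d ^+ 2)^-1 * (w r (k + 1) + w r (k - 1) + (-2) * w r k))).
  by apply: eq_Rintegral => r _; rewrite /dlap mulrC mulNr.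
rewrite RintegralZl//; last first.
  by apply: integrableR_D => //; [exact: integrableR_D|exact: integrableR_Z].
rewrite RintegralD//; [|exact: integrableR_D|exact: integrableR_Z].
by rewrite RintegralD// RintegralZl// /dlap /z mulrC mulNr.
Qed.

Section kernel.
Variables (B : int -> R) (C : R).
Hypothesis BC : forall k, `|B k| <= C.

Let C0 : 0 <= C. Proof. exact: le_trans (normr_ge0 _) (BC 0). Qed.

Let iCg : mu.-integrable I (EFin \o (fun s => C * g s)).
Proof. exact: integrableR_Z. Qed.

Let mB k l : measurable_fun I (fun s => B (k - l) * w s l).
Proof. by apply: measurable_funM => //; exact: mw. Qed.

Let sB k s : s \in `[0%R, 1%R] -> zsummable (fun l => B (k - l) * w s l).
Proof. by move=> sI; apply: (zsummable_kernel BC); exact: sw. Qed.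

Let Bg k s : s \in `[0%R, 1%R] -> zsum (fun l => `|B (k - l) * w s l|) <= C * g s.
Proof.
move=> sI; apply: (@le_trans _ _ (C * zsum (fun l => `|w s l|))); last first.
  by rewrite ler_wpM2l// wg.
have sn := zsummable_norm (sw sI).
rewrite -zsumZ//; apply: ler_zsum; [exact/zsummable_norm/sB|exact: zsummableZ|].
by move=> l; rewrite normrM ler_wpM2r.
Qed.

Lemma integrable_dconv_flux k :
  mu.-integrable I (EFin \o (fun s => dconv d B (w s) k)).
Proof.
have h := integrable_zsum_itv (mB k) (sB k) iCg (Bg k).
have h2 : mu.-integrable I (EFin \o (fun s => d * zsum (fun l => B (k - l) * w s l))).
  exact: integrableR_Z.
by apply: eq_integrable h2 => // s _; rewrite /= dconvE.
Qed.

Lemma dconv_flux_primitive s k : s \in `[0%R, 1%R] ->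
  dconv d B (z s) k = \int[mu]_(r in `[0%R, s]) dconv d B (w r) k.
Proof.
move=> sI; have sub := subI sI.
have iCgs : mu.-integrable `[0%R, s] (EFin \o (fun s => C * g s)).
  by apply: integrableS iCg.
have mBs l : measurable_fun `[0%R, s] (fun s => B (k - l) * w s l).
  by apply: measurable_funS (mB k l).
have iws l : mu.-integrable `[0%R, s] (EFin \o (w ^~ l)).
  by apply: integrableS (iw l).
under eq_Rintegral do rewrite dconvE.
rewrite RintegralZl//; last first.
  apply: (integrable_zsum_itv mBs _ iCgs) => r /sub rI.
    exact: sB.
  exact: Bg.
rewrite (zsum_integral_itv mBs _ iCgs); last 2 first.
- by move=> r /sub rI; exact: sB.
- by move=> r /sub rI; exact: Bg.
rewrite dconvE; congr (_ * _); apply: eq_zsum => l.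
by rewrite RintegralZl.
Qed.

End kernel.

Local Notation v := (fun s k => dconv d V (rho s) k).
Local Notation u := (fun s k => dconv d K (w s) k).

Let sr s (sI : s \in `[0%R, 1%R]) : zsummable (rho s) := Pdelta_summable d0 (P sI).

Let vE s k : s \in `[0%R, 1%R] -> v s k = v 0 k + dconv d K (z s) k.
Proof.
move=> sI; have sdz := zsummable_dlap d (sz sI).
rewrite -(dconv_dlap d VMn k (sz sI)) -(dconvDr d VMn _ (sr zeroI) sdz).
by congr (dconv d V _ k); apply/funext => l; rewrite -rhoE.
Qed.

(** Moving the Laplacian from the integrated flux to the kernel replaces [V] by the bounded kernel
    [K], so the derivative of the velocity is [K * w], with no Laplacian left on [w]. *)
Lemma velocity_ac k : ac (fun s => v s k) (fun s => u s k).
Proof.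
split; first exact: integrable_dconv_flux KL1 k.
by move=> s sI; rewrite vE// (dconv_flux_primitive KL1).
Qed.

Let vMn s k : s \in `[0%R, 1%R] -> `|v s k| <= M.
Proof. by move=> sI; exact: velocity_norm VM _ (P sI) k. Qed.

Let mv k := ac_measurable (velocity_ac k).
Let mu_ k : measurable_fun I (fun s => u s k).
Proof. exact: integrable_measurable (integrable_dconv_flux KL1 k). Qed.

Let M0 : 0 <= M. Proof. exact: le_trans (normr_ge0 _) (VMn 0). Qed.
Let L10 : 0 <= L1. Proof. exact: le_trans (normr_ge0 _) (KL1 0). Qed.

Section weighted_flux.
Variable f : R -> int -> R.
Hypothesis mf : forall k, measurable_fun I (f ^~ k).
Hypothesis fM : forall s k, s \in `[0%R, 1%R] -> `|f s k| <= M.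

Let F s k := w s k * f s k.
Let mF k : measurable_fun I (F ^~ k).
Proof. by apply: measurable_funM; [exact: mw|exact: mf]. Qed.
Let sF s : s \in `[0%R, 1%R] -> zsummable (F s).
Proof.
move=> sI; have h := zsummableM (fun k => fM k sI) (sw sI).
by apply: eq_zsummable h => k; rewrite /F mulrC.
Qed.
Let iMg : mu.-integrable I (EFin \o (fun s => M * g s)).
Proof. exact: integrableR_Z. Qed.
Let Fg s : s \in `[0%R, 1%R] -> zsum (fun k => `|F s k|) <= M * g s.
Proof.
move=> sI; apply: (@le_trans _ _ (M * zsum (fun l => `|w s l|))); last first.
  by rewrite ler_wpM2l// wg.
have sn := zsummable_norm (sw sI).
rewrite -zsumZ//; apply: ler_zsum; [exact/zsummable_norm/sF|exact: zsummableZ|].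
by move=> l; rewrite normrM mulrC ler_wpM2r// fM.
Qed.

Lemma summable_weighted s : s \in `[0%R, 1%R] -> zsummable (fun k => w s k * f s k).
Proof. exact: sF. Qed.

Lemma integrable_weighted :
  mu.-integrable I (EFin \o (fun s => zsum (fun k => w s k * f s k))).
Proof. exact: integrable_zsum_itv mF sF iMg Fg. Qed.

Lemma integrable_weighted_term k :
  mu.-integrable I (EFin \o (fun s => w s k * f s k)).
Proof. exact: integrable_zsum_term_itv mF sF iMg Fg k. Qed.

(** The weight is general because [integral_power] uses it twice: for the velocity and for the
    velocity frozen at time [0]. *)
Lemma integral_weighted : \int[mu]_(s in I) zsum (fun k => w s k * f s k) =
  zsum (fun k => \int[mu]_(s in I) (w s k * f s k)).
Proof. exact: zsum_integral_itv mF sF iMg Fg. Qed.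

End weighted_flux.

(** The chain rule for the energy. Integration by parts in time gives, site by site, the integral of
    [w v] as [z 1 * v 1] minus the integral of [z u]. Symmetry of [K] turns the sum of [z u] into
    that of [w (K * z) = w (v s - v 0)], so the unknown power reappears. *)
Lemma integral_power : d * \int[mu]_(s in I) zsum (fun k => w s k * v s k) =
  energy d W a - energy d W b.
Proof.
have mv0 k : measurable_fun I (fun _ : R => v 0 k) by [].
have v0M (s : R) k : s \in `[0%R, 1%R] -> `|v 0 k| <= M by move=> _; exact: vMn.
set PP := \int[mu]_(s in I) _.
pose G s k := z s k * u s k.
have mz k := ac_measurable (z_ac k).
have mG k : measurable_fun I (G ^~ k).
  by apply: measurable_funM; [exact: mz|exact: mu_].
have uL s k : s \in `[0%R, 1%R] -> `|u s k| <= L1 * d * g s.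
  move=> sI; apply: (le_trans (dconv_bound d0 KL1 k (sw sI))).
  by rewrite -mulrA ler_wpM2l// ler_pM2l// wg.
have sG s : s \in `[0%R, 1%R] -> zsummable (G s).
  move=> sI; apply: eq_zsummable (zsummableM (fun k => uL s k sI) (sz sI)) => k.
  by rewrite mulrC.
have iGg : mu.-integrable I (EFin \o (fun s => (L1 * d * zsum Z) * g s)).
  exact: integrableR_Z.
have Z0 k : 0 <= Z k by exact: Rintegral_ge0.
have Gg s : s \in `[0%R, 1%R] -> zsum (fun k => `|G s k|) <= (L1 * d * zsum Z) * g s.
  move=> sI; have -> : (L1 * d * zsum Z) * g s = (L1 * d * g s) * zsum Z by ring.
  rewrite -(zsumZ (L1 * d * g s) sZ); apply: ler_zsum; [exact/zsummable_norm/sG|exact: zsummableZ|].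
  move=> k; rewrite normrM mulrC ler_pM//; [exact: uL|exact: zZ].
have iG k := integrable_zsum_term_itv mG sG iGg Gg k.
have term k : \int[mu]_(s in I) (w s k * v s k) =
    z 1 k * v 1 k - \int[mu]_(s in I) G s k.
  have [_ /(_ 1 oneI)] := acM (z_ac k) (velocity_ac k).
  rewrite /= RintegralD; [|by []|exact: (integrable_weighted_term mv (@vMn) k)|exact: iG].
  have -> : z 0 k = 0 by rewrite /z set_itv1 Rintegral_set1.
  by rewrite mul0r add0r => ->; rewrite addrK.
have sz1 := sz oneI.
have sz1v s : s \in `[0%R, 1%R] -> zsummable (fun k => z 1 k * v s k).
  move=> sI; apply: eq_zsummable (zsummableM (fun k => vMn k sI) sz1) => k.
  by rewrite mulrC.
have GE s : s \in `[0%R, 1%R] -> zsum (G s) =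
    zsum (fun k => w s k * v s k) - zsum (fun k => w s k * v 0 k).
  move=> sI.
  have Ksym k : K (- k) = K k by apply: dlap_sym; exact: dlap_sym.
  rewrite /G (dconv_sym d0 KL1 Ksym (sw sI) (sz sI)).
  rewrite -zsumB; [|exact: (summable_weighted (@vMn))|exact: (summable_weighted v0M)].
  by apply: eq_zsum => k; rewrite (vE k sI); ring.
have intG : \int[mu]_(s in I) zsum (G s) = PP - zsum (fun k => z 1 k * v 0 k).
  transitivity (\int[mu]_(s in I) (zsum (fun k => w s k * v s k) -
     zsum (fun k => w s k * v 0 k))).
    by apply: eq_Rintegral => s /set_mem sI; rewrite GE.
  rewrite RintegralB//; [|exact: (integrable_weighted mv (@vMn))|
    exact: (integrable_weighted mv0 v0M)].
  rewrite (integral_weighted mv0 v0M); congr (_ - _); apply: eq_zsum => k.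
  by rewrite RintegralZr.
(* [PP] occurs on both sides; solving for it yields the trapezoidal expression of [energy_diff]. *)
have PPE : PP = zsum (fun k => z 1 k * v 1 k) - (PP - zsum (fun k => z 1 k * v 0 k)).
  rewrite -intG {1}/PP (integral_weighted mv (@vMn)).
  rewrite (zsum_integral_itv mG sG iGg Gg).
  rewrite -zsumB; [|exact: sz1v|exact: (zsummable_integral_itv mG sG iGg Gg)].
  by apply: eq_zsum => k; rewrite term.
have PP2 : 2 * PP = zsum (fun k => z 1 k * (v 0 k + v 1 k)).
  rewrite (@eq_zsum _ _ (fun k => z 1 k * v 0 k + z 1 k * v 1 k)); last first.
    by move=> k; rewrite mulrDr.
  rewrite zsumD; [|exact: sz1v..].
  by lra.
have := @energy_diff R d d0 W M Wsym V0 VM (rho 0) (rho 1) (z 1) (P zeroI) (P oneI)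
  sz1 (fun k => rhoE k oneI).
rewrite -PP2 (curve_start hc) (curve_end hc) => h.
by apply: (@mulfI _ 2) => //; rewrite h; ring.
Qed.

Variable t : R.
Hypotheses (t0 : 0 <= t) (tM : 4 * t * M <= d ^+ 2).

Let x01 (s : R) : s \in `[0%R, 1%R] -> 0 <= 1 - s <= 1.
Proof. by rewrite in_itv/= => /andP[s0 s1]; rewrite subr_ge0 s1 gerBl. Qed.

Let rho' s := euler_density d V (rho s) t (1 - s).
Let w' s := euler_flux d V (rho s) (w s) t (1 - s).
Let c' s := euler_cost d V (rho s) (w s) (c s) t (1 - s).

Lemma euler_curve : curve d (euler_density d V a t 1) b rho' w' c'
  ((1 + t * (2 * L1 + L2) + 4 * t ^+ 2 * L1 ^+ 2) * A + 4 * t ^+ 2 * M ^+ 2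
   + 2 * t * (energy d W b - energy d W a)).
Proof.
have c0 s k : s \in `[0%R, 1%R] -> 0 <= c s k by exact: curve_ge0 hc s k.
have wc s k : s \in `[0%R, 1%R] -> w s k ^+ 2 <= c s k * rho s k.
  exact: curve_bound hc s k.
have sc s : s \in `[0%R, 1%R] -> zsummable (c s) by exact: curve_summable hc s.
have mr k := ac_measurable (curve_ac hc k).
have ms : measurable_fun I (fun s : R => 1 - s).
  by apply: measurable_funB => //; exact: measurable_cst.
have mc := curve_measurable_c hc.
have mdw k : measurable_fun I (fun s => dlap d (w s) k).
  by case: (curve_ac hc k) => /integrable_measurable.
have mw' k : measurable_fun I (w' ^~ k).
  apply: measurable_funD; first apply: measurable_funB.
  - exact: mw.
  - apply: measurable_funM => //; apply: measurable_funM; [exact: mr|exact: mv].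
  - apply: measurable_funM; first by apply: measurable_funM.
    apply: measurable_funD; apply: measurable_funM.
    + exact: mdw.
    + exact: mv.
    + exact: mr.
    + exact: mu_.
have mb : measurable_fun I (fun s : R => (1 - s) * t / d ^+ 2).
  by apply: measurable_funM => //; apply: measurable_funM.
have my k : measurable_fun I (fun s => (1 - s) * u s k - v s k).
  by apply: measurable_funB; [apply: measurable_funM => //; exact: mu_|exact: mv].
have mcv k : measurable_fun I (fun s => c s k / v s k).
  apply: measurable_funM; first exact: mc.
  apply: measurable_fun_inv; last exact: mv.
  by move=> s sI; apply: ltW; exact: velocity_gt0 (P sI) k.
have mc' k : measurable_fun I (c' ^~ k).
  rewrite /c' /euler_cost.
  apply: measurable_funD; first apply: measurable_funD; first apply: measurable_funD.
  - apply: measurable_funM; last exact: mc.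
    apply: measurable_funB => //; apply: measurable_funM; last exact: mv.
    by apply: measurable_funM.
  - apply: measurable_funM => //; apply: measurable_funM; [exact: mw|exact: my].
  - apply: measurable_funM => //; apply: measurable_funM; first exact: mr.
    by apply: measurable_funX; exact: my.
  - apply: measurable_funM.
      apply: measurable_funM => //; apply: measurable_funX; exact: mv.
    by apply: measurable_funD; exact: mcv.
have sc' s : s \in `[0%R, 1%R] -> zsummable (c' s).
  move=> sI; apply: (euler_summable d0 V0 VM KL1 VL2 t (P sI)) => //.
  - by move=> k; exact: c0.
  - exact: sc.
  - by move=> k; exact: wc.
  - exact: x01.
have c'0 s k : s \in `[0%R, 1%R] -> 0 <= c' s k.
  move=> sI; apply: (euler_cost_ge0 d0 V0 VM (P sI)) => //.
  - by move=> l; exact: c0.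
  - by move=> l; exact: wc.
  - exact: x01.
pose up s := (1 + t * (2 * L1 + L2) + 4 * t ^+ 2 * L1 ^+ 2) * (d * zsum (c s)) +
  4 * t ^+ 2 * M ^+ 2 - 2 * t * (d * zsum (fun k => w s k * v s k)).
have c'up s : s \in `[0%R, 1%R] -> d * zsum (c' s) <= up s.
  move=> sI; apply: (euler_cost_sum d0 V0 VM KL1 VL2 (P sI)) => //.
  - by move=> l; exact: c0.
  - exact: sc.
  - by move=> l; exact: wc.
  - exact: x01.
have i1 : mu.-integrable I (EFin \o (fun s => d * zsum (c s))).
  by apply: integrableR_Z => //; exact: curve_integrable hc.
have i2 : mu.-integrable I (EFin \o (fun s => d * zsum (fun k => w s k * v s k))).
  by apply: integrableR_Z => //; exact: (integrable_weighted mv (@vMn)).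
set C1 := 1 + _ + _ in up c'up *.
have i3 : mu.-integrable I (EFin \o (fun s => C1 * (d * zsum (c s)))).
  exact: integrableR_Z.
have i4 : mu.-integrable I (EFin \o (fun s => 2 * t * (d * zsum (fun k => w s k * v s k)))).
  exact: integrableR_Z.
have i5 : mu.-integrable I (EFin \o (fun s => C1 * (d * zsum (c s)) + 4 * t ^+ 2 * M ^+ 2)).
  by apply: integrableR_D => //; exact: integrable_cst_itv.
have iup : mu.-integrable I (EFin \o up) by exact: integrableR_B.
have ic' : mu.-integrable I (EFin \o (fun s => d * zsum (c' s))).
  apply: (@integrable_le _ _ R mu I _ _ up) => //.
    by apply: measurable_funM => //; exact: measurable_zsum.
  move=> s sI; rewrite ger0_norm; first exact: c'up.
  by rewrite mulr_ge0 ?(ltW d0)// zsum_ge0// => k; exact: c'0.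
have ic'' : mu.-integrable I (EFin \o (fun s => zsum (c' s))).
  have h : mu.-integrable I (EFin \o (fun s => d^-1 * (d * zsum (c' s)))).
    exact: integrableR_Z.
  apply: eq_integrable h => // s _.
  by rewrite /= mulrA mulVf ?mul1r// gt_eqF.
split.
- move=> s sI; apply: (euler_Pdelta d0 V0 VM (P sI)) => //.
  exact: x01.
- by rewrite /rho' subr0 (curve_start hc).
- apply/funext => k; rewrite /rho' subrr (curve_end hc) /euler_density.
  by rewrite !mul0r addr0.
- exact: c'0.
- move=> s k sI; apply: (euler_bound d0 V0 VM (P sI)) => //.
  + by move=> l; exact: c0.
  + by move=> l; exact: wc.
  + exact: x01.
- exact: mw'.
- exact: mc'.
- move=> k.
  have af l := acM (curve_ac hc l) (velocity_ac l).
  have adf := ac_dlap d k af.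
  have ax : ac (fun s : R => t - t * s) (fun s => 0 - t * 1).
    by apply: acB; [exact: ac_cst|exact: (acZ t (@ac_id R))].
  have := acD (curve_ac hc k) (acM ax adf); apply: eq_ac => s sI.
    by rewrite /rho' /euler_density; congr (_ + _ * _); ring.
  by rewrite /w' /euler_flux /dlap; ring.
- exact: sc'.
- exact: ic''.
rewrite -RintegralZl//.
apply: (@le_trans _ _ (\int[mu]_(s in I) up s)).
  by apply: le_Rintegral => // s sI; exact: c'up.
rewrite /up RintegralB// RintegralD//; last exact: integrable_cst_itv.
rewrite [X in _ + X - _]Rintegral_cst_itv// mulr1.
rewrite [X in X + _ - _]RintegralZl// [X in X + _ - _]mulrC RintegralZl//; last first.
  exact: curve_integrable hc.
rewrite [X in _ - X]RintegralZl// [X in _ - _ * X]RintegralZl//; last first.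
  exact: (integrable_weighted mv (@vMn)).
rewrite integral_power [X in X + _ - _]mulrC.
(* [curve_action] is only an upper bound for the action, so the factor in front of it must be
   nonnegative. *)
have C10 : 0 <= C1.
  rewrite /C1 addr_ge0 ?mulr_ge0 ?sqr_ge0// addr_ge0// mulr_ge0//.
  exact: (Lambda_ge0 d0 V0 KL1 VL2).
have := ler_wpM2l C10 (curve_action hc).
set X := d * _; lra.
Qed.

End curve_calculus.

(** * The initial layer of the flow *)

Lemma lipschitz_within_continuous (R : realType) (A : set R) (f : R -> R) (L : R) :
  (forall x y, A x -> A y -> `|f x - f y| <= L * `|x - y|) ->
  {within A, continuous f}.
Proof.
move=> fL; apply/subspace_continuousP => x Ax.
apply/cvgrPdist_le => e e0; rewrite near_withinE.
pose L' := `|L| + 1; have L0 : 0 < L' by rewrite ltr_wpDl.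
have eL : 0 < e / L' by rewrite divr_gt0.
near=> y => Ay; rewrite (le_trans (fL _ _ Ax Ay))//.
have xy : `|x - y| <= e / L'.
  by near: y; apply: (@cvgr_dist_le _ _ _ _ _ id) => //.
rewrite (@le_trans _ _ (L' * `|x - y|))//.
  by rewrite ler_wpM2r// (le_trans (ler_norm L))// lerDl.
by rewrite -ler_pdivlMl// mulrC.
Unshelve. all: by end_near. Qed.

Lemma is_derive_affineM (R : realType) (u : R -> R) (du c x z : R) :
  is_derive z 1 u du -> is_derive z 1 (fun y => (1 + c * (y - x)) * u y)
    ((1 + c * (z - x)) * du + u z * c).
Proof.
move=> hu.
have h1 : is_derive z 1 ((id : R -> R) - cst x) (1 - 0) by exact: is_deriveB.
have h2 : is_derive z 1 ((cst 1 : R -> R) + c *: ((id : R -> R) - cst x)) (0 + c *: (1 - 0)).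
  by apply: is_deriveD; exact: is_deriveZ.
have h3 := is_deriveM h2 hu.
by apply: (is_derive_eq h3); rewrite /GRing.scale/= add0r subr0 mulr1.
Qed.

Section initial_layer.
Variables (R : realType) (d : R).
Hypothesis d0 : 0 < d.
Variables (r X q : int -> R) (e : R).
Hypotheses (Pr : Pdelta d r) (PX : Pdelta d X) (sq : zsummable q).
Hypothesis rE : forall k, r k = X k + dlap d q k.
Hypothesis qe : forall k, `|q k| <= e * r k.
Hypothesis e0 : 0 <= e.

(* The quadratic profile [(1 - s)^2] lets the density stay above [(1 - s)^2 r],
   so that no lower bound on the target [X] is needed. *)
Lemma initial_curve : curve d r X
  (fun s k => (1 - s) ^+ 2 * r k + (1 - (1 - s) ^+ 2) * X k)
  (fun s k => 2 * (s - 1) * q k) (fun _ k => 4 * e * `|q k|)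
  (4 * e * (d * zsum (fun k => `|q k|))).
Proof.
have r0 k : 0 <= r k by case: Pr.
have X0 k : 0 <= X k by case: PX.
have x01 (s : R) : s \in `[0%R, 1%R] -> 0 <= (1 - s) ^+ 2 <= 1.
  rewrite in_itv/= => /andP[s0 s1]; rewrite sqr_ge0/= expr_le1// ?gerBl//.
  by rewrite subr_ge0.
have sqn := zsummable_norm sq.
split.
- by move=> s sI; apply: Pdelta_convex => //; exact: x01.
- by apply/funext => k; rewrite subr0 expr1n subrr mul1r mul0r addr0.
- by apply/funext => k; rewrite subrr expr0n/= mul0r subr0 mul1r add0r.
- by move=> s k _; rewrite !mulr_ge0.
- move=> s k sI; have /andP[y0 y1] := x01 s sI.
  have -> : (2 * (s - 1) * q k) ^+ 2 = 4 * (1 - s) ^+ 2 * q k ^+ 2 by ring.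
  rewrite -[q k ^+ 2]real_normK ?num_real//.
  have h1 : `|q k| ^+ 2 <= `|q k| * (e * r k) by rewrite expr2 ler_wpM2l.
  have h2 : 0 <= e * `|q k| * ((1 - (1 - s) ^+ 2) * X k).
    by rewrite !mulr_ge0// subr_ge0.
  have h3 := ler_wpM2l y0 h1.
  move: h2 h3; set x := `|q k|; set y := (1 - s) ^+ 2 => h2 h3.
  have -> : 4 * e * x * (y * r k + (1 - y) * X k) =
    4 * (y * (x * (e * r k))) + 4 * (e * x * ((1 - y) * X k)) by ring.
  by rewrite -mulrA; lra.
- move=> k; apply: measurable_funM => //; apply: measurable_funM => //.
  by apply: measurable_funB => //; exact: measurable_cst.
- by move=> k; exact: measurable_cst.
- move=> k.
  have a1 : ac (fun s : R => 1 - s) (fun=> 0 - 1).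
    by apply: acB; [exact: ac_cst|exact: ac_id].
  have := acD (ac_cst (X k)) (acZ (dlap d q k) (acM a1 a1)).
  apply: eq_ac => s _; first by rewrite rE; ring.
  by rewrite /dlap; ring.
- by move=> s _; exact: zsummableZ.
- exact: integrable_cst_itv.
rewrite Rintegral_cst_itv// mulr1 zsumZ//.
by rewrite le_eqVlt; apply/orP; left; apply/eqP; ring.
Qed.

End initial_layer.

(** * Short-time estimates for the flow *)

Section flow.
Variables (R : realType) (d : R).
Hypothesis d0 : 0 < d.
Local Notation mu := (@lebesgue_measure R).
Variables (W : int -> R) (M : R).
Hypothesis Wsym : forall k, W (- k) = W k.
Local Notation V := (dlap d W).
Hypothesis V0 : forall k, 0 < V k.
Hypothesis VM : forall k, V k <= M.
Variable S : R -> (int -> R) -> (int -> R).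
Hypothesis hS : generated_semigroup d W S.
Variable a : int -> R.
Hypothesis Pa : Pdelta d a.

Let VMn k : `|V k| <= M. Proof. by rewrite gtr0_norm. Qed.
Let M0 : 0 <= M. Proof. exact: le_trans (normr_ge0 _) (VMn 0). Qed.
Let r (x : R) := S x a.
Let v (x : R) := dconv d V (r x).
Let g (x : R) k := r x k * v x k.
(** An upper bound for the rate at which mass leaves a site, by [v <= M]. *)
Let C := 2 * M / d ^+ 2.
Let d20 : 0 < d ^+ 2. Proof. exact: exprn_gt0. Qed.
Let C0 : 0 <= C. Proof. by rewrite divr_ge0 ?(ltW d20)// mulr_ge0. Qed.

Let P (x : R) : 0 <= x -> Pdelta d (r x).
Proof. by case: hS => _ h _ _ _; exact: h. Qed.
Let r00 : r 0 = a. Proof. by case: hS => h _ _ _ _; exact: h. Qed.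
Let r_ge0 (x : R) k : 0 <= x -> 0 <= r x k. Proof. by move=> /P[]. Qed.
Let sr (x : R) (x0 : 0 <= x) : zsummable (r x) := Pdelta_summable d0 (P x0).
Let vM (x : R) k : 0 <= x -> `|v x k| <= M.
Proof. by move=> x0; exact: velocity_norm VM _ (P x0) k. Qed.
Let v_ge0 (x : R) k : 0 <= x -> 0 <= v x k.
Proof. by move=> x0; apply: ltW; exact: velocity_gt0 VM _ (P x0) k. Qed.
Let v_le (x : R) k : 0 <= x -> v x k <= M.
Proof. by move=> x0; apply: le_trans (vM k x0); exact: ler_norm. Qed.
Let g_ge0 (x : R) k : 0 <= x -> 0 <= g x k.
Proof. by move=> x0; rewrite mulr_ge0 ?r_ge0 ?v_ge0. Qed.
Let g_le (x : R) k : 0 <= x -> g x k <= M * r x k.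
Proof. by move=> x0; rewrite /g mulrC ler_wpM2r ?r_ge0 ?v_le. Qed.

Let rhsE (x : R) k : 0 <= x -> rhs d W (r x) k = dlap d (g x) k.
Proof.
move=> x0; rewrite /rhs; congr (dlap d _ k); apply/funext => l.
by rewrite (dlap_dconv_potential d0 Wsym V0 VM l (P x0)).
Qed.

Let flow_derive k (x : R) : 0 < x ->
  is_derive x 1 (fun y : R => r y k) (dlap d (g x) k).
Proof.
move=> x0; case: hS => _ _ _ _ /(_ a k x Pa x0)[h1 h2].
apply: DeriveDef => //; rewrite -derive1E h2; exact/rhsE/ltW.
Qed.

Let dlap_lower (x : R) k : 0 <= x -> - (C * r x k) <= dlap d (g x) k.
Proof.
move=> x0; rewrite /dlap ler_pdivlMr// /C.
have -> : - (2 * M / d ^+ 2 * r x k) * d ^+ 2 = - (2 * (M * r x k)).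
  by field; rewrite gt_eqF.
have := g_ge0 (k + 1) x0; have := g_ge0 (k - 1) x0; have := g_le k x0; lra.
Qed.

Let flow_within (x y : R) k : 0 <= x -> x < y -> {within `[x, y], continuous (fun z => r z k)}.
Proof.
move=> x0 xy.
have der z : 0 < z -> {for z, continuous (fun z => r z k)}.
  move=> z0; apply: differentiable_continuous; apply/derivable1_diffP.
  by have [] := flow_derive k z0.
apply/continuous_within_itvP => //; split.
- move=> z; rewrite in_itv/= => /andP[xz _]; apply: der; exact: le_lt_trans xz.
- move: x0; rewrite le_eqVlt => /orP[/eqP <-|xp]; last first.
    by apply: cvg_at_right_filter; exact: der.
  by rewrite r00; case: hS => _ _ _ h _; exact: h.
- by apply: cvg_at_left_filter; apply: der; exact: le_lt_trans xy.
Qed.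

(** From [r' >= - C r]. The affine factor [1 + u], with [u = 2 C (z - x)], replaces the exponential:
    the derivative of the product is at least [C r (1 - u)], nonnegative as long as [u <= 1]. *)
Lemma flow_decay (x y : R) k : 0 <= x -> x <= y -> 2 * C * (y - x) <= 1 ->
  r x k <= (1 + 2 * C * (y - x)) * r y k.
Proof.
move=> x0; rewrite le_eqVlt => /orP[/eqP -> _|xy h].
  by rewrite subrr mulr0 addr0 mul1r.
pose f z := (1 + 2 * C * (z - x)) * r z k.
pose df z := (1 + 2 * C * (z - x)) * dlap d (g z) k + r z k * (2 * C).
have [z zI||z] := @MVT R f df x y xy.
- have z0 : 0 < z by move: zI; rewrite in_itv/= => /andP[/(le_lt_trans x0)].
  exact/is_derive_affineM/flow_derive.
- move=> z; apply: cvgM; last exact: (flow_within x0 xy).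
  apply: cvgD; first exact: cvg_cst.
  apply: cvgM; first exact: cvg_cst.
  apply: cvgB; last exact: cvg_cst.
  have : {within `[x, y], continuous (id : R -> R)}.
    by apply: continuous_subspaceT => ?; exact: cvg_id.
  exact.
rewrite in_itv/= => /andP[xz zy]; rewrite /f subrr mulr0 addr0 mul1r => E.
have z0 : 0 <= z by exact: le_trans (ltW xz).
suff : 0 <= df z * (y - x) by rewrite -E subr_ge0.
rewrite mulr_ge0//; last by rewrite subr_ge0 ltW.
have r0 := r_ge0 k z0; have low := dlap_lower k z0.
have b1 : 0 <= 2 * C * (z - x) by rewrite mulr_ge0 ?(mulr_ge0 _ C0)// subr_ge0 ltW.
have b2 : 2 * C * (z - x) <= 1.
  apply: le_trans h; rewrite ler_wpM2l ?(mulr_ge0 _ C0)// lerD2r; exact: ltW.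
have Cr : 0 <= C * r z k := mulr_ge0 C0 r0.
rewrite /df; move: b1 b2 low Cr; set u := 2 * C * (z - x); set D := dlap _ _ _.
set w := C * r z k => b1 b2 low Cr.
have -> : r z k * (2 * C) = 2 * w by rewrite /w; ring.
have : (1 + u) * - w <= (1 + u) * D by rewrite ler_wpM2l// addr_ge0.
have : u * w <= w by rewrite ler_piMl.
lra.
Qed.

(** The one-sided bound [flow_decay] suffices: [z <= 2 p] and [p >= 0] give [|z| <= 4 p - z], and
    [z] sums to zero because mass is conserved. *)
Lemma flow_lipschitz (x y : R) : 0 <= x -> x <= y -> 2 * C * (y - x) <= 1 ->
  zsum (fun k => `|r x k - r y k|) <= 4 * C / d * (y - x).
Proof.
move=> x0 xy h; have y0 := le_trans x0 xy.
have sx := sr x0; have sy := sr y0.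
have s1 := zsummableZ (4 * C * (y - x)) sy; have s2 := zsummableB sx sy.
apply: (@le_trans _ _ (zsum (fun k => 4 * C * (y - x) * r y k - (r x k - r y k)))).
  apply: ler_zsum; [exact: zsummable_norm|exact: zsummableB|move=> k].
  have := flow_decay k x0 xy h; have := r_ge0 k y0.
  have u0 : 0 <= C * (y - x) by rewrite mulr_ge0// subr_ge0.
  move=> ry0 dec.
  have ur : 0 <= C * (y - x) * r y k by rewrite mulr_ge0.
  have -> : 4 * C * (y - x) * r y k = 4 * (C * (y - x) * r y k) by ring.
  have : r x k - r y k <= 2 * (C * (y - x) * r y k) by lra.
  set z := r x k - r y k; set p := C * (y - x) * r y k => zp.
  by rewrite ler_norml; apply/andP; split; move: ur; rewrite -/p; lra.
rewrite zsumB// zsumB// zsumZ// (Pdelta_zsum d0 (P x0)) (Pdelta_zsum d0 (P y0)).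
by rewrite subrr subr0 le_eqVlt; apply/orP; left; apply/eqP; ring.
Qed.

Lemma flow_velocity_lipschitz (x y : R) k : 0 <= x -> x <= y -> 2 * C * (y - x) <= 1 ->
  `|v x k - v y k| <= 4 * C * M * (y - x).
Proof.
move=> x0 xy h; have y0 := le_trans x0 xy.
rewrite /v -(dconvBr d VMn k (sr x0) (sr y0)).
have s2 := zsummableB (sr x0) (sr y0).
rewrite (le_trans (dconv_bound d0 VMn k s2))//.
have -> : 4 * C * M * (y - x) = M * (d * (4 * C / d * (y - x))).
  by field; rewrite gt_eqF.
by rewrite ler_wpM2l// ler_pM2l//; exact: flow_lipschitz.
Qed.

Let g_diff (x y : R) k : 0 <= x -> 0 <= y ->
  `|g x k - g y k| <= M * `|r x k - r y k| + r y k * `|v x k - v y k|.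
Proof.
move=> x0 y0; have -> : g x k - g y k = v x k * (r x k - r y k) + r y k * (v x k - v y k).
  by rewrite /g; ring.
rewrite (le_trans (ler_normD _ _))// (normrM (v x k)) (normrM (r y k)) lerD//.
  by rewrite ler_wpM2r//; exact: vM.
by rewrite ger0_norm// r_ge0.
Qed.

(** The pointwise version provides the continuity in time that the fundamental theorem of calculus
    asks for; the summed version that follows sets the order of the defect [q]. *)
Lemma flow_mobility_lipschitz (x y : R) k : 0 <= x -> x <= y -> 2 * C * (y - x) <= 1 ->
  `|g x k - g y k| <= 8 * C * M / d * (y - x).
Proof.
move=> x0 xy h; have y0 := le_trans x0 xy.
have h1 : `|r x k - r y k| <= 4 * C / d * (y - x).
  apply: le_trans (flow_lipschitz x0 xy h).
  apply: (@ler_zsum_term _ (fun k => `|r x k - r y k|)) => //.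
  by apply/zsummable_norm/zsummableB; exact: sr.
have h2 := flow_velocity_lipschitz k x0 xy h.
rewrite (le_trans (g_diff k x0 y0))//.
have -> : 8 * C * M / d * (y - x) =
   M * (4 * C / d * (y - x)) + d^-1 * (4 * C * M * (y - x)) by ring.
rewrite lerD ?ler_wpM2l// ler_pM// ?r_ge0//; exact: Pdelta_le (P y0).
Qed.

Lemma flow_mobility_lipschitz1 (x y : R) : 0 <= x -> x <= y -> 2 * C * (y - x) <= 1 ->
  zsum (fun k => `|g x k - g y k|) <= 8 * C * M / d * (y - x).
Proof.
move=> x0 xy h; have y0 := le_trans x0 xy.
have sn : zsummable (fun k => `|r x k - r y k|).
  by apply/zsummable_norm/zsummableB; exact: sr.
have sg z : 0 <= z -> zsummable (g z).
  move=> z0; apply: zsummable_le (zsummableZ M (sr z0)) => k.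
  by rewrite ger0_norm ?g_ge0// g_le.
have s1 := zsummableZ M sn; have s2 := zsummableZ (4 * C * M * (y - x)) (sr y0).
apply: (@le_trans _ _ (zsum (fun k => M * `|r x k - r y k| +
   4 * C * M * (y - x) * r y k))).
  apply: ler_zsum; [|exact: zsummableD|].
    by apply/zsummable_norm/zsummableB; exact: sg.
  move=> k; rewrite (le_trans (g_diff k x0 y0))// lerD2l mulrC ler_wpM2r ?r_ge0//.
  exact: flow_velocity_lipschitz.
rewrite zsumD// (zsumZ _ sn) (zsumZ _ (sr y0)) (Pdelta_zsum d0 (P y0)).
have -> : 8 * C * M / d * (y - x) =
   M * (4 * C / d * (y - x)) + 4 * C * M * (y - x) * d^-1 by ring.
by rewrite lerD2r ler_wpM2l//; exact: flow_lipschitz.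
Qed.

Variable t : R.
Hypotheses (t0 : 0 < t) (tC : 2 * C * t <= 1).

Let small (x y : R) : 0 <= x -> y <= t -> 2 * C * (y - x) <= 1.
Proof.
move=> x0 yt; apply: le_trans tC; apply: ler_wpM2l; first exact: mulr_ge0.
by rewrite (le_trans _ yt)// gerBl.
Qed.

Let g_lip k (x y : R) : `[0%R, t]%classic x -> `[0%R, t]%classic y ->
  `|g x k - g y k| <= 8 * C * M / d * `|x - y|.
Proof.
move=> /=; rewrite !in_itv/= => /andP[x0 xt] /andP[y0 yt].
wlog xy : x y x0 xt y0 yt / x <= y.
  by move=> H; case: (leP x y) => [|/ltW] xy; [|rewrite distrC [`|x - y|]distrC]; exact: H.
rewrite [`|x - y|]distrC (ger0_norm (_ : 0 <= y - x)) ?subr_ge0//.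
by apply: flow_mobility_lipschitz => //; exact: small.
Qed.

Let dlap_continuous k : {within `[0%R, t], continuous (fun x => dlap d (g x) k)}.
Proof.
pose L := 8 * C * M / d.
apply: (@lipschitz_within_continuous _ _ _ (4 * L / d ^+ 2)) => x y xI yI.
have h l := g_lip l xI yI.
have -> : dlap d (g x) k - dlap d (g y) k = ((g x (k + 1) - g y (k + 1)) +
  (g x (k - 1) - g y (k - 1)) - 2 * (g x k - g y k)) / d ^+ 2 by rewrite /dlap; ring.
rewrite normrM [X in _ * X]gtr0_norm ?invr_gt0// mulrAC ler_pM2r ?invr_gt0//.
rewrite (le_trans (ler_normB _ _))// normrM [`|2|]ger0_norm//.
have := ler_normD (g x (k + 1) - g y (k + 1)) (g x (k - 1) - g y (k - 1)).
have := h (k + 1); have := h (k - 1); have := h k; rewrite -/L; lra.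
Qed.

Let g_measurable k : measurable_fun `[0%R, t] (fun x => g x k).
Proof.
apply: subspace_continuous_measurable_fun => //.
exact: (lipschitz_within_continuous (@g_lip k)).
Qed.

Let g_bound (x : R) k : `[0%R, t]%classic x -> `|g x k| <= M / d.
Proof.
move=> /=; rewrite in_itv/= => /andP[x0 xt]; rewrite ger0_norm ?g_ge0//.
rewrite (le_trans (g_le k x0))// ler_wpM2l//; exact: Pdelta_le (P x0).
Qed.

Let g_integrable k : mu.-integrable `[0%R, t] (EFin \o (fun x => g x k)).
Proof.
apply: (@integrable_le _ _ R mu _ _ _ (fun=> M / d)) => //.
- exact: g_measurable.
- by move=> x xI; exact: g_bound.
- exact: integrable_cst_itv.
Qed.

Let q k := \int[mu]_(x in `[0%R, t]) (g x k - g 0 k).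

Let qE k : q k = \int[mu]_(x in `[0%R, t]) g x k - g 0 k * t.
Proof.
rewrite /q RintegralB//; last exact: integrable_cst_itv.
by rewrite Rintegral_cst_itv// ltW.
Qed.

Let X := euler_density d V a t 1.

Lemma flow_expansion k : r t k = X k + dlap d q k.
Proof.
(* The equation holds for positive times only; the initial condition supplies right continuity at
   [0], which is enough here. *)
have FTC : \int[mu]_(x in `[0%R, t]) dlap d (g x) k = r t k - r 0 k.
  rewrite /Rintegral (@continuous_FTC2 _ _ (fun z => r z k) 0 t t0)//.
  - have /continuous_within_itvP[//|c1 c2 c3] := flow_within (k := k) (lexx 0) t0.
    split => // z; rewrite in_itv/= => /andP[z0 _].
    by have [] := flow_derive k z0.
  - move=> z; rewrite in_itv/= => /andP[z0 _].
    by rewrite derive1E; have [_ ->] := flow_derive k z0.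
have E : \int[mu]_(x in `[0%R, t]) dlap d (g x) k =
    dlap d (fun l => \int[mu]_(x in `[0%R, t]) g x l) k.
  transitivity (\int[mu]_(x in `[0%R, t])
    ((d ^+ 2)^-1 * (g x (k + 1) + g x (k - 1) + (-2) * g x k))).
    by apply: eq_Rintegral => x _; rewrite /dlap mulrC mulNr.
  rewrite RintegralZl//; last first.
    by apply: integrableR_D => //; [exact: integrableR_D|exact: integrableR_Z].
  rewrite RintegralD//; [|exact: integrableR_D|exact: integrableR_Z].
  by rewrite RintegralD// RintegralZl// /dlap mulrC mulNr.
have : r t k = r 0 k + dlap d (fun l => \int[mu]_(x in `[0%R, t]) g x l) k.
  by rewrite -E FTC; ring.
rewrite r00 => ->; rewrite /X /euler_density.
have -> : (fun j => a j * dconv d V a j) = g 0.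
  by apply/funext => j; rewrite /g /v r00.
rewrite /dlap !qE; move: (Rintegral _ _) => J; move: (g 0) => G; ring.
Qed.

Let t_in (x : R) : x \in `[0%R, t] -> 0 <= x /\ x <= t.
Proof. by rewrite in_itv/= => /andP[]. Qed.

(** Both [g x] and [g 0] lie between [0] and [2 M r t], by [flow_decay] with a factor at most [2].
    The comparison is with the final time because the layer starts at [S t a]. *)
Lemma flow_defect_le k : `|q k| <= 2 * M * t * r t k.
Proof.
have bd x : x \in `[0%R, t] -> g x k <= 2 * M * r t k.
  move=> /t_in[x0 xt]; rewrite (le_trans (g_le k x0))//.
  rewrite [2 * M]mulrC -mulrA ler_wpM2l//.
  rewrite (le_trans (flow_decay k x0 xt (small x0 (lexx t))))//.
  rewrite ler_wpM2r ?r_ge0 ?(ltW t0)//.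
  by have := small x0 (lexx t); lra.
have zI : 0 \in `[0%R, t] by rewrite in_itv/= lexx ltW.
have ig : mu.-integrable `[0%R, t] (EFin \o (fun x => g x k - g 0 k)).
  by apply: integrableR_B => //; exact: integrable_cst_itv.
rewrite (le_trans (le_normr_Rintegral _ ig))//.
have -> : 2 * M * t * r t k = \int[mu]_(x in `[0%R, t]) (2 * M * r t k).
  by rewrite Rintegral_cst_itv ?ltW//; ring.
apply: le_Rintegral => //.
- exact: integrable_norm.
- exact: integrable_cst_itv.
- move=> x xI; have [x0 _] := t_in xI.
  have := bd x xI; have := bd 0 zI; have := g_ge0 k x0; have := g_ge0 k (lexx 0).
  by rewrite ler_norml => *; apply/andP; split; lra.
Qed.

(** One factor [t] is the length of the time interval, the other comes from the Lipschitz continuity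
    of [g] in time. *)
Lemma flow_defect_sum : zsummable q /\
  zsum (fun k => `|q k|) <= 8 * C * M / d * t ^+ 2.
Proof.
pose F x k := `|g x k - g 0 k|.
have mF k : measurable_fun `[0%R, t] (F ^~ k).
  by apply: measurableT_comp => //; apply: measurable_funB => //; exact: g_measurable.
have sg z : 0 <= z -> zsummable (g z).
  move=> z0; apply: zsummable_le (zsummableZ M (sr z0)) => k.
  by rewrite ger0_norm ?g_ge0// g_le.
have sF x : x \in `[0%R, t] -> zsummable (F x).
  by move=> /t_in[x0 xt]; apply/zsummable_norm/zsummableB; exact: sg.
pose B := 8 * C * M / d * t.
have iB : mu.-integrable `[0%R, t] (EFin \o (fun=> B : R)) by exact: integrable_cst_itv.
have FB x : x \in `[0%R, t] -> zsum (fun k => `|F x k|) <= B.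
  move=> /t_in[x0 xt].
  have -> : zsum (fun k => `|F x k|) = zsum (fun k => `|g 0 k - g x k|).
    by apply: eq_zsum => k; rewrite normr_id distrC.
  have sm : 2 * C * (x - 0) <= 1 by apply: small.
  rewrite (le_trans (flow_mobility_lipschitz1 (lexx 0) x0 sm))// subr0.
  apply: ler_wpM2l => //; apply: divr_ge0; last exact: ltW.
  by rewrite mulr_ge0// mulr_ge0.
have sI := zsummable_integral_itv mF sF iB FB.
have EI := zsum_integral_itv mF sF iB FB.
have ig k : mu.-integrable `[0%R, t] (EFin \o (fun x => g x k - g 0 k)).
  by apply: integrableR_B => //; exact: integrable_cst_itv.
have qF k : `|q k| <= \int[mu]_(x in `[0%R, t]) F x k.
  exact: le_normr_Rintegral.
have sq : zsummable q by exact: zsummable_le sI.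
split => //; apply: (@le_trans _ _ (zsum (fun k => \int[mu]_(x in `[0%R, t]) F x k))).
  by apply: ler_zsum => //; exact: zsummable_norm.
rewrite -EI; have -> : 8 * C * M / d * t ^+ 2 = \int[mu]_(x in `[0%R, t]) B.
  by rewrite Rintegral_cst_itv ?ltW// /B; ring.
apply: le_Rintegral => //; first exact: integrable_zsum_itv mF sF iB FB.
move=> x xI; apply: le_trans (FB x xI).
by apply: ler_zsum; [exact: sF|exact/zsummable_norm/sF|] => k; exact: ler_norm.
Qed.

Lemma flow_initial_curve : exists rho w c,
  curve d (S t a) (euler_density d V a t 1) rho w c (64 * C * M ^+ 2 * t ^+ 3).
Proof.
have [sq zq] := flow_defect_sum.
have tM : 4 * t * M <= d ^+ 2.
  move: tC; rewrite /C.
  have -> : 2 * (2 * M / d ^+ 2) * t = 4 * t * M / d ^+ 2 by ring.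
  by rewrite ler_pdivrMr// mul1r.
have PX : Pdelta d X.
  by apply: (euler_Pdelta d0 V0 VM Pa (ltW t0) tM); rewrite ler01 lexx.
have e0 : 0 <= 2 * M * t by rewrite !mulr_ge0// ltW.
have h := initial_curve d0 (P (ltW t0)) PX sq flow_expansion flow_defect_le e0.
do 3 eexists; apply: le_curve h.
(* The factor [4] of [initial_curve], the pointwise bound with constant [2 M t], and the summed
   bound with constant [8]. *)
have -> : 64 * C * M ^+ 2 * t ^+ 3 =
   4 * (2 * M * t) * (d * (8 * C * M / d * t ^+ 2)) by field; rewrite gt_eqF.
rewrite ler_wpM2l//; first by rewrite mulr_ge0.
by rewrite ler_pM2l.
Qed.

End flow.

(** * The evolution variational inequality *)

Lemma limf_esup_le (R : realType) (f : R -> \bar R) (F : set_system R) (x : \bar R) :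
  (\forall t \near F, (f t <= x)%E) -> (limf_esup f F <= x)%E.
Proof.
move=> fx; rewrite limf_esupE.
apply: (@le_trans _ _ (ereal_sup (f @` [set t | (f t <= x)%E]))).
  by apply: ereal_inf_lbound; exists [set t | (f t <= x)%E].
by apply: ge_ereal_sup => _ [t ft <-].
Qed.

(* [B] is the action of the Euler-shifted curve and [G t^3 / (z t)] that of the
   initial layer, run during the time fraction [z t]. *)
Lemma concat_action_estimate (R : realFieldType) (D L E L1 M G z t B : R) :
  0 <= D -> 0 <= L -> 0 <= G -> 0 < z -> 0 < t -> t <= 1 -> 2 * (z * t) <= 1 ->
  B = (1 + t * L + 4 * t ^+ 2 * L1 ^+ 2) * (D + t ^+ 2)
      + 4 * t ^+ 2 * M ^+ 2 + 2 * t * E ->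
  G * t ^+ 3 / (z * t) + B / (1 - z * t) <=
  D + 2 * t * (L * D / 2 + E
    + t * (G / z + (4 * L1 ^+ 2 * (D + 1) + (1 + L) + 4 * M ^+ 2))
    + z * ((1 + L + 4 * L1 ^+ 2) * (D + 1) + 4 * M ^+ 2 + 2 * `|E|)).
Proof.
move=> D0 L0 G0 z0 t0 t1 zt BE; set K := 4 * _ * _ + _ + _; set N := _ + 2 * `|E|.
have l0 : 0 <= L1 ^+ 2 by exact: sqr_ge0.
have m0 : 0 <= M ^+ 2 by exact: sqr_ge0.
have t20 : 0 <= t ^+ 2 by exact: sqr_ge0.
have t21 : t ^+ 2 <= 1 by rewrite expr_le1// ltW.
have e0 : 0 < z * t by rewrite mulr_gt0.
have -> : G * t ^+ 3 / (z * t) = t ^+ 2 * (G / z) by field; rewrite !gt_eqF.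
(* Powers of [t] above the second are absorbed into [t ^ 2] by [t <= 1]. *)
have BK : B <= D + t * (L * D) + 2 * t * E + t ^+ 2 * K.
  have h1 : t ^+ 2 * (t * L) <= t ^+ 2 * L by rewrite ler_wpM2l// ler_piMl.
  have h2 : t ^+ 2 * (t ^+ 2 * L1 ^+ 2) <= t ^+ 2 * L1 ^+ 2.
    by rewrite ler_wpM2l// ler_piMl.
  by rewrite BE /K; lra.
(* [E] may be negative, which leaves the sign of [B] open, so its absolute value is bounded before
   the division by [1 - z t]. *)
have BN : `|B| <= N.
  rewrite BE /N (le_trans (ler_normD _ _))// lerD//; last first.
    rewrite normrM ler_wpM2r// ger0_norm; last by rewrite mulr_ge0// ltW.
    by rewrite ger_pMr.
  have h1 : 0 <= t * L by rewrite mulr_ge0// ltW.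
  have h2 : 0 <= 4 * t ^+ 2 * L1 ^+ 2 by apply: mulr_ge0 => //; exact: mulr_ge0.
  have h3 : t * L <= L by rewrite ler_piMl.
  have h4 : 4 * t ^+ 2 * L1 ^+ 2 <= 4 * L1 ^+ 2 by rewrite -mulrA ler_pM2l// ler_piMl.
  have h5 : 4 * t ^+ 2 * M ^+ 2 <= 4 * M ^+ 2 by rewrite -mulrA ler_pM2l// ler_piMl.
  rewrite ger0_norm; last first.
    by apply: addr_ge0; apply: mulr_ge0; rewrite ?addr_ge0// mulr_ge0.
  by rewrite lerD// ler_pM ?addr_ge0//; lra.
have e1 : 0 < 1 - z * t by lra.
(* For [y = z t <= 1 / 2], [B y <= N y <= 2 y N (1 - y)]. *)
have Be : B / (1 - z * t) <= B + 2 * (z * t) * N.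
  rewrite ler_pdivrMr// mulrDl.
  have h1 : B * (z * t) <= N * (z * t).
    by rewrite ler_pM2r// (le_trans (ler_norm _) BN).
  have N0 : 0 <= N by exact: le_trans BN.
  have h2 : 0 <= z * t * N * (1 - 2 * (z * t)).
    by rewrite mulr_ge0 ?subr_ge0// (mulr_ge0 (ltW e0)).
  by move: h1 h2; set y := z * t; lra.
have lD : 0 <= L1 ^+ 2 * (D + 1) by rewrite mulr_ge0// addr_ge0.
have K0 : 0 <= t ^+ 2 * K by rewrite mulr_ge0// /K; lra.
have Gz : 0 <= t ^+ 2 * (G / z) by rewrite mulr_ge0// divr_ge0// ltW.
have -> : D + 2 * t * (L * D / 2 + E + t * (G / z + K) + z * N) =
  D + t * (L * D) + 2 * t * E + 2 * (t ^+ 2 * (G / z)) + 2 * (t ^+ 2 * K)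
  + 2 * (z * t) * N by field; rewrite gt_eqF.
by lra.
Qed.

Section contraction.
Variables (R : realType) (d : R) (W : int -> R) (S : R -> (int -> R) -> (int -> R)).
Hypothesis d0 : 0 < d.
Hypothesis Wsym : forall k, W (- k) = W k.
Local Notation V := (dlap d W).
Hypothesis V0 : forall k, 0 < V k.
Variables M L1 L2 : R.
Hypothesis VM : forall k, V k <= M.
Hypothesis KL1 : forall k, `|dlap d V k| <= L1.
Hypothesis VL2 : forall k, dlap d (fun j => V j ^+ 2) k <= L2 * V k.
Hypothesis hS : generated_semigroup d W S.
Variables rb eb : int -> R.
Hypothesis Prb : Pdelta d rb.
Hypothesis Dfin : (D2 d rb eb < +oo)%E.

Let D := fine (D2 d rb eb).
Let L := 2 * L1 + L2.
Let E := energy d W eb - energy d W rb.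
Let G := 64 * (2 * M / d ^+ 2) * M ^+ 2.

Let DE : D2 d rb eb = D%:E.
Proof. by rewrite fineK// ge0_fin_numE// D2_ge0. Qed.

Let D_ge0 : 0 <= D. Proof. exact/fine_ge0/D2_ge0. Qed.

Lemma D2_flow_le z t : 0 < z -> 0 < t -> t <= 1 -> 2 * (z * t) <= 1 ->
  4 * t * M <= d ^+ 2 ->
  (D2 d (S t rb) eb <= (D + 2 * t * (L * D / 2 + E
    + t * (G / z + (4 * L1 ^+ 2 * (D + 1) + (1 + L) + 4 * M ^+ 2))
    + z * ((1 + L + 4 * L1 ^+ 2) * (D + 1) + 4 * M ^+ 2 + 2 * `|E|)))%:E)%E.
Proof.
move=> z0 t0 t1 zt tM.
have L0 : 0 <= L by exact: (Lambda_ge0 d0 V0 KL1 VL2).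
(* A nearly optimal curve with slack [t ^ 2], which still vanishes after division by [2 t]. *)
have : (D2 d rb eb < (D + t ^+ 2)%:E)%E by rewrite DE lte_fin ltrDl exprn_gt0.
move=> /(D2_curve d0)[rho [w [c hc]]].
have h2 := euler_curve d0 Wsym V0 VM KL1 VL2 hc (ltW t0) tM.
have tC : 2 * (2 * M / d ^+ 2) * t <= 1.
  have -> : 2 * (2 * M / d ^+ 2) * t = 4 * t * M / d ^+ 2 by ring.
  by rewrite ler_pdivrMr ?mul1r// exprn_gt0.
have [rho1 [w1 [c1 h1]]] := flow_initial_curve d0 Wsym V0 VM hS Prb t0 tC.
have zt01 : 0 < z * t < 1 by rewrite mulr_gt0//=; lra.
have [rho3 [w3 [c3 h3]]] := curve_concat zt01 h1 h2.
apply: (le_trans (curve_D2 d0 h3)); rewrite lee_fin.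
apply: concat_action_estimate => //.
have M0 : 0 <= M by exact/ltW/(lt_le_trans (V0 0)).
by rewrite /G !mulr_ge0 ?sqr_ge0// ?invr_ge0 ?sqr_ge0.
Qed.

Lemma flow_EVI : (limf_esup (fun t : R =>
    ((D2 d (S t rb) eb - D2 d rb eb) * ((2 * t)^-1)%:E)%E) 0^'+
  <= (L * D / 2 + E)%:E)%E.
Proof.
have L0 : 0 <= L by exact: (Lambda_ge0 d0 V0 KL1 VL2).
have M0 : 0 < M by exact: lt_le_trans (V0 0) (VM 0).
apply/lee_addgt0Pr => e e0; rewrite -EFinD.
pose N := (1 + L + 4 * L1 ^+ 2) * (D + 1) + 4 * M ^+ 2 + 2 * `|E|.
have l0 := sqr_ge0 L1; have m0 := sqr_ge0 M.
have D1 : 0 <= D + 1 by rewrite addr_ge0.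
have lD : 0 <= L1 ^+ 2 * (D + 1) by exact: mulr_ge0.
have N0 : 0 <= N.
  have LD : 0 <= (1 + L) * (D + 1) by rewrite mulr_ge0// addr_ge0.
  by have := normr_ge0 E; rewrite /N; lra.
(* [z] is fixed by [e] before [t] is made small, because [H] contains [G / z]; the two halves of [e]
   pay for [z N] and [t H]. The summand [1] avoids a division by zero. *)
pose z := e / (2 * (N + 1)).
have N1 : 0 < N + 1 by rewrite ltr_wpDl.
have z0 : 0 < z by rewrite divr_gt0// mulr_gt0.
have zN : z * N <= e / 2.
  have -> : e / 2 = z * (N + 1) by rewrite /z; field; rewrite gt_eqF.
  by rewrite ler_pM2l// lerDl.
pose H := G / z + (4 * L1 ^+ 2 * (D + 1) + (1 + L) + 4 * M ^+ 2).
have H0 : 0 < H + 1.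
  rewrite ltr_wpDl// /H /G addr_ge0//.
    by rewrite divr_ge0 ?(ltW z0)// !mulr_ge0 ?sqr_ge0// ?invr_ge0 ?sqr_ge0// ltW.
  by lra.
have M4 : 0 < 4 * M by rewrite mulr_gt0.
have z2 : 0 < 2 * z by rewrite mulr_gt0.
have H2 : 0 < 2 * (H + 1) by rewrite mulr_gt0.
have d20 : 0 < d ^+ 2 by rewrite exprn_gt0.
apply: limf_esup_le; near=> t.
have t0 : 0 < t by near: t; exact: nbhs_right_gt.
have t1 : t <= 1 by near: t; exact: nbhs_right_le.
have tz : 2 * (z * t) <= 1.
  have : t <= (2 * z)^-1 by near: t; apply: nbhs_right_le; rewrite invr_gt0.
  by rewrite -[(2 * z)^-1]div1r ler_pdivlMr//; lra.
have tM : 4 * t * M <= d ^+ 2.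
  have : t <= d ^+ 2 / (4 * M) by near: t; apply: nbhs_right_le; rewrite divr_gt0.
  by rewrite ler_pdivlMr//; lra.
have tH : t * H <= e / 2.
  have : t <= e / (2 * (H + 1)) by near: t; apply: nbhs_right_le; rewrite divr_gt0.
  by rewrite ler_pdivlMr//; lra.
have := D2_flow_le z0 t0 t1 tz tM; rewrite -/H -/N => h.
have i0 : 0 < (2 * t)^-1 by rewrite invr_gt0 mulr_gt0.
apply: (@le_trans _ _ ((2 * t * (L * D / 2 + E + e))%:E * ((2 * t)^-1)%:E)%E).
  rewrite lee_wpmul2r ?lee_fin ?(ltW i0)// DE leeBlDr// -EFinD.
  rewrite (le_trans h)// lee_fin addrC lerD2r.
  by rewrite ler_pM2l ?mulr_gt0//; lra.
rewrite -EFinM lee_fin mulrC mulrA mulVf ?mul1r//.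
by rewrite gt_eqF// mulr_gt0.
Unshelve. all: by end_near. Qed.

End contraction.

Theorem theorem1p3 (R : realType) (d : R) (W : int -> R)
    (S : R -> (int -> R) -> (int -> R)) :
  0 < d ->
  (forall k, W (- k) = W k) ->
  (forall k, 0 < dlap d W k) ->
  has_ubound (range (dlap d W)) ->
  has_ubound (range (fun k => `| dlap d (dlap d W) k |)) ->
  has_ubound (range (fun k => dlap d (fun j => (dlap d W j) ^+ 2) k / dlap d W k)) ->
  generated_semigroup d W S ->
  lambda_contractive d (- Lambda d W) S (energy d W).

Proof.
move=> d0 Wsym V0 [M VM] uK uV hS rb eb Prb _ Dfin.
have VM' k : dlap d W k <= M by apply: VM; exists k.
set L1 := sup (range (fun k => `|dlap d (dlap d W) k|)).
set L2 := sup (range (fun k => dlap d (fun j => (dlap d W j) ^+ 2) k / dlap d W k)).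
have KL1 k : `|dlap d (dlap d W) k| <= L1 by apply: ub_le_sup => //; exists k.
have VL2 k : dlap d (fun j => dlap d W j ^+ 2) k <= L2 * dlap d W k.
  by rewrite -ler_pdivrMr//; apply: ub_le_sup => //; exists k.
have h := flow_EVI d0 Wsym V0 VM' KL1 VL2 hS Prb Dfin.
apply: (le_trans (leeD2r _ h)); rewrite -EFinD lee_fin /Lambda -/L1 -/L2.
by rewrite le_eqVlt; apply/orP; left; apply/eqP; ring.
Qed.
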